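(* Let $c\neq0$ and let $M$ be a connected mixed-totally geodesic proper CR-submanifold of maximal CR-dimension in the complex space form $\hat M_n(c)$. Let $N\in\Gamma(J\mathcal D^\perp)$ be a unit vector field normal to $M$, $\xi=-JN$, let $\phi X$ be the tangential part of $JX$ for $X$ tangent to $M$, let $A_N$ be the shape operator of $M$ with respect to $N$, and let $\alpha=\langle h(\xi,\xi),N\rangle$. Then (a) $2A_N\phi A_N-\alpha(\phi A_N+A_N\phi)-2c\phi=0$; (b) if $A_NY=\lambda Y$ and $A_N\phi Y=\lambda^*\phi Y$, where $Y\in\Gamma(\mathcal D)$, then $(2\lambda-\alpha)(2\lambda^*-\alpha)=\alpha^2+4c$ (at points where $Y\neq0$); (c) $\alpha$ is a constant.
   Context: $\hat M_n(c)$ denotes an $n$-dimensional complex space form: a complete, simply connected Kaehler manifold of complex dimension $n$ with constant holomorphic sectional curvature $4c$; $J$ is its complex structure and $\langle\,,\rangle$ its metric (also the induced one on $M$). Its curvature tensor is $\hat R(X,Y)Z=c(X\wedge Y+JX\wedge JY-2\langle JX,Y\rangle J)Z$, where $(X\wedge Y)Z=\langle Y,Z\rangle X-\langle X,Z\rangle Y$. CR-submanifolds: let $M$ be an isometrically immersed submanifold of a Kaehler manifold, with normal bundle $TM^\perp$. For $x\in M$ put $\mathcal D_x=T_xM\cap JT_xM$. $M$ is generic if $\dim\mathcal D_x$ is constant along $M$; then $\mathcal D$ is called the holomorphic distribution. A generic submanifold is a CR-submanifold if the orthogonal complement $\mathcal D^\perp$ of $\mathcal D$ in $TM$ satisfies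 $J\mathcal D^\perp\subset TM^\perp$. It is holomorphic if $\mathcal D^\perp=\{0\}$, totally real if $\mathcal D=\{0\}$, and proper if it is neither. It is of maximal CR-dimension if $\dim_{\mathbb R} M=2p+1$ with $\dim_{\mathbb C}\mathcal D=p$ and $\dim_{\mathbb R}\mathcal D^\perp=1$. $h$ denotes the second fundamental form of $M$, and the shape operator $A_\sigma$ for a normal vector $\sigma$ is defined by $\langle h(X,Y),\sigma\rangle=\langle A_\sigma X,Y\rangle$. $M$ is mixed-totally geodesic if $h(\mathcal D^\perp,\mathcal D)=0$. $\Gamma(\mathcal V)$ denotes the sections of a vector bundle $\mathcal V$ over $M$. *)

(* Defs.v *)
From HB Require Import structures.
From mathcomp Require Import all_boot all_order all_algebra.
From mathcomp Require Import all_classical all_reals all_analysis.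

Set Implicit Arguments.
Unset Strict Implicit.
Unset Printing Implicit Defensive.

Import Order.TTheory GRing.Theory Num.Theory.
Import numFieldNormedType.Exports.

Local Open Scope classical_set_scope.
Local Open Scope ring_scope.

(* Vectors are row vectors and a linear map is a matrix acting on the right,
   so that the differential of F at y sends u to u *m jacobian F y. *)

Fixpoint Ck (R : realType) (V W : normedModType R) (k : nat) (U : set V)
    (F : V -> W) : Prop :=
  match k with
  | 0 => forall y, U y -> {for y, continuous F}
  | k'.+1 => (forall y, U y -> differentiable F y) /\
             (forall v : V, Ck k' U (fun y => 'D_v F y))
  end.

Definition smooth_on (R : realType) (V W : normedModType R) (U : set V)
    (F : V -> W) : Prop := forall k, Ck k U F.

(* A smooth manifold of dimension m, presented by an atlas containing one
   distinguished chart [chart p], with domain [cdom p], around each point p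
   (any atlas can be reindexed in this way); [cinv p] is the inverse chart. *)
Record manifold (R : realType) (m : nat) := Manifold {
  carrier :> topologicalType;
  cdom : carrier -> set carrier;
  chart : carrier -> carrier -> 'rV[R]_m;
  cinv : carrier -> 'rV[R]_m -> carrier;
  _ : hausdorff_space carrier;
  _ : @second_countable carrier;
  _ : forall p, open (cdom p);
  _ : forall p, cdom p p;
  _ : forall p q, cdom p q -> cinv p (chart p q) = q;
  _ : forall p, open (chart p @` cdom p);
  _ : forall p, {within cdom p, continuous (chart p)};
  _ : forall p, {within chart p @` cdom p, continuous (cinv p)};
  _ : forall p q,
      smooth_on (chart p @` (cdom p `&` cdom q)) (chart q \o cinv p) }.

Section Manifolds.
Variable R : realType.

(* The tangent space of M at q is 'rV_m, the components of a vector being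
   taken in the chart [chart q].  [to_chart p q] and [from_chart p q] are the
   changes of components at q between the chart [chart q] and the chart
   [chart p]. *)
Definition to_chart m (M : manifold R m) (p q : M) : 'M[R]_m :=
  jacobian (chart p \o cinv q) (chart q q).

Definition from_chart m (M : manifold R m) (p q : M) : 'M[R]_m :=
  jacobian (chart q \o cinv p) (chart p q).

Definition local_map m k (M : manifold R m) (M' : manifold R k) (f : M -> M')
    (p : M) (q : M') : 'rV[R]_m -> 'rV[R]_k := chart q \o f \o cinv p.

Definition local_dom m k (M : manifold R m) (M' : manifold R k) (f : M -> M')
    (p : M) (q : M') : set 'rV[R]_m :=
  chart p @` (cdom p `&` f @^-1` cdom q).

Definition smooth_map m k (M : manifold R m) (M' : manifold R k)
    (f : M -> M') : Prop :=
  continuous f /\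
  forall p q, smooth_on (local_dom f p q) (local_map f p q).

Definition differential m k (M : manifold R m) (M' : manifold R k)
    (f : M -> M') (x : M) : 'M[R]_(m, k) :=
  jacobian (local_map f x (f x)) (chart x x).

Definition immersion m k (M : manifold R m) (M' : manifold R k)
    (f : M -> M') : Prop :=
  smooth_map f /\ forall x, row_free (differential f x).

(* smooth sections of the pullback of the tangent bundle of M' along f *)
Definition smooth_along m k (M : manifold R m) (M' : manifold R k)
    (f : M -> M') (V : M -> 'rV[R]_k) : Prop :=
  forall p q, smooth_on (local_dom f p q)
    (fun y => V (cinv p y) *m to_chart q (f (cinv p y))).

Definition vector_field m (M : manifold R m) (X : M -> 'rV[R]_m) : Prop :=
  smooth_along (fun x : M => x) X.

Definition smooth_curve m (M : manifold R m) (gam : R -> M) : Prop :=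
  continuous gam /\
  forall p, smooth_on (gam @^-1` cdom p : set R^o) (chart p \o gam).

Definition simply_connected (T : topologicalType) : Prop :=
  (forall x y : T, exists gam : R -> T,
     [/\ {within `[0, 1], continuous gam}, gam 0 = x & gam 1 = y]) /\
  (forall gam : R -> T, {within `[0, 1], continuous gam} -> gam 0 = gam 1 ->
     exists H : R * R -> T,
       [/\ {within `[0, 1] `*` `[0, 1], continuous H},
           forall t, `[0, 1]%classic t -> H (0, t) = gam t,
           forall t, `[0, 1]%classic t -> H (1, t) = gam 0 &
           forall s, `[0, 1]%classic s ->
             H (s, 0) = gam 0 /\ H (s, 1) = gam 0]).

(* inner product with Gram matrix G *)
Definition form m (G : 'M[R]_m) (u v : 'rV[R]_m) : R := (u *m G *m v^T) 0 0.

(* the vector a such that form G a v = l v for all v (l linear) *)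
Definition riesz m (G : 'M[R]_m) (l : 'rV[R]_m -> R) : 'rV[R]_m :=
  (\row_k l (delta_mx 0 k)) *m invmx G.

(* orthogonal complement of the row space of A *)
Definition orth m k (G : 'M[R]_m) (A : 'M[R]_(k, m)) : 'M[R]_m :=
  kermx (G *m A^T).

(* components in [chart p], at the point with coordinates y, of a field of
   bilinear forms g and of a field of endomorphisms J *)
Definition form_in_chart m (M : manifold R m) (g : M -> 'M[R]_m) (p : M)
    (y : 'rV[R]_m) : 'M[R]_m :=
  from_chart p (cinv p y) *m g (cinv p y) *m (from_chart p (cinv p y))^T.

Definition endo_in_chart m (M : manifold R m) (J : M -> 'M[R]_m) (p : M)
    (y : 'rV[R]_m) : 'M[R]_m :=
  from_chart p (cinv p y) *m J (cinv p y) *m to_chart p (cinv p y).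

Record riemannian m (M : manifold R m) := Riemannian {
  metric :> M -> 'M[R]_m;
  _ : forall x, (metric x)^T = metric x;
  _ : forall x u, u != 0 -> 0 < form (metric x) u u;
  _ : forall p, smooth_on (chart p @` cdom p) (form_in_chart metric p) }.

Section Riemannian.
Variables (m : nat) (M : manifold R m) (g : riemannian M).

(* Levi-Civita connection: covariant derivative along u of the vector field
   with constant components v in [chart p], at the point of coordinates y;
   Koszul's formula for commuting fields *)
Definition christoffel (p : M) (y u v : 'rV[R]_m) : 'rV[R]_m :=
  let gy (a b : 'rV[R]_m) : 'rV[R]_m -> R^o :=
    fun z => form (form_in_chart g p z) a b in
  riesz (form_in_chart g p y) (fun w =>
    2^-1 * ('D_u (gy v w) y + 'D_v (gy u w) y - 'D_w (gy u v) y)).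

(* R(u, v) w, for R(X, Y) = [nabla_X, nabla_Y] - nabla_[X, Y] *)
Definition curvature (p : M) (u v w : 'rV[R]_m) : 'rV[R]_m :=
  let y := chart p p in
  'D_u (fun z => christoffel p z v w) y - 'D_v (fun z => christoffel p z u w) y
  + christoffel p y u (christoffel p y v w)
  - christoffel p y v (christoffel p y u w).

Definition sectional_curvature (p : M) (u v : 'rV[R]_m) : R :=
  form (g p) (curvature p u v v) u /
  (form (g p) u u * form (g p) v v - form (g p) u v ^+ 2).

Definition geodesic (gam : R -> M) : Prop :=
  smooth_curve gam /\
  forall t, let c : R -> 'rV[R]_m := chart (gam t) \o gam in
    derive1 (derive1 c) t
    + christoffel (gam t) (c t) (derive1 c t) (derive1 c t) = 0.

Definition geodesically_complete : Prop :=
  forall (p : M) (v : 'rV[R]_m), exists gam : R -> M,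
    [/\ geodesic gam, gam 0 = p & derive1 (chart p \o gam) 0 = v].

End Riemannian.

(* A Kaehler manifold of complex dimension n: an almost Hermitian manifold
   whose almost complex structure J is parallel; the last axiom is
   nabla_u (J V) = J (nabla_u V) for V with constant components v. *)
Record kaehler n (M : manifold R n.*2) := Kaehler {
  kmetric :> riemannian M;
  cplx : M -> 'M[R]_(n.*2);
  _ : forall p, smooth_on (chart p @` cdom p) (endo_in_chart cplx p);
  _ : forall x, cplx x *m cplx x = - 1%:M;
  _ : forall x u v,
      form (kmetric x) (u *m cplx x) (v *m cplx x) = form (kmetric x) u v;
  _ : forall p u v, let y := chart p p in
      'D_u (fun z => v *m endo_in_chart cplx p z) y
      + christoffel kmetric p y u (v *m cplx p)
      = christoffel kmetric p y u v *m cplx p }.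

(* complex space form of constant holomorphic sectional curvature 4c *)
Definition complex_space_form n (M : manifold R n.*2) (K : kaehler M) (c : R)
    : Prop :=
  [/\ geodesically_complete K, simply_connected M &
      forall p u, u != 0 -> sectional_curvature K p u (u *m cplx K p) = 4 * c].

(* Submanifolds: M is immersed in the Kaehler manifold M' by f and carries the
   induced metric.  A vector u tangent to M at x corresponds to the vector
   u *m differential f x tangent to M' at f x; subspaces of the tangent space
   of M' at f x are row spaces of matrices. *)
Section Submanifold.
Variables (m n : nat) (M : manifold R m) (M' : manifold R n.*2).
Variables (K : kaehler M') (f : M -> M').

Definition induced_metric (x : M) : 'M[R]_m :=
  differential f x *m K (f x) *m (differential f x)^T.

Definition tangent_space (x : M) : 'M[R]_(m, n.*2) := differential f x.

Definition normal_space (x : M) : 'M[R]_(n.*2) :=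
  orth (K (f x)) (tangent_space x).

Definition holo_dist (x : M) : 'M[R]_(n.*2) :=
  (tangent_space x :&: tangent_space x *m cplx K (f x))%MS.

Definition holo_perp (x : M) : 'M[R]_(n.*2) :=
  (tangent_space x :&: orth (K (f x)) (holo_dist x))%MS.

Definition generic : Prop :=
  forall x y : M, \rank (holo_dist x) = \rank (holo_dist y).

Definition CR_submanifold : Prop :=
  generic /\
  forall x : M, (holo_perp x *m cplx K (f x) <= normal_space x)%MS.

Definition holomorphic_submanifold : Prop :=
  forall x : M, holo_perp x = 0.

Definition totally_real_submanifold : Prop :=
  forall x : M, holo_dist x = 0.

Definition proper_CR : Prop :=
  [/\ CR_submanifold, ~ holomorphic_submanifold & ~ totally_real_submanifold].

Definition maximal_CR_dim (p : nat) : Prop :=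
  m = p.*2.+1 /\
  forall x : M, \rank (holo_dist x) = p.*2 /\ \rank (holo_perp x) = 1%N.

(* tangential part, as a vector tangent to M *)
Definition tan_part (x : M) (w : 'rV[R]_(n.*2)) : 'rV[R]_m :=
  riesz (induced_metric x)
    (fun v => form (K (f x)) w (v *m differential f x)).

Definition normal_part (x : M) (w : 'rV[R]_(n.*2)) : 'rV[R]_(n.*2) :=
  w - tan_part x w *m differential f x.

(* second fundamental form: normal part of the covariant derivative along u of
   df(V), where V has constant components v in [chart x] *)
Definition second_ff (x : M) (u v : 'rV[R]_m) : 'rV[R]_(n.*2) :=
  let F := local_map f x (f x) in
  let y := chart x x in
  normal_part x ('D_u (fun z => 'D_v F z) y +
    christoffel K (f x) (F y) (u *m differential f x) (v *m differential f x)).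

Definition shape_op (x : M) (sigma : 'rV[R]_(n.*2)) (u : 'rV[R]_m)
    : 'rV[R]_m :=
  riesz (induced_metric x)
    (fun v => form (K (f x)) (second_ff x u v) sigma).

Definition mixed_totally_geodesic : Prop :=
  forall (x : M) (u v : 'rV[R]_m),
    (u *m differential f x <= holo_perp x)%MS ->
    (v *m differential f x <= holo_dist x)%MS ->
    second_ff x u v = 0.

Definition phi (x : M) (u : 'rV[R]_m) : 'rV[R]_m :=
  tan_part x (u *m differential f x *m cplx K (f x)).

(* -J N, as a vector tangent to M *)
Definition xi (N : M -> 'rV[R]_(n.*2)) (x : M) : 'rV[R]_m :=
  tan_part x (- (N x *m cplx K (f x))).

Definition alpha (N : M -> 'rV[R]_(n.*2)) (x : M) : R :=
  form (K (f x)) (second_ff x (xi N x) (xi N x)) (N x).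

(* N is a section of J D^perp which is a unit normal field *)
Definition unit_normal_section (N : M -> 'rV[R]_(n.*2)) : Prop :=
  smooth_along f N /\
  forall x : M, [/\ (N x <= holo_perp x *m cplx K (f x))%MS,
                    (N x <= normal_space x)%MS &
                    form (K (f x)) (N x) (N x) = 1].

Definition holo_section (Y : M -> 'rV[R]_m) : Prop :=
  vector_field Y /\
  forall x : M, (Y x *m differential f x <= holo_dist x)%MS.

End Submanifold.

End Manifolds.

(* Main.v *)
(** Everything is pulled back to a chart of [M] and a chart of the space form:
    the tangent bundle of the space form becomes a trivial bundle over an open
    set of R^m, with a metric, a parallel complex structure [J], a metric
    connection [nabla] and a soldering form [th]; the curvature of [nabla] is
    known because a Kaehler curvature tensor is determined by its holomorphic
    sectional curvatures.

    Since [nabla_X xi = - J nabla_X N], mixed total geodesy gives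
    [<nabla_X N, xi> = - alpha eta(X)] and [nabla_X N] tangent to [D] for [X] in
    [D].  Taking the exterior derivative of that identity between 1-forms
    contracts the Codazzi equation with [xi]: its [D x D] part is (a), hence
    (b), and its [xi x D] part says [d alpha = beta eta].

    If [beta] did not vanish at some point, [d d alpha = 0] would give
    [d eta = 0] on [D] nearby, that is [phi A = - A phi] on [D], and then
    [A^2 = - c] by (a).  Hence [c < 0] and [D] splits into eigenbundles of [A]
    for the eigenvalues [l] and [- l], [l^2 = - c], exchanged by [J].  The
    curvature equation applied to [N] shows that both are parallel along [D], so
    for an eigenfield [S] the Gauss equation yields
    [<R(S, JS)S, JS> = 2 c |S|^4], while the space form has
    [<R(S, JS)S, JS> = - 4 c |S|^4]: a contradiction.  So [alpha] is locally
    constant. *)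

(* The codimension is arbitrary, yet only the normal direction N has to be followed: J preserves the
   normals orthogonal to N, so mixed total geodesy, which speaks of all normals, also removes the
   normal part of nabla_X N for X in D.

   The case beta <> 0 is refuted on an open set because the vanishing of d eta on D is used there at
   neighbouring points, under further derivatives. On that set A / l is an involution of D with l
   constant, so (1 + A / l) / 2 is a smooth projection and every eigenvector extends to an
   eigenfield; no choice of frame and no bound on the rank of D enters.

   Another obstacle lies in the definitions. The parallelism of J and the sectional curvatures are
   prescribed only at the centre of each distinguished chart, and alpha is computed at x in the
   charts centred at x and f x. Derivatives require one fixed chart, hence the change-of-chart rules
   for Christoffel symbols, curvature and second fundamental form. *)
Require Import Defs.
From HB Require Import structures.
From mathcomp Require Import all_boot all_order all_algebra.
From mathcomp Require Import all_classical all_reals all_analysis.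
From mathcomp Require Import ring lra.

Set Implicit Arguments.
Unset Strict Implicit.
Unset Printing Implicit Defensive.

Import Order.TTheory GRing.Theory Num.Theory.
Import numFieldNormedType.Exports.

Local Open Scope classical_set_scope.
Local Open Scope ring_scope.
Local Notation form := Defs.form.

(** * Directional derivatives of matrix-valued functions *)

Section Differentiability.
Variables (R : realType) (V : normedModType R).

Lemma near_open (U : set V) (P : V -> Prop) y :
  open U -> U y -> (forall z, U z -> P z) -> \forall z \near y, P z.
Proof. by move=> oU Uy UP; apply: filterS (open_nbhs_nbhs (conj oU Uy)). Qed.

Lemma derive_open (W : normedModType R) (U : set V) (f g : V -> W) v y :
  open U -> U y -> (forall z, U z -> f z = g z) -> 'D_v f y = 'D_v g y.
Proof. by move=> oU Uy fg; apply: near_eq_derive; apply: (near_open oU Uy). Qed.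

(** Both functions have the same first-order expansion at [y], with continuous linear part ['d f y];
    uniqueness of the expansion identifies this part with ['d g y]. *)
Lemma near_differentiable (W : normedModType R) (f g : V -> W) y :
  (\near y, f y = g y) -> differentiable f y -> differentiable g y.
Proof.
move=> fg df; have fgy : f y = g y by exact: nbhs_singleton fg.
have gf : g \o shift y = cst (g y) + 'd f y +o_ 0 id.
  apply/eqaddoP => eps eps0; have /eqaddoP/(_ eps eps0) := diff_locally df.
  have : \forall h \near 0, f (h + y) = g (h + y).
    have cont : {for 0, continuous (fun h : V => h + y)}.
      by apply: cvgD; [exact: cvg_id|exact: cvg_cst].
    have := fg; rewrite -{1}(add0r y) => fg'.
    exact: (cont _ fg').
  apply: filterS2 => h fgh.
  rewrite !fctE /= /shift /= => le; move: le; rewrite fgh fgy.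
  by [].
have dgf : 'd g y = 'd f y :> (V -> W).
  by apply: diff_unique => //; exact: diff_continuous.
apply/diff_locallyP; rewrite dgf; split => //; exact: diff_continuous.
Qed.

(** A matrix function is a finite sum of scalar functions times constant matrix units. Product rules
    for matrices thereby reduce to those for scalars. *)
Lemma differentiable_mxP m n (F : V -> 'M[R]_(m, n)) y :
  differentiable F y <-> forall i j, differentiable (fun z => F z i j : R) y.
Proof.
split=> [dF i j|dF].
  apply: (@differentiable_comp _ _ _ _ F (fun N : 'M[R]_(m, n) => N i j)) => //.
  exact: differentiable_coord.
have -> : F = \sum_i \sum_j (fun z => F z i j *: delta_mx i j).
  apply/funext => z; rewrite fct_sumE [LHS]matrix_sum_delta.
  by apply: eq_bigr => i _; rewrite fct_sumE.
apply: differentiable_sum => i; apply: differentiable_sum => j.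
exact: differentiableZl.
Qed.

Lemma derive_mxE m n (F : V -> 'M[R]_(m, n)) v y i j :
  differentiable F y -> ('D_v F y) i j = 'D_v (fun z => F z i j) y.
Proof. by move=> dF; rewrite derive_mx ?mxE//; exact: diff_derivable. Qed.

Lemma differentiable_mulmx m n p (A : V -> 'M[R]_(m, n)) (B : V -> 'M[R]_(n, p)) y :
  differentiable A y -> differentiable B y ->
  differentiable (fun z => A z *m B z) y.
Proof.
move=> /differentiable_mxP dA /differentiable_mxP dB.
apply/differentiable_mxP => i j.
rewrite (_ : (fun _ => _) = \sum_k ((fun z => A z i k) * (fun z => B z k j))); last first.
  by apply/funext => z; rewrite fct_sumE mxE.
by apply: differentiable_sum => k; apply: differentiableM.
Qed.

Lemma derive_mulmx m n p (A : V -> 'M[R]_(m, n)) (B : V -> 'M[R]_(n, p)) v y :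
  differentiable A y -> differentiable B y ->
  'D_v (fun z => A z *m B z) y = 'D_v A y *m B y + A y *m 'D_v B y.
Proof.
move=> dA dB; apply/matrixP => i j.
rewrite derive_mxE; last exact: differentiable_mulmx.
rewrite (_ : (fun _ => _) = \sum_k ((fun z => A z i k) * (fun z => B z k j))); last first.
  by apply/funext => z; rewrite fct_sumE mxE.
have dA' i' j' := (differentiable_mxP A y).1 dA i' j'.
have dB' i' j' := (differentiable_mxP B y).1 dB i' j'.
rewrite derive_sum; last first.
  by move=> k; apply: derivableM; apply: diff_derivable.
rewrite !mxE -big_split /=; apply: eq_bigr => k _.
rewrite deriveM; [|exact: diff_derivable|exact: diff_derivable].
rewrite !derive_mxE// addrC; congr (_ + _).
by rewrite /GRing.scale /= mulrC.
Qed.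

Lemma differentiable_tr m n (A : V -> 'M[R]_(m, n)) y :
  differentiable A y -> differentiable (fun z => (A z)^T) y.
Proof.
move=> /differentiable_mxP dA; apply/differentiable_mxP => i j.
by under eq_fun do rewrite mxE; exact: dA.
Qed.

Lemma derive_tr m n (A : V -> 'M[R]_(m, n)) v y :
  differentiable A y -> 'D_v (fun z => (A z)^T) y = ('D_v A y)^T.
Proof.
move=> dA; apply/matrixP => i j; rewrite derive_mxE; last exact: differentiable_tr.
by rewrite mxE derive_mxE//; under eq_fun do rewrite mxE.
Qed.

End Differentiability.

(** * Smooth functions *)

Section Smooth.
Variables (R : realType) (V : normedModType R) (U : set V).
Hypothesis oU : open U.

Lemma Ck_diff (W : normedModType R) k (F : V -> W) y :
  U y -> Ck k.+1 U F -> differentiable F y.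
Proof. by move=> Uy [dF _]; exact: dF. Qed.

Lemma CkW (W : normedModType R) k (F : V -> W) : Ck k.+1 U F -> Ck k U F.
Proof.
elim: k F => [|k IH] F [dF DF].
  by move=> y Uy; exact/differentiable_continuous/dF.
by split=> // v; exact/IH/DF.
Qed.

(** [Ck] is stated for total functions, so a formula for a derivative that holds only on [U] enters
    through this lemma. Openness of [U] makes all derivatives agree as well. *)
Lemma Ck_ext (W : normedModType R) k (F G : V -> W) :
  (forall y, U y -> F y = G y) -> Ck k U F -> Ck k U G.
Proof.
elim: k F G => [|k IH] F G FG.
  move=> cF y Uy; have FGy : \forall z \near y, F z = G z by exact: near_open FG.
  have cFy : F z @[z --> y] --> F y by exact: cF.
  suff : G z @[z --> y] --> G y by [].
  by rewrite -(FG _ Uy); apply: cvg_trans cFy; exact: near_eq_cvg.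
move=> [dF DF]; split.
  by move=> y Uy; apply: near_differentiable (dF y Uy); exact: near_open FG.
move=> v; apply: IH (DF v) => y Uy; exact: derive_open FG.
Qed.

Lemma Ck_cst (W : normedModType R) k (a : W) : Ck k U (fun=> a).
Proof.
elim: k a => [|k IH] a; first by move=> y _; exact: cvg_cst.
split=> [y _|v]; first exact: differentiable_cst.
by apply: (Ck_ext _ (IH 0)) => y _; rewrite derive_cst.
Qed.

Lemma CkD (W : normedModType R) k (F G : V -> W) :
  Ck k U F -> Ck k U G -> Ck k U (fun y => F y + G y).
Proof.
elim: k F G => [|k IH] F G.
  by move=> cF cG y Uy; apply: cvgD; [exact: cF|exact: cG].
move=> [dF DF] [dG DG]; split.
  by move=> y Uy; apply: differentiableD; [exact: dF|exact: dG].
move=> v; apply: Ck_ext (IH _ _ (DF v) (DG v)) => y Uy.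
by rewrite (@deriveD _ _ _ F G)//; apply: diff_derivable; [exact: dF|exact: dG].
Qed.

Lemma Ck_sum (W : normedModType R) k (I : Type) (r : seq I) (P : pred I) (F : I -> V -> W) :
  (forall i, Ck k U (F i)) -> Ck k U (fun y => \sum_(i <- r | P i) F i y).
Proof.
move=> CF; elim: r => [|i r IH].
  by apply: (Ck_ext _ (Ck_cst k 0)) => y _; rewrite big_nil.
under eq_fun do rewrite big_cons.
by case: (P i) => //; exact: CkD.
Qed.

Lemma CkM k (f g : V -> R) :
  Ck k U f -> Ck k U g -> Ck k U (fun y => f y * g y).
Proof.
elim: k f g => [|k IH] f g.
  by move=> cf cg y Uy; apply: cvgM; [exact: cf|exact: cg].
move=> Cf Cg; split.
  by move=> y Uy; apply: differentiableM; [exact: Ck_diff Uy Cf|exact: Ck_diff Uy Cg].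
move=> v.
have := CkD (IH _ _ (CkW Cf) (Cg.2 v)) (IH _ _ (CkW Cg) (Cf.2 v)).
apply: Ck_ext => y Uy.
by rewrite (@deriveM _ _ f g) //; apply: diff_derivable;
  [exact: Ck_diff Uy Cf|exact: Ck_diff Uy Cg].
Qed.

Lemma Ck_prod k (I : Type) (r : seq I) (P : pred I) (F : I -> V -> R) :
  (forall i, Ck k U (F i)) -> Ck k U (fun y => \prod_(i <- r | P i) F i y).
Proof.
move=> CF; elim: r => [|i r IH].
  apply: (@Ck_ext _ _ (fun=> 1 : R)); last exact: Ck_cst.
    by move=> y _; rewrite big_nil.
under eq_fun do rewrite big_cons.
by case: (P i) => //; exact: CkM.
Qed.

Lemma CkV k (f : V -> R) :
  (forall y, U y -> f y != 0) -> Ck k U f -> Ck k U (fun y => (f y)^-1).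
Proof.
move=> f0; elim: k f f0 => [|k IH] f f0.
  by move=> cf y Uy; exact: (cvgV (f0 y Uy) (cf y Uy)).
move=> Cf; split.
  by move=> y Uy; apply: differentiableV (f0 y Uy); exact: Ck_diff Uy Cf.
move=> v.
have C1 := IH _ f0 (CkW Cf).
(* The derivative - f^-2 df as an iterated product, each factor being of class [k] by induction. *)
have := CkM (@Ck_cst R k (-1)) (CkM (CkM C1 C1) (Cf.2 v)).
apply: Ck_ext => y Uy.
rewrite (@deriveV _ _ f) ?f0//; last by apply: diff_derivable; exact: Ck_diff Uy Cf.
by rewrite -exprVn /GRing.scale /= expr2 mulN1r mulNr.
Qed.

Lemma Ck_mxP m n k (F : V -> 'M[R]_(m, n)) :
  Ck k U F <-> forall i j, Ck k U (fun y => F y i j : R).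
Proof.
elim: k F => [|k IH] F; split.
- move=> cF i j y Uy; apply: (cvg_comp F (fun M : 'M[R]_(m, n) => M i j)).
    exact: cF.
  exact: coord_continuous.
- move=> cF y Uy.
  rewrite (_ : F = fun z => \sum_i \sum_j F z i j *: delta_mx i j); last first.
    by apply/funext => z; exact: matrix_sum_delta.
  apply: (@Ck_sum _ 0) Uy => i; apply: Ck_sum => j z Uz.
  by apply: cvgZr_tmp; exact: cF.
- move=> [dF DF] i j; split=> [y Uy|v].
    by have /differentiable_mxP := dF y Uy; exact.
  apply: Ck_ext ((IH _).1 (DF v) i j) => y Uy.
  by rewrite derive_mxE//; exact: dF.
- move=> CF; have dF y : U y -> differentiable F y.
    by move=> Uy; apply/differentiable_mxP => i j; exact: Ck_diff Uy (CF i j).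
  split=> // v; apply/IH => i j.
  apply: Ck_ext ((CF i j).2 v) => y Uy.
  by rewrite derive_mxE//; exact: dF.
Qed.

Lemma Ck_mulmx m n p k (A : V -> 'M[R]_(m, n)) (B : V -> 'M[R]_(n, p)) :
  Ck k U A -> Ck k U B -> Ck k U (fun y => A y *m B y).
Proof.
move=> /Ck_mxP CA /Ck_mxP CB; apply/Ck_mxP => i j.
under eq_fun do rewrite mxE.
by apply: Ck_sum => l; apply: CkM.
Qed.

Lemma Ck_tr m n k (A : V -> 'M[R]_(m, n)) :
  Ck k U A -> Ck k U (fun y => (A y)^T).
Proof.
move=> /Ck_mxP CA; apply/Ck_mxP => i j.
by under eq_fun do rewrite mxE.
Qed.

Lemma Ck_scale m n k (f : V -> R) (A : V -> 'M[R]_(m, n)) :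
  Ck k U f -> Ck k U A -> Ck k U (fun y => f y *: A y).
Proof.
move=> Cf /Ck_mxP CA; apply/Ck_mxP => i j.
by under eq_fun do rewrite mxE; exact: CkM.
Qed.

Lemma Ck_opp m n k (A : V -> 'M[R]_(m, n)) :
  Ck k U A -> Ck k U (fun y => - A y).
Proof.
by move=> CA; under eq_fun do rewrite -scaleN1r; apply: Ck_scale (Ck_cst _ _) CA.
Qed.

Lemma Ck_det n k (A : V -> 'M[R]_n) : Ck k U A -> Ck k U (fun y => \det (A y)).
Proof.
move=> /Ck_mxP CA; apply: Ck_sum => s.
by apply: CkM; [exact: Ck_cst|apply: Ck_prod].
Qed.

Lemma Ck_inv n k (A : V -> 'M[R]_n) : (forall y, U y -> A y \in unitmx) ->
  Ck k U A -> Ck k U (fun y => invmx (A y)).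
Proof.
move=> uA CA.
(* Cramer's rule: determinant and adjugate are polynomials in the entries. *)
have CI : Ck k U (fun y => (\det (A y))^-1 *: \adj (A y)).
  apply: Ck_scale.
    apply: CkV; last exact: Ck_det.
    by move=> y /uA; rewrite unitmxE unitfE.
  apply/Ck_mxP => i j; under eq_fun do rewrite mxE.
  apply: CkM; first exact: Ck_cst.
  apply: Ck_det; apply/Ck_mxP => i' j'; under eq_fun do rewrite !mxE.
  by move/Ck_mxP : CA; exact.
by apply: Ck_ext CI => y Uy; rewrite /invmx uA.
Qed.

End Smooth.

Lemma CkS (R : realType) (V W : normedModType R) k (U U' : set V) (F : V -> W) :
  U' `<=` U -> Ck k U F -> Ck k U' F.
Proof.
move=> sU; elim: k F => [|k IH] F; first by move=> cF y /sU; exact: cF.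
by move=> [dF DF]; split=> [y /sU|v]; [exact: dF|exact/IH/DF].
Qed.

Lemma derive_linear (R : realType) (V W : normedModType R) (F : V -> W) y u v a :
  differentiable F y -> 'D_(a *: u + v) F y = a *: 'D_u F y + 'D_v F y.
Proof. by move=> dF; rewrite !deriveE// linearP. Qed.

Lemma derive_coord (R : realType) d (W : normedModType R) (G : 'rV[R]_d -> W) z w :
  differentiable G z -> 'D_w G z = \sum_i w 0 i *: 'D_(delta_mx 0 i) G z.
Proof.
move=> dG; rewrite deriveE// {1}(row_sum_delta w) linear_sum.
by apply: eq_bigr => i _; rewrite linearZ deriveE.
Qed.

Lemma derive_comp (R : realType) (V V' W : normedModType R) (F : V -> V')
    (G : V' -> W) y v :
  differentiable F y -> differentiable G (F y) ->
  'D_v (fun z => G (F z)) y = 'D_('D_v F y) G (F y).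
Proof.
move=> dF dG; rewrite (_ : (fun z => _) = G \o F)// !deriveE//.
  by rewrite diff_comp.
exact: differentiable_comp.
Qed.

Lemma Ck_comp (R : realType) (V : normedModType R) d m n (U : set V)
    (U' : set 'rV[R]_d) k (F : V -> 'rV[R]_d) (G : 'rV[R]_d -> 'M[R]_(m, n)) :
  open U -> open U' -> (forall y, U y -> U' (F y)) ->
  Ck k U F -> Ck k U' G -> Ck k U (fun y => G (F y)).
Proof.
move=> oU oU' FU; elim: k G => [|k IH] G CF CG.
  by move=> y Uy; apply: (cvg_comp F G); [exact: CF|exact/CG/FU].
split=> [y Uy|v].
  by apply: differentiable_comp; [exact: Ck_diff Uy CF|exact: Ck_diff (FU _ Uy) CG].
(* The chain rule differentiates [G] in a direction that varies with [y]; coordinates replace it by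
   constant directions, to which the induction hypothesis applies. *)
have C : Ck k U (fun y => \sum_i ('D_v F y) 0 i *: 'D_(delta_mx 0 i) G (F y)).
  apply: Ck_sum => // i; apply: Ck_scale => //.
    by have /Ck_mxP := CF.2 v; exact.
  exact: (IH ('D_(delta_mx 0 i) G) (CkW CF) (CG.2 _)).
apply: Ck_ext C => // y Uy.
have dF : differentiable F y by exact: Ck_diff Uy CF.
have dG : differentiable G (F y) by exact: Ck_diff (FU _ Uy) CG.
by rewrite (derive_comp v dF dG) -derive_coord.
Qed.

(** * Second derivatives *)

Section SecondDerivatives.
Variables (R : realType) (V : normedModType R).

Lemma differentiable_line (z u : V) (s : R) :
  differentiable (fun r : R => z + r *: u) s.
Proof.
apply: differentiableD; first exact: differentiable_cst.
by have [] := @is_diff_scalel R V s u.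
Qed.

Lemma derive_line (z u : V) (s : R) : 'D_1 (fun r : R => z + r *: u) s = u.
Proof.
rewrite deriveE; last exact: differentiable_line.
have ds := @is_diff_scalel R V s u.
have dc : differentiable (cst z : R -> V) s by exact: differentiable_cst.
have ds' : differentiable ( *:%R ^~ u : R -> V) s by case: ds.
have -> : (fun r : R => z + r *: u) = (cst z : R -> V) + ( *:%R ^~ u) by [].
rewrite (diffD dc ds') /= diff_cst (@diff_val _ _ _ _ _ _ _ ds).
by rewrite /= scale1r add0r.
Qed.

Lemma line_MVT (phi : V -> R) (z u : V) (t : R) : 0 < t ->
  (forall s : R, 0 <= s <= t -> differentiable phi (z + s *: u)) ->
  exists2 s, 0 < s < t & phi (z + t *: u) - phi z = t * 'D_u phi (z + s *: u).
Proof.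
move=> t0 dphi; pose g s := phi (z + s *: u).
have dg s : 0 <= s <= t -> differentiable g s.
  move=> st; apply: (differentiable_comp (differentiable_line z u s)).
  exact: dphi.
have [||s] := @MVT R g (fun s => 'D_u phi (z + s *: u)) 0 t t0.
- move=> s; rewrite in_itv/= => /andP[s0 st].
  have st' : 0 <= s <= t by rewrite !ltW.
  apply: DeriveDef; first by apply: diff_derivable; exact: dg.
  rewrite (derive_comp (1 : R) (differentiable_line z u s)) ?derive_line//.
  exact: dphi.
- apply: derivable_within_continuous => s; rewrite in_itv/= => st.
  by apply: diff_derivable; exact: dg.
- rewrite in_itv/= => st; rewrite /g scale0r addr0 subr0 mulrC => ->.
  by exists s.
Qed.

(** Two uses of the mean value theorem: along [u] for the increment [phi] of [f] in the direction
    [v], then along [v]. The left side is symmetric in [u] and [v], which is the source of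
    [schwarz]. *)
Lemma second_difference (U : set V) (f : V -> R) (u v y : V) (t : R) :
  Ck 2 U f -> 0 < t ->
  (forall a b : R, 0 <= a <= t -> 0 <= b <= t -> U (y + a *: u + b *: v)) ->
  exists a b, [/\ 0 <= a <= t, 0 <= b <= t &
    f (y + t *: u + t *: v) - f (y + t *: u) - (f (y + t *: v) - f y)
    = t ^+ 2 * 'D_v ('D_u f) (y + a *: u + b *: v)].
Proof.
move=> [df ddf] t0 sU; have tt : (0 : R) <= t <= t by rewrite (ltW t0) /=.
have t00 : (0 : R) <= 0 <= t by rewrite (ltW t0) andbT.
pose phi z := f (z + t *: v) - f z.
have dsh z : differentiable (fun z : V => z + t *: v) z.
  by apply: differentiableD;
    [by have [] := @is_diff_id R V z|exact: differentiable_cst].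
have dfs a : 0 <= a <= t -> differentiable (fun z => f (z + t *: v)) (y + a *: u).
  move=> at_; apply: (differentiable_comp (dsh (y + a *: u))).
  exact/df/sU.
have df0 a : 0 <= a <= t -> differentiable f (y + a *: u).
  by move=> at_; have := df _ (sU a 0 at_ t00); rewrite scale0r addr0.
have dphi a : 0 <= a <= t -> differentiable phi (y + a *: u).
  by move=> at_; apply: differentiableB; [exact: dfs|exact: df0].
have [a /andP[a0 at1] ->] := line_MVT t0 dphi.
have at_ : 0 <= a <= t by rewrite !ltW.
have -> : 'D_u phi (y + a *: u) =
    'D_u f (y + a *: u + t *: v) - 'D_u f (y + a *: u).
  rewrite (@deriveB _ _ _ (fun z => f (z + t *: v)) f); last 2 first.
  - by apply: diff_derivable; exact: dfs.
  - by apply: diff_derivable; exact: df0.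
  congr (_ - _); rewrite (derive_comp u (dsh _)); last exact/df/sU.
  congr ('D_ _ f _).
  rewrite (@deriveD _ _ _ id (cst (t *: v))) ?derive_id ?derive_cst ?addr0//.
have [b /andP[b0 bt] ->] := line_MVT (phi := 'D_u f) t0
  (fun s st => (ddf u).1 _ (sU a s at_ st)).
by exists a, b; rewrite expr2 mulrA; split => //; rewrite !ltW.
Qed.

Lemma schwarz (U : set V) (f : V -> R) (u v y : V) :
  open U -> U y -> Ck 2 U f -> 'D_u ('D_v f) y = 'D_v ('D_u f) y.
Proof.
move=> oU Uy Cf; apply/eqP; rewrite -subr_eq0 -normr_le0; apply/ler_addgt0Pl => e e0.
rewrite addr0.
have cD w w' : {for y, continuous ('D_w ('D_w' f))}.
  by have [_ /(_ w')[_ /(_ w)]] := Cf; exact.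
have e2 : 0 < e / 2 by rewrite divr_gt0.
have near1 w w' : \forall z \near y, U z /\ `|'D_w ('D_w' f) y - 'D_w ('D_w' f) z| < e / 2.
  have /cvgrPdist_lt/(_ _ e2) := cD w w'.
  by apply: filterS2 (open_nbhs_nbhs (conj oU Uy)) => z.
have /nbhs_ballP[r /= r0 rP] : \forall z \near y,
    [/\ U z, `|'D_u ('D_v f) y - 'D_u ('D_v f) z| < e / 2 &
     `|'D_v ('D_u f) y - 'D_v ('D_u f) z| < e / 2].
  by move: (near1 u v) (near1 v u); apply: filterS2 => z [? ?] [].
(* So small that the parallelogram spanned at [y] by [t *: u] and [t *: v] stays in the ball of
   radius [r]; the summand 1 covers [u = v = 0]. *)
pose t := r / (1 + `|u| + `|v|) / 2.
have n0 : 0 < 1 + `|u| + `|v| by rewrite ltr_wpDr// ltr_wpDr.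
have t0 : 0 < t by rewrite /t !divr_gt0.
have inb w w' a b : `|w| + `|w'| = `|u| + `|v| -> 0 <= a <= t -> 0 <= b <= t ->
    ball y r (y + a *: w + b *: w').
  move=> ww /andP[a0 at_] /andP[b0 bt].
  rewrite -ball_normE /= -addrA opprD addNKr normrN.
  apply: (@le_lt_trans _ _ (t * (`|w| + `|w'|))).
    rewrite (le_trans (ler_normD _ _))// mulrDr !normrZ !ger0_norm// lerD//;
    exact: ler_wpM2r.
  rewrite ww (@lt_le_trans _ _ (t * (1 + `|u| + `|v|)))//.
    by rewrite ltr_pM2l// -addrA ltrDr.
  rewrite /t mulrAC divfK ?gt_eqF// ler_pdivrMr// ler_pMr// ler1n//.
have [|a [b [at_ bt E1]]] := second_difference (u := u) (v := v) (y := y) Cf t0.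
  by move=> a b at_ bt; have [] := rP _ (inb u v a b erefl at_ bt).
have uv : `|v| + `|u| = `|u| + `|v| by rewrite addrC.
have [|a' [b' [at' bt' E2]]] := second_difference (u := v) (v := u) (y := y) Cf t0.
  by move=> a' b' at' bt'; have [] := rP _ (inb v u a' b' uv at' bt').
have [_ _ B1] := rP _ (inb u v a b erefl at_ bt).
have [_ B2 _] := rP _ (inb v u a' b' uv at' bt').
(* The two mixed derivatives take a common value at two points of the ball, where each is within
   [e / 2] of its value at [y]. *)
have EE : 'D_v ('D_u f) (y + a *: u + b *: v) = 'D_u ('D_v f) (y + a' *: v + b' *: u).
  apply: (@mulfI _ (t ^+ 2)); first by rewrite expf_neq0// gt_eqF.
  apply: etrans (esym E1) _; apply: etrans E2; rewrite (addrAC y (t *: v) (t *: u)).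
  by move: (f _) (f _) (f _) (f _) => p1 p2 p3 p4; ring.
rewrite EE distrC in B1; rewrite (splitr e).
exact: le_trans (ler_distD _ _ _) (lerD (ltW B2) (ltW B1)).
Qed.

Lemma schwarz_mx m n (U : set V) (F : V -> 'M[R]_(m, n)) (u v y : V) :
  open U -> U y -> Ck 2 U F -> 'D_u ('D_v F) y = 'D_v ('D_u F) y.
Proof.
move=> oU Uy CF; apply/matrixP => i j.
have e w w' : 'D_w ('D_w' F) y i j = 'D_w ('D_w' (fun z => F z i j)) y.
  rewrite derive_mxE; last by have [_ /(_ w')[+ _]] := CF; exact.
  apply: (derive_open w oU Uy) => z Uz.
  by rewrite derive_mxE//; have [+ _] := CF; exact.
apply: etrans (e u v) _.
apply: etrans (esym (e v u)).
have CF' : Ck 2 U (fun z => F z i j : R).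
  by move/(Ck_mxP oU) : CF; apply.
exact: (schwarz u v oU Uy CF').
Qed.

Lemma zero_derivative (U : set V) (f : V -> R) y : open U -> U y ->
  (forall z, U z -> differentiable f z) -> (forall z v, U z -> 'D_v f z = 0) ->
  \forall z \near y, f z = f y.
Proof.
move=> oU Uy df Df.
have /nbhs_ballP[r /= r0 rU] : nbhs y U by apply: open_nbhs_nbhs.
apply/nbhs_ballP; exists r => //= z yz.
have inU s : 0 <= s <= 1 -> U (y + s *: (z - y)).
  move=> /andP[s0 s1]; apply: rU; move: yz; rewrite -!ball_normE/= => yz.
  rewrite opprD addNKr normrN normrZ ger0_norm// distrC.
  by rewrite (le_lt_trans _ yz)// ler_piMl.
have [s /andP[s0 s1]] := line_MVT ltr01 (fun s s01 => df _ (inU s s01)).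
rewrite scale1r (addrC y) subrK Df; last by apply: inU; rewrite !ltW.
by rewrite mulr0 => /eqP; rewrite subr_eq0 => /eqP.
Qed.

End SecondDerivatives.

Section Smooth_on.
Variables (R : realType) (V : normedModType R) (U : set V).
Hypothesis oU : open U.

Lemma smooth_diff (W : normedModType R) (F : V -> W) y :
  U y -> smooth_on U F -> differentiable F y.
Proof. by move=> Uy /(_ 1%N); exact: Ck_diff. Qed.

Lemma smooth_ext (W : normedModType R) (F G : V -> W) :
  (forall y, U y -> F y = G y) -> smooth_on U F -> smooth_on U G.
Proof. by move=> FG sF k; exact: Ck_ext (sF k). Qed.

Lemma smooth_cst (W : normedModType R) (a : W) : smooth_on U (fun=> a).
Proof. by move=> k; exact: Ck_cst. Qed.

Lemma smooth_derive (W : normedModType R) (F : V -> W) v :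
  smooth_on U F -> smooth_on U ('D_v F).
Proof. by move=> sF k; have [_] := sF k.+1; exact. Qed.

Lemma smoothD (W : normedModType R) (F G : V -> W) :
  smooth_on U F -> smooth_on U G -> smooth_on U (fun y => F y + G y).
Proof. by move=> sF sG k; exact: CkD. Qed.

Lemma smooth_sum (W : normedModType R) (I : Type) (r : seq I) (P : pred I)
    (F : I -> V -> W) :
  (forall i, smooth_on U (F i)) -> smooth_on U (fun y => \sum_(i <- r | P i) F i y).
Proof. by move=> sF k; apply: Ck_sum => // i; exact: sF. Qed.

Lemma smoothM (f g : V -> R) :
  smooth_on U f -> smooth_on U g -> smooth_on U (fun y => f y * g y).
Proof. by move=> sf sg k; exact: CkM. Qed.

Lemma smooth_coord m n (F : V -> 'M[R]_(m, n)) i j :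
  smooth_on U F -> smooth_on U (fun y => F y i j : R).
Proof. by move=> sF k; have /(Ck_mxP oU) := sF k; exact. Qed.

Lemma smooth_mx m n (F : V -> 'M[R]_(m, n)) :
  (forall i j, smooth_on U (fun y => F y i j : R)) -> smooth_on U F.
Proof. by move=> sF k; apply/(Ck_mxP oU) => i j; exact: sF. Qed.

Lemma smooth_mulmx m n p (A : V -> 'M[R]_(m, n)) (B : V -> 'M[R]_(n, p)) :
  smooth_on U A -> smooth_on U B -> smooth_on U (fun y => A y *m B y).
Proof. by move=> sA sB k; exact: Ck_mulmx. Qed.

Lemma smooth_tr m n (A : V -> 'M[R]_(m, n)) :
  smooth_on U A -> smooth_on U (fun y => (A y)^T).
Proof. by move=> sA k; exact: Ck_tr. Qed.

Lemma smooth_scale m n (f : V -> R) (A : V -> 'M[R]_(m, n)) :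
  smooth_on U f -> smooth_on U A -> smooth_on U (fun y => f y *: A y).
Proof. by move=> sf sA k; exact: Ck_scale. Qed.

Lemma smoothN m n (A : V -> 'M[R]_(m, n)) :
  smooth_on U A -> smooth_on U (fun y => - A y).
Proof. by move=> sA k; exact: Ck_opp. Qed.

Lemma smoothB m n (A B : V -> 'M[R]_(m, n)) :
  smooth_on U A -> smooth_on U B -> smooth_on U (fun y => A y - B y).
Proof. by move=> sA sB; apply: smoothD => //; exact: smoothN. Qed.

Lemma smooth_inv n (A : V -> 'M[R]_n) : (forall y, U y -> A y \in unitmx) ->
  smooth_on U A -> smooth_on U (fun y => invmx (A y)).
Proof. by move=> uA sA k; exact: Ck_inv. Qed.

Lemma smooth_form m (G : V -> 'M[R]_m) (u v : V -> 'rV[R]_m) :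
  smooth_on U G -> smooth_on U u -> smooth_on U v ->
  smooth_on U (fun y => form (G y) (u y) (v y) : R).
Proof.
move=> sG su sv; apply: smooth_coord; apply: smooth_mulmx; last exact: smooth_tr.
exact: smooth_mulmx.
Qed.

End Smooth_on.

Lemma smoothS (R : realType) (V W : normedModType R) (U U' : set V) (F : V -> W) :
  U' `<=` U -> smooth_on U F -> smooth_on U' F.
Proof. by move=> sU sF k; exact: CkS (sF k). Qed.

Lemma smooth_comp (R : realType) (V : normedModType R) d m n (U : set V)
    (U' : set 'rV[R]_d) (F : V -> 'rV[R]_d) (G : 'rV[R]_d -> 'M[R]_(m, n)) :
  open U -> open U' -> (forall y, U y -> U' (F y)) ->
  smooth_on U F -> smooth_on U' G -> smooth_on U (fun y => G (F y)).
Proof. by move=> oU oU' FU sF sG k; exact: Ck_comp oU oU' FU (sF k) (sG k). Qed.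

(** * Bilinear forms *)

Section Form.
Variables (R : realType) (m : nat).
Implicit Types (G : 'M[R]_m) (u v w : 'rV[R]_m).

Lemma formDl G u v w : form G (u + v) w = form G u w + form G v w.
Proof. by rewrite /Defs.form !mulmxDl mxE. Qed.

Lemma formDr G u v w : form G w (u + v) = form G w u + form G w v.
Proof. by rewrite /Defs.form linearD mulmxDr mxE. Qed.

Lemma formZl G a u v : form G (a *: u) v = a * form G u v.
Proof. by rewrite /Defs.form -!scalemxAl mxE. Qed.

Lemma formZr G a u v : form G u (a *: v) = a * form G u v.
Proof. by rewrite /Defs.form linearZ -scalemxAr mxE. Qed.

Lemma formNl G u v : form G (- u) v = - form G u v.
Proof. by rewrite -scaleN1r formZl mulN1r. Qed.

Lemma formNr G u v : form G u (- v) = - form G u v.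
Proof. by rewrite -scaleN1r formZr mulN1r. Qed.

Lemma formBl G u v w : form G (u - v) w = form G u w - form G v w.
Proof. by rewrite formDl formNl. Qed.

Lemma formBr G u v w : form G w (u - v) = form G w u - form G w v.
Proof. by rewrite formDr formNr. Qed.

Lemma form0l G v : form G 0 v = 0.
Proof. by rewrite -(scale0r 0) formZl mul0r. Qed.

Lemma form0r G v : form G v 0 = 0.
Proof. by rewrite -(scale0r 0) formZr mul0r. Qed.

Lemma formC G u v : G^T = G -> form G u v = form G v u.
Proof.
move=> sG; have e : v *m G *m u^T = (u *m G *m v^T)^T.
  by rewrite !trmx_mul trmxK sG mulmxA.
by rewrite /Defs.form e [RHS]mxE.
Qed.

Lemma form_mul k G (A : 'M[R]_(k, m)) (u v : 'rV[R]_k) :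
  form G (u *m A) (v *m A) = form (A *m G *m A^T) u v.
Proof. by rewrite /Defs.form trmx_mul !mulmxA. Qed.

Definition posdef G := forall u, u != 0 -> 0 < form G u u.

Lemma posdef_ge0 G u : posdef G -> 0 <= form G u u.
Proof. by move=> pG; have [->|/pG/ltW//] := eqVneq u 0; rewrite form0l. Qed.

Lemma posdef_eq0 G u : posdef G -> form G u u = 0 -> u = 0.
Proof. by move=> pG u0; apply/eqP/negPn/negP => /pG; rewrite u0 ltxx. Qed.

Lemma posdef_inj G u v : posdef G -> (forall w, form G u w = form G v w) -> u = v.
Proof.
move=> pG uv; apply/eqP; rewrite -subr_eq0; apply/eqP/(posdef_eq0 pG).
by rewrite formBl uv subrr.
Qed.

Lemma posdef_unit G : posdef G -> G \in unitmx.
Proof.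
move=> pG; rewrite -row_free_unit -kermx_eq0; apply/eqP.
apply/row_matrixP => i; rewrite row0; apply: (posdef_eq0 pG).
rewrite /Defs.form; suff -> : row i (kermx G) *m G = 0 by rewrite mul0mx mxE.
by rewrite -row_mul mulmx_ker row0.
Qed.

Lemma riesz_form G (l : 'rV[R]_m -> R) v : posdef G ->
  (forall a u w, l (a *: u + w) = a * l u + l w) -> form G (riesz G l) v = l v.
Proof.
move=> pG lin; rewrite /Defs.form /riesz mulmxKV ?posdef_unit//.
have l0 : l 0 = 0.
  have := lin 1 0 0; rewrite scale1r addr0 mul1r => e.
  by apply: (@addrI _ (l 0)); rewrite addr0 -e.
have lD u w : l (u + w) = l u + l w by rewrite -{1}[u]scale1r lin mul1r.
rewrite [in RHS](row_sum_delta v) mxE.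
rewrite (big_morph l lD l0).
apply: eq_bigr => j _; rewrite !mxE mulrC.
by rewrite -[v 0 j *: _]addr0 lin l0 addr0.
Qed.

End Form.

(** * Connections on a trivial bundle *)

Section ConstantFactors.
Variables (R : realType) (V : normedModType R).
Implicit Types (a : R) (u v y : V).

(* Directional derivatives, typed in the plain matrix and scalar structures
   and sealed: unifying ['D_u F y] with a matrix expression unfolds limits. *)
Fact derivative_key : unit. Proof. exact: tt. Qed.

Definition dmx m n : V -> (V -> 'M[R]_(m, n)) -> V -> 'M[R]_(m, n) :=
  locked_with derivative_key (fun u F y => 'D_u F y).

Definition dsc : V -> (V -> R) -> V -> R :=
  locked_with derivative_key (fun u f y => 'D_u f y).

Lemma dmx_def m n (F : V -> 'M[R]_(m, n)) u y : dmx u F y = 'D_u F y.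
Proof. by rewrite /dmx unlock. Qed.

Lemma dsc_def (f : V -> R) u y : dsc u f y = 'D_u f y.
Proof. by rewrite /dsc unlock. Qed.

Lemma dmx_defE m n (F : V -> 'M[R]_(m, n)) u : dmx u F = 'D_u F.
Proof. by apply/funext => y; exact: dmx_def. Qed.

Lemma dsc_defE (f : V -> R) u : dsc u f = 'D_u f.
Proof. by apply/funext => y; exact: dsc_def. Qed.

Lemma dmx_open m n (U : set V) (F G : V -> 'M[R]_(m, n)) u y :
  open U -> U y -> (forall z, U z -> F z = G z) -> dmx u F y = dmx u G y.
Proof. by rewrite !dmx_def; exact: derive_open. Qed.

Lemma dsc_open (U : set V) (F G : V -> R) u y :
  open U -> U y -> (forall z, U z -> F z = G z) -> dsc u F y = dsc u G y.
Proof. by rewrite !dsc_def; exact: derive_open. Qed.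

Lemma dmx_linear m n (F : V -> 'M[R]_(m, n)) a u v y : differentiable F y ->
  dmx (a *: u + v) F y = a *: dmx u F y + dmx v F y.
Proof. by rewrite !dmx_def; exact: derive_linear. Qed.

Lemma dsc_linear (F : V -> R) a u v y : differentiable F y ->
  dsc (a *: u + v) F y = a * dsc u F y + dsc v F y.
Proof. by rewrite !dsc_def; exact: derive_linear. Qed.

Lemma dmx_cst m n (A : 'M[R]_(m, n)) u y : dmx u (fun=> A) y = 0.
Proof. by rewrite !dmx_def; exact: derive_cst. Qed.

Lemma dsc_cst (a : R) u y : dsc u (fun=> a) y = 0.
Proof. by rewrite !dsc_def; exact: derive_cst. Qed.

Lemma dmxE m n (F : V -> 'M[R]_(m, n)) u y i j :
  differentiable F y -> dmx u F y i j = dsc u (fun z => F z i j) y.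
Proof. by rewrite dmx_def dsc_def; exact: derive_mxE. Qed.

Lemma dmx_mulmx m n p (A : V -> 'M[R]_(m, n)) (B : V -> 'M[R]_(n, p)) u y :
  differentiable A y -> differentiable B y ->
  dmx u (fun z => A z *m B z) y = dmx u A y *m B y + A y *m dmx u B y.
Proof. by rewrite !dmx_def; exact: derive_mulmx. Qed.

Lemma dmx_tr m n (A : V -> 'M[R]_(m, n)) u y :
  differentiable A y -> dmx u (fun z => (A z)^T) y = (dmx u A y)^T.
Proof. by rewrite !dmx_def; exact: derive_tr. Qed.

Lemma dmx_mull k m n (v : 'M[R]_(k, m)) (A : V -> 'M[R]_(m, n)) u y :
  differentiable A y -> dmx u (fun z => v *m A z) y = v *m dmx u A y.
Proof.
move=> dA; apply: etrans (dmx_mulmx u (differentiable_cst v y) dA) _.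
by rewrite dmx_cst mul0mx add0r.
Qed.

Lemma dmx_add m n (F G : V -> 'M[R]_(m, n)) u y :
  differentiable F y -> differentiable G y ->
  dmx u (fun z => F z + G z) y = dmx u F y + dmx u G y.
Proof.
move=> dF dG; rewrite !dmx_def.
by apply: (@deriveD _ _ _ F G); exact: diff_derivable.
Qed.

Lemma dmx_opp m n (F : V -> 'M[R]_(m, n)) u y :
  differentiable F y -> dmx u (fun z => - F z) y = - dmx u F y.
Proof.
move=> dF; rewrite !dmx_def.
by apply: (@deriveN _ _ _ F); exact: diff_derivable.
Qed.

Lemma dsc_opp (f : V -> R) u y :
  differentiable f y -> dsc u (fun z => - f z) y = - dsc u f y.
Proof.
move=> dF; rewrite !dsc_def.
by apply: (@deriveN _ _ _ f); exact: diff_derivable.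
Qed.

Lemma dmx_sum m n k (F : 'I_k -> V -> 'M[R]_(m, n)) u y :
  (forall i, differentiable (F i) y) ->
  dmx u (fun z => \sum_i F i z) y = \sum_i dmx u (F i) y.
Proof.
move=> dF; have df i : derivable (F i) y u by exact: diff_derivable.
under eq_bigr do rewrite dmx_def.
apply: etrans (@derive_sum R V _ k F y u df); rewrite dmx_def.
by congr ('D_u _ y); apply/funext => z; rewrite fct_sumE.
Qed.

Lemma dsc_mul (f h : V -> R) u y :
  differentiable f y -> differentiable h y ->
  dsc u (fun z => f z * h z) y = dsc u f y * h y + f y * dsc u h y.
Proof.
move=> df dh; rewrite !dsc_def.
apply: etrans (@deriveM _ _ f h y u _ _) _; try exact: diff_derivable.
by rewrite /GRing.scale/= addrC mulrC.
Qed.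

Lemma dmx_scale m n (f : V -> R) (A : V -> 'M[R]_(m, n)) u y :
  differentiable f y -> differentiable A y ->
  dmx u (fun z => f z *: A z) y = dsc u f y *: A y + f y *: dmx u A y.
Proof.
move=> df dA; have dA' i j : differentiable (fun z => A z i j : R) y.
  by move/differentiable_mxP : dA; exact.
have dfA : differentiable (fun z => f z *: A z) y.
  apply/differentiable_mxP => i j; under eq_fun do rewrite mxE.
  exact: differentiableM.
apply/matrixP => i j; rewrite dmxE// !mxE (dmxE _ _ _ dA).
by rewrite -dsc_mul//; under eq_fun do rewrite mxE.
Qed.

Lemma dmx_schwarz m n (U : set V) (F : V -> 'M[R]_(m, n)) u v y :
  open U -> U y -> smooth_on U F -> dmx u (dmx v F) y = dmx v (dmx u F) y.
Proof.
by move=> oU Uy /(_ 2) CF; rewrite !dmx_defE; exact: schwarz_mx CF.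
Qed.

Lemma dsc_schwarz (U : set V) (f : V -> R) u v y :
  open U -> U y -> smooth_on U f -> dsc u (dsc v f) y = dsc v (dsc u f) y.
Proof.
by move=> oU Uy /(_ 2) CF; rewrite !dsc_defE; exact: schwarz CF.
Qed.

Lemma smooth_dmx m n (U : set V) (F : V -> 'M[R]_(m, n)) v :
  smooth_on U F -> smooth_on U (dmx v F).
Proof. by rewrite dmx_defE; exact: smooth_derive. Qed.

Lemma smooth_dsc (U : set V) (f : V -> R) v :
  smooth_on U f -> smooth_on U (dsc v f).
Proof. by rewrite dsc_defE; exact: smooth_derive. Qed.

End ConstantFactors.

Lemma dmx_coord (R : realType) k m n (F : 'rV[R]_k -> 'M[R]_(m, n)) u y :
  differentiable F y -> dmx u F y = \sum_i u 0 i *: dmx (delta_mx 0 i) F y.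
Proof.
move=> dF; rewrite dmx_def; under eq_bigr do rewrite dmx_def.
exact: derive_coord.
Qed.

Lemma dsc_coord (R : realType) k (F : 'rV[R]_k -> R) u y :
  differentiable F y -> dsc u F y = \sum_i u 0 i * dsc (delta_mx 0 i) F y.
Proof.
move=> dF; rewrite dsc_def; under eq_bigr do rewrite dsc_def.
exact: derive_coord.
Qed.

Lemma mx_lin_coord (R : realType) k m n (f : 'rV[R]_k -> 'M[R]_(m, n)) u :
  (forall (a : R) v w, f (a *: v + w) = a *: f v + f w) ->
  f u = \sum_i u 0 i *: f (delta_mx 0 i).
Proof.
move=> lin; have f0 : f 0 = 0.
  have := lin 1 0 0; rewrite scale1r addr0 scale1r => e.
  by apply: (@addrI _ (f 0)); rewrite addr0 -e.
have fD v w : f (v + w) = f v + f w by rewrite -{1}[v]scale1r lin scale1r.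
rewrite {1}(row_sum_delta u) (big_morph f fD f0).
by apply: eq_bigr => i _; rewrite -[_ *: delta_mx 0 i]addr0 lin f0 addr0.
Qed.

Section Connection.
Variables (R : realType) (m d : nat) (U : set 'rV[R]_m) (c : R).
Variables (g J : 'rV[R]_m -> 'M[R]_d) (Om : 'rV[R]_m -> 'rV[R]_m -> 'M[R]_d).
Variable th : 'rV[R]_m -> 'M[R]_(m, d).
Implicit Types (a : R) (u v y : 'rV[R]_m) (W Z : 'rV[R]_m -> 'rV[R]_d)
  (X Y : 'rV[R]_m -> 'rV[R]_m) (w : 'rV[R]_d).

(** The tensor X ∧ Y + JX ∧ JY - 2 <JX, Y> J applied to Z, that is, the curvature tensor of the
    space form for c = 1. *)
Definition cplx_space_curv (G I : 'M[R]_d) (X Y Z : 'rV[R]_d) : 'rV[R]_d :=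
  form G Y Z *: X - form G X Z *: Y
  + form G (Y *m I) Z *: (X *m I) - form G (X *m I) Z *: (Y *m I)
  - (2 * form G (X *m I) Y) *: (Z *m I).

(* [Om u] is the connection matrix along [u], so that [nabla_u W] is
   [cov u W] below, and [th] stands for the differential of the immersion. *)
Record kaehler_pullback : Prop := KaehlerPullback {
  kp_open : open U;
  kp_sg : smooth_on U g;
  kp_sJ : smooth_on U J;
  kp_sth : smooth_on U th;
  kp_sOm : forall u, smooth_on U (Om u);
  kp_OmL : forall y, U y -> forall (a : R) (u v : 'rV[R]_m), Om (a *: u + v) y = a *: Om u y + Om v y;
  kp_sym : forall y, U y -> (g y)^T = g y;
  kp_pos : forall y, U y -> posdef (g y);
  kp_JJ : forall y, U y -> J y *m J y = - 1%:M;
  kp_Jiso : forall y, U y -> forall a b : 'rV[R]_d,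
    form (g y) (a *m J y) (b *m J y) = form (g y) a b;
  kp_compat : forall y, U y -> forall u : 'rV[R]_m,
    dmx u g y = Om u y *m g y + g y *m (Om u y)^T;
  kp_parJ : forall y, U y -> forall u : 'rV[R]_m, dmx u J y + J y *m Om u y = Om u y *m J y;
  kp_tors : forall y, U y -> forall u v : 'rV[R]_m,
    v *m dmx u th y + v *m th y *m Om u y = u *m dmx v th y + u *m th y *m Om v y;
  kp_curv : forall y, U y -> forall (u v : 'rV[R]_m) (w : 'rV[R]_d),
    w *m (dmx u (Om v) y - dmx v (Om u) y + Om v y *m Om u y - Om u y *m Om v y)
    = c *: cplx_space_curv (g y) (J y) (u *m th y) (v *m th y) w }.

Definition cov : 'rV[R]_m -> ('rV[R]_m -> 'rV[R]_d) -> 'rV[R]_m -> 'rV[R]_d :=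
  locked_with derivative_key (fun u W y => dmx u W y + W y *m Om u y).

Lemma cov_funE u W : cov u W = fun y => dmx u W y + W y *m Om u y.
Proof. by rewrite /cov unlock. Qed.

Lemma covE u W y : cov u W y = dmx u W y + W y *m Om u y.
Proof. by rewrite cov_funE. Qed.

Definition bracket (X Y : 'rV[R]_m -> 'rV[R]_m) (y : 'rV[R]_m) : 'rV[R]_m :=
  dmx (X y) Y y - dmx (Y y) X y.

Hypothesis kp : kaehler_pullback.

Let oU := kp_open kp.

Lemma Om_sum y u : U y -> Om u y = \sum_i u 0 i *: Om (delta_mx 0 i) y.
Proof. by move=> Uy; apply: (mx_lin_coord (f := Om ^~ y)); exact: (kp_OmL kp). Qed.

Lemma cov_coord W y u : U y -> smooth_on U W ->
  cov u W y = \sum_i u 0 i *: cov (delta_mx 0 i) W y.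
Proof.
move=> Uy sW; rewrite !covE (dmx_coord u (smooth_diff Uy sW)) Om_sum//.
rewrite mulmx_sumr -big_split/=; apply: eq_bigr => i _.
by rewrite covE scalerDr -scalemxAr.
Qed.

Lemma covL W y a u v : U y -> smooth_on U W ->
  cov (a *: u + v) W y = a *: cov u W y + cov v W y.
Proof.
move=> Uy sW; rewrite !covE (dmx_linear _ _ _ (smooth_diff Uy sW)) (kp_OmL kp)//.
by rewrite mulmxDr -scalemxAr scalerDr addrACA.
Qed.

Lemma cov_add W y u v : U y -> smooth_on U W ->
  cov (u + v) W y = cov u W y + cov v W y.
Proof. by move=> Uy sW; rewrite -{1}[u]scale1r covL// scale1r. Qed.

Lemma cov_scale W y a u : U y -> smooth_on U W -> cov (a *: u) W y = a *: cov u W y.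
Proof.
move=> Uy sW; rewrite [LHS]cov_coord// [X in _ = _ *: X]cov_coord// scaler_sumr.
by apply: eq_bigr => i _; rewrite mxE scalerA.
Qed.

Lemma cov_sub W y u v : U y -> smooth_on U W ->
  cov (u - v) W y = cov u W y - cov v W y.
Proof. by move=> Uy sW; rewrite -scaleN1r addrC covL// scaleN1r addrC. Qed.

Lemma cov_ext W W' y u : U y -> (forall z, U z -> W z = W' z) ->
  cov u W y = cov u W' y.
Proof. by move=> Uy e; rewrite !covE e// (dmx_open u oU Uy e). Qed.

Lemma smooth_cov_cst u W : smooth_on U W -> smooth_on U (cov u W).
Proof.
by move=> sW; rewrite cov_funE; exact: (smoothD oU (smooth_dmx u sW) (smooth_mulmx oU sW (kp_sOm kp u))).
Qed.

Lemma smooth_cov X W : smooth_on U X -> smooth_on U W ->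
  smooth_on U (fun y => cov (X y) W y).
Proof.
move=> sX sW; have s1 : smooth_on U (fun y => \sum_i X y 0 i *: cov (delta_mx 0 i) W y).
  apply: (smooth_sum oU) => i.
  exact: (smooth_scale oU (smooth_coord oU _ _ sX) (smooth_cov_cst _ sW)).
by apply: (smooth_ext oU) s1 => y Uy; rewrite -cov_coord.
Qed.

Lemma cov_lincomb k (f : 'I_k -> 'rV[R]_m -> R) (C : 'I_k -> 'rV[R]_m -> 'rV[R]_d) u y :
  U y -> (forall i, smooth_on U (f i)) -> (forall i, smooth_on U (C i)) ->
  cov u (fun z => \sum_i f i z *: C i z) y =
  \sum_i (dsc u (f i) y *: C i y + f i y *: cov u (C i) y).
Proof.
move=> Uy sf sC; rewrite !covE dmx_sum; last first.
  by move=> i; exact: smooth_diff Uy (smooth_scale oU (sf i) (sC i)).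
rewrite mulmx_suml -big_split/=; apply: eq_bigr => i _.
rewrite (dmx_scale u (smooth_diff Uy (sf i)) (smooth_diff Uy (sC i))).
by rewrite covE scalerDr addrA scalemxAl.
Qed.

(** Freezing the direction [Y] at [y] costs one first-order term; antisymmetrized, these terms form
    the bracket in [cov_curvature]. *)
Lemma cov_fieldE u Y W y : U y -> smooth_on U Y -> smooth_on U W ->
  cov u (fun z => cov (Y z) W z) y = cov (dmx u Y y) W y + cov u (cov (Y y) W) y.
Proof.
move=> Uy sY sW.
have sC i := smooth_cov_cst (delta_mx 0 i) sW.
have sY' i := smooth_coord oU 0 i sY.
have e1 : cov u (fun z => cov (Y z) W z) y = _ :=
  cov_ext u Uy (fun z Uz => cov_coord (Y z) Uz sW).
have e2 : cov u (cov (Y y) W) y = _ :=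
  cov_ext u Uy (fun z Uz => cov_coord (Y y) Uz sW).
rewrite e1 e2 (cov_lincomb u Uy sY' sC).
rewrite (cov_lincomb u Uy (fun i => smooth_cst oU (Y y 0 i)) sC).
rewrite (cov_coord (dmx u Y y) Uy sW) -big_split/=; apply: eq_bigr => i _.
by rewrite dsc_cst scale0r add0r (dmxE _ _ _ (smooth_diff Uy sY)).
Qed.

Lemma cov_scal W y a u : U y -> smooth_on U W ->
  cov u (fun z => a *: W z) y = a *: cov u W y.
Proof.
move=> Uy sW; rewrite !covE.
rewrite (dmx_scale u (differentiable_cst a y) (smooth_diff Uy sW)).
by rewrite dsc_cst scale0r add0r -scalemxAl scalerDr.
Qed.

Lemma cov_opp W y u : U y -> smooth_on U W ->
  cov u (fun z => - W z) y = - cov u W y.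
Proof.
by move=> Uy sW; rewrite !covE (dmx_opp u (smooth_diff Uy sW)) mulNmx opprD.
Qed.

Lemma cov_mulmx k (A : 'rV[R]_m -> 'rV[R]_k) (B : 'rV[R]_m -> 'M[R]_(k, d)) u y : U y ->
  smooth_on U A -> smooth_on U B ->
  cov u (fun z => A z *m B z) y = dmx u A y *m B y + cov u (fun z => A y *m B z) y.
Proof.
move=> Uy sA sB; rewrite !covE.
rewrite (dmx_mulmx u (smooth_diff Uy sA) (smooth_diff Uy sB)).
by rewrite (dmx_mull _ u (smooth_diff Uy sB)) addrA.
Qed.

(** Vanishing torsion for two constant fields, which commute. It contains the symmetry of the second
    fundamental form. *)
Lemma cov_th_sym u v y : U y ->
  cov u (fun z => v *m th z) y = cov v (fun z => u *m th z) y.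
Proof.
move=> Uy; have dth := smooth_diff Uy (kp_sth kp).
by rewrite !covE !(dmx_mull _ _ dth) (kp_tors kp).
Qed.

Lemma cov_torsion X Y y : U y -> smooth_on U X -> smooth_on U Y ->
  cov (X y) (fun z => Y z *m th z) y - cov (Y y) (fun z => X z *m th z) y
  = bracket X Y y *m th y.
Proof.
move=> Uy sX sY.
rewrite (cov_mulmx (X y) Uy sY (kp_sth kp)) (cov_mulmx (Y y) Uy sX (kp_sth kp)).
rewrite (cov_th_sym (X y) (Y y) Uy) /bracket mulmxBl.
by rewrite opprD addrACA subrr addr0.
Qed.

Lemma derive_form u W Z y : U y -> smooth_on U W -> smooth_on U Z ->
  dsc u (fun z => form (g z) (W z) (Z z) : R) y =
  form (g y) (cov u W y) (Z y) + form (g y) (W y) (cov u Z y).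
Proof.
move=> Uy sW sZ.
have dW := smooth_diff Uy sW; have dZ := smooth_diff Uy sZ.
have dg := smooth_diff Uy (kp_sg kp).
have dWg := differentiable_mulmx dW dg.
have dZt := differentiable_tr dZ.
rewrite /Defs.form -(dmxE u 0 0 (differentiable_mulmx dWg dZt)).
rewrite (dmx_mulmx u dWg dZt) (dmx_mulmx u dW dg) (dmx_tr u dZ) (kp_compat kp)//.
rewrite !covE; move: (dmx u W y) (W y) (g y) (Om u y) (Z y) (dmx u Z y).
move=> a1 a2 a3 a4 a5 a6.
have -> : (a6 + a5 *m a4)^T = a6^T + a4^T *m a5^T.
  by rewrite linearD/= trmx_mul.
have addE (A B : 'M[R]_1) : (A + B) 0 0 = A 0 0 + B 0 0 by rewrite mxE.
by rewrite !mulmxDl !mulmxDr !mulmxDl !mulmxA !addE; ring.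
Qed.

Lemma cov_J u W y : U y -> smooth_on U W ->
  cov u (fun z => W z *m J z) y = cov u W y *m J y.
Proof.
move=> Uy sW; rewrite !covE.
rewrite (dmx_mulmx u (smooth_diff Uy sW) (smooth_diff Uy (kp_sJ kp))).
by rewrite -addrA -mulmxA -mulmxDr (kp_parJ kp Uy) mulmxA mulmxDl.
Qed.

(** Matrices act on the right, so nabla_u nabla_v contributes [Om v *m Om u]; this is the order of
    the products in [kp_curv]. The second derivatives of [W] cancel by Schwarz and the mixed
    first-order terms in pairs. *)
Lemma cov_curvature_cst u v W y : U y -> smooth_on U W ->
  cov u (cov v W) y - cov v (cov u W) y =
  c *: cplx_space_curv (g y) (J y) (u *m th y) (v *m th y) (W y).
Proof.
move=> Uy sW; rewrite -(kp_curv kp Uy).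
have e (a b : 'rV[R]_m) : cov a (cov b W) y = dmx a (dmx b W) y + (dmx a W y *m Om b y +
    W y *m dmx a (Om b) y) + (dmx b W y *m Om a y + W y *m Om b y *m Om a y).
  rewrite covE covE mulmxDl; congr (_ + _); rewrite cov_funE.
  rewrite (dmx_add a (smooth_diff Uy (smooth_dmx b sW))
    (smooth_diff Uy (smooth_mulmx oU sW (kp_sOm kp b)))).
  by rewrite (dmx_mulmx a (smooth_diff Uy sW) (smooth_diff Uy (kp_sOm kp b))).
rewrite (e u v) (e v u) (dmx_schwarz u v oU Uy sW).
rewrite !mulmxDr !mulmxN !mulmxA.
move: (dmx v (dmx u W) y) (dmx u W y *m Om v y) (dmx v W y *m Om u y)
  (W y *m dmx u (Om v) y) (W y *m dmx v (Om u) y)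
  (W y *m Om v y *m Om u y) (W y *m Om u y *m Om v y) => a1 a2 a3 a4 a5 a6 a7.
by apply/rowP => i; rewrite !mxE; ring.
Qed.

Lemma cov_curvature X Y W y : U y -> smooth_on U X -> smooth_on U Y -> smooth_on U W ->
  cov (X y) (fun z => cov (Y z) W z) y - cov (Y y) (fun z => cov (X z) W z) y =
  cov (bracket X Y y) W y +
  c *: cplx_space_curv (g y) (J y) (X y *m th y) (Y y *m th y) (W y).
Proof.
move=> Uy sX sY sW; rewrite -(cov_curvature_cst _ _ Uy sW) /bracket.
rewrite (cov_sub _ _ Uy sW) (cov_fieldE (X y) Uy sY sW) (cov_fieldE (Y y) Uy sX sW).
move: (cov (dmx (X y) Y y) W y) (cov (dmx (Y y) X y) W y) => a1 a2.
move: (cov (X y) (cov (Y y) W) y) (cov (Y y) (cov (X y) W) y) => a3 a4.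
by apply/rowP => i; rewrite !mxE; ring.
Qed.

End Connection.

(** * The unit normal field and the Hopf field *)

Section Geometry.
Variables (R : realType) (m d : nat) (U : set 'rV[R]_m) (c : R).
Variables (g J : 'rV[R]_m -> 'M[R]_d) (Om : 'rV[R]_m -> 'rV[R]_m -> 'M[R]_d).
Variables (th : 'rV[R]_m -> 'M[R]_(m, d)) (N : 'rV[R]_m -> 'rV[R]_d).
Implicit Types (a : R) (u v w y : 'rV[R]_m) (W Z : 'rV[R]_m -> 'rV[R]_d)
  (X Y : 'rV[R]_m -> 'rV[R]_m) (mu : 'rV[R]_d).

Hypothesis kp : kaehler_pullback U c g J Om th.

Local Notation ip y := (form (g y)).

(** D is encoded as the set of tangent vectors orthogonal to xi = - J N; [hn_JD] says that J
    preserves tangency there. In [hn_mtg] the vector [mu] ranges over all normals, which states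
    h(xi, D) = 0 without a normal projection. *)
Record hopf_normal : Prop := HopfNormal {
  hn_sN : smooth_on U N;
  hn_th : forall y, U y -> row_free (th y);
  hn_NN : forall y, U y -> ip y (N y) (N y) = 1;
  hn_thN : forall y, U y -> forall v : 'rV[R]_m, ip y (v *m th y) (N y) = 0;
  hn_xi : forall y, U y -> exists u : 'rV[R]_m, u *m th y = - (N y *m J y);
  hn_mtg : forall y, U y -> forall (u v : 'rV[R]_m) (mu : 'rV[R]_d),
    u *m th y = - (N y *m J y) -> ip y (v *m th y) (- (N y *m J y)) = 0 ->
    (forall w : 'rV[R]_m, ip y (w *m th y) mu = 0) ->
    ip y (cov Om u (fun z => v *m th z) y) mu = 0;
  hn_JD : forall y, U y -> forall v : 'rV[R]_m,
    ip y (v *m th y) (- (N y *m J y)) = 0 ->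
    exists w : 'rV[R]_m, w *m th y = v *m th y *m J y }.

Hypothesis hn : hopf_normal.

Let oU : open U := kp_open kp.
Let sN := hn_sN hn.
Let sth := kp_sth kp.

(** Orthogonal projection to the tangent space, followed by the inverse of [th]. The closed form
    with the inverse Gram matrix makes smoothness in [y] immediate. *)
Definition tangential y (w : 'rV[R]_d) : 'rV[R]_m :=
  w *m g y *m (th y)^T *m invmx (th y *m g y *m (th y)^T).

(* [xif] is the field [xi = - J N], [xit] the tangent vector it comes from,
   [eta] the dual 1-form and [hopf] the function [alpha]. *)
Definition xif y : 'rV[R]_d := - (N y *m J y).

Definition xit y : 'rV[R]_m := tangential y (xif y).

Definition eta v y : R := ip y (v *m th y) (xif y).

Local Notation DN u y := (cov Om u N y).

Definition hopf y : R := - ip y (DN (xit y) y) (xif y).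

Lemma ipC y : U y -> forall x z : 'rV[R]_d, ip y x z = ip y z x.
Proof. by move=> Uy x z; exact: formC (kp_sym kp Uy). Qed.

Lemma induced_posdef y : U y -> posdef (th y *m g y *m (th y)^T).
Proof.
move=> Uy v v0; rewrite -form_mul; apply: (kp_pos kp Uy).
apply: contra v0 => /eqP e; apply/eqP; apply: (row_free_inj (hn_th hn Uy)).
by rewrite mul0mx.
Qed.

Lemma tangential_form y w v : U y -> forall x : 'rV[R]_d,
  ip y (tangential y x *m th y) (v *m th y) = ip y x (v *m th y).
Proof.
move=> Uy x; rewrite form_mul /Defs.form /tangential mulmxKV ?posdef_unit//.
  by rewrite trmx_mul !mulmxA.
exact: induced_posdef.
Qed.

Lemma th_inj y u v : U y -> u *m th y = v *m th y -> u = v.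
Proof. by move=> Uy; apply: (row_free_inj (hn_th hn Uy)). Qed.

Lemma tangentialK y v : U y -> tangential y (v *m th y) = v.
Proof.
move=> Uy; rewrite /tangential -!mulmxA mulmxA -!mulmxA !mulmxA.
rewrite -2!(mulmxA v) mulmxK//; apply: posdef_unit; exact: induced_posdef.
Qed.

Lemma smooth_tangential W : smooth_on U W -> smooth_on U (fun y => tangential y (W y)).
Proof.
move=> sW; have sg := kp_sg kp; have st := smooth_tr oU sth.
apply: (smooth_mulmx oU (smooth_mulmx oU (smooth_mulmx oU sW sg) st)).
apply: (smooth_inv oU); last exact: (smooth_mulmx oU (smooth_mulmx oU sth sg) st).
by move=> y Uy; apply: posdef_unit; exact: induced_posdef.
Qed.

Lemma xit_th y : U y -> xit y *m th y = xif y.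
Proof.
move=> Uy; have [u uE] := hn_xi hn Uy.
by rewrite /xit /xif -uE tangentialK.
Qed.

Lemma smooth_xif : smooth_on U xif.
Proof. exact: (smoothN oU (smooth_mulmx oU sN (kp_sJ kp))). Qed.

Lemma smooth_xit : smooth_on U xit.
Proof. exact: smooth_tangential smooth_xif. Qed.

Lemma smooth_vth v : smooth_on U (fun z => v *m th z).
Proof. exact: (smooth_mulmx oU (smooth_cst oU v) sth). Qed.

Lemma smooth_eta v : smooth_on U (eta v).
Proof. exact: (smooth_form oU (kp_sg kp) (smooth_vth v) smooth_xif). Qed.

Lemma JJ y : U y -> forall x : 'rV[R]_d, x *m J y *m J y = - x.
Proof. by move=> Uy x; rewrite -mulmxA (kp_JJ kp Uy) mulmxN mulmx1. Qed.

Lemma J_skew y : U y -> forall x z : 'rV[R]_d, ip y (x *m J y) z = - ip y x (z *m J y).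
Proof.
by move=> Uy x z; rewrite -(kp_Jiso kp Uy x) (JJ Uy) formNr opprK.
Qed.

Lemma xifJ y : U y -> xif y *m J y = N y.
Proof. by move=> Uy; rewrite /xif mulNmx (JJ Uy) opprK. Qed.

Lemma NJ y : N y *m J y = - xif y.
Proof. by rewrite /xif opprK. Qed.

Lemma xif_unit y : U y -> ip y (xif y) (xif y) = 1.
Proof. by move=> Uy; rewrite /xif formNl formNr opprK (kp_Jiso kp Uy) (hn_NN hn). Qed.

Lemma eta_xit y : U y -> eta (xit y) y = 1.
Proof. by move=> Uy; rewrite /eta xit_th// xif_unit. Qed.

Lemma etaB y u v : eta (u - v) y = eta u y - eta v y.
Proof. by rewrite /eta mulmxBl formBl. Qed.

Lemma etaD y u v : eta (u + v) y = eta u y + eta v y.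
Proof. by rewrite /eta mulmxDl formDl. Qed.

Lemma etaZ y a v : eta (a *: v) y = a * eta v y.
Proof. by rewrite /eta -scalemxAl formZl. Qed.

Lemma eta_dpart y u : U y -> eta (u - eta u y *: xit y) y = 0.
Proof. by move=> Uy; rewrite etaB etaZ eta_xit// mulr1 subrr. Qed.

(** Weingarten's formula: the derivative of <v, N> = 0. *)
Lemma shape_cov y u v : U y ->
  ip y (v *m th y) (DN u y) = - ip y (cov Om u (fun z => v *m th z) y) (N y).
Proof.
move=> Uy; apply/eqP; rewrite -addr_eq0 addrC; apply/eqP.
rewrite -(derive_form kp u Uy (smooth_vth v) sN).
rewrite (dsc_open (G := fun=> 0) u oU Uy) ?dsc_cst// => z Uz.
exact: hn_thN.
Qed.

Lemma shape_sym y u v : U y -> ip y (v *m th y) (DN u y) = ip y (u *m th y) (DN v y).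
Proof. by move=> Uy; rewrite !shape_cov// (cov_th_sym kp u v Uy). Qed.

Lemma DN_N y u : U y -> ip y (DN u y) (N y) = 0.
Proof.
move=> Uy; have := derive_form kp u Uy sN sN.
rewrite (dsc_open (G := fun=> 1) u oU Uy) ?dsc_cst; last by move=> z; exact: hn_NN.
rewrite (ipC Uy (N y)) => e; lra.
Qed.

(** Symmetry of the shape operator turns the left side into - <h(xi, u), N>, to which mixed total
    geodesy applies. *)
Lemma DN_xi_D y u : U y -> eta u y = 0 -> ip y (xif y) (DN u y) = 0.
Proof.
move=> Uy u0; rewrite -xit_th// shape_sym// shape_cov//.
by rewrite (hn_mtg hn Uy)// ?oppr0//; [exact: xit_th|exact: hn_thN].
Qed.

Lemma DN_xi y u : U y -> ip y (DN u y) (xif y) = - hopf y * eta u y.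
Proof.
move=> Uy; have := DN_xi_D Uy (eta_dpart u Uy).
rewrite (cov_sub kp _ _ Uy sN) (cov_scale kp _ _ Uy sN) formBr formZr.
by rewrite !(ipC Uy (xif y)) /hopf => e; lra.
Qed.

Lemma smooth_DN u : smooth_on U (fun y => DN u y).
Proof. exact: (smooth_cov_cst kp u sN). Qed.

Lemma smooth_hopf : smooth_on U hopf.
Proof.
have s1 := smooth_form oU (kp_sg kp) (smooth_cov kp smooth_xit sN) smooth_xif.
apply: (smooth_ext oU) (smoothM oU (@smooth_cst R _ U oU R (-1)) s1) => y Uy.
by rewrite mulN1r.
Qed.

Lemma cov_xif y u : U y -> cov Om u xif y = - (DN u y *m J y).
Proof.
move=> Uy; rewrite -(cov_J kp u Uy sN).
exact: (cov_opp Om u Uy (smooth_mulmx oU sN (kp_sJ kp))).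
Qed.

(** J is skew, maps D into the tangent space and xi to N, so <w, J mu> = - <J w, mu> vanishes on D
    and on xi. *)
Lemma normal_J y mu : U y -> (forall w, ip y (w *m th y) mu = 0) ->
  ip y (N y) mu = 0 -> forall w, ip y (w *m th y) (mu *m J y) = 0.
Proof.
move=> Uy nmu Nmu w; have w0 := eta_dpart w Uy.
have [w' w'E] := hn_JD hn Uy w0.
have := nmu w'; rewrite w'E mulmxBl -scalemxAl xit_th// mulmxBl -scalemxAl xifJ//.
rewrite formBl formZl Nmu mulr0 subr0 (J_skew Uy) => /eqP.
by rewrite oppr_eq0 => /eqP.
Qed.

Lemma cov_tangent y u X : U y -> smooth_on U X ->
  forall mu, (forall w, ip y (w *m th y) mu = 0) ->
  ip y (cov Om u (fun z => X z *m th z) y) mu =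
  ip y (cov Om u (fun z => X y *m th z) y) mu.
Proof.
by move=> Uy sX mu nmu; rewrite (cov_mulmx Om u Uy sX sth) formDl nmu add0r.
Qed.

Lemma tangent_remainder y (x : 'rV[R]_d) : U y ->
  forall w, ip y (w *m th y) (x - tangential y x *m th y) = 0.
Proof.
by move=> Uy w; rewrite formBr (ipC Uy _ (tangential _ _ *m _)) tangential_form//
  (ipC Uy x) subrr.
Qed.

(** The normal part [mu] of nabla_u N is orthogonal to N, hence J mu is normal too. Then <nabla_u N,
    mu> = - <nabla_u xi, J mu> = - <h(u, xi), J mu> = 0, which forces mu = 0. *)
Lemma DN_tangent y u : U y -> eta u y = 0 ->
  exists2 w, DN u y = w *m th y & eta w y = 0.
Proof.
move=> Uy u0; pose w := tangential y (DN u y).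
pose mu := DN u y - w *m th y.
have nmu : forall w', ip y (w' *m th y) mu = 0 by exact: tangent_remainder.
have Nmu : ip y (N y) mu = 0.
  by rewrite /mu formBr (ipC Uy) DN_N// (ipC Uy) (hn_thN hn)// subr0.
have nJ := normal_J Uy nmu Nmu.
have DNmu : ip y (DN u y) mu = 0.
  rewrite -(kp_Jiso kp Uy) -[DN u y *m J y]opprK -cov_xif// formNl.
  rewrite -[RHS]oppr0; congr (- _).
  (* Only as the image of a tangent field can xi trade places with [u] through vanishing torsion. *)
  rewrite (cov_ext kp u (W' := fun z => xit z *m th z) Uy); last first.
    by move=> z Uz; rewrite xit_th.
  rewrite (cov_tangent _ Uy smooth_xit)// (cov_th_sym kp)//.
  by apply: (hn_mtg hn Uy) => //; exact: xit_th.
have mu0 : mu = 0.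
  by apply: (posdef_eq0 (kp_pos kp Uy)); rewrite {1}/mu formBl DNmu nmu subrr.
exists w; first by apply/eqP; rewrite -subr_eq0 -/mu mu0.
rewrite /eta; have -> : w *m th y = DN u y.
  by apply/esym/eqP; rewrite -subr_eq0 -/mu mu0.
by rewrite (ipC Uy) DN_xi_D.
Qed.

(** ** The Codazzi equation *)

Lemma form_cov_xif y u (x : 'rV[R]_d) : U y ->
  ip y x (cov Om u xif y) = - ip y x (DN u y *m J y).
Proof. by move=> Uy; rewrite cov_xif// formNr. Qed.

(** The value d eta(u, v) = <nabla_u xi, v> - <nabla_v xi, u>, without a factor 1/2, after nabla xi
    = - J nabla N. *)
Definition deta u v y : R :=
  - ip y (v *m th y) (DN u y *m J y) + ip y (u *m th y) (DN v y *m J y).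

Lemma dsc_eta y u v : U y ->
  dsc u (eta v) y = ip y (cov Om u (fun z => v *m th z) y) (xif y)
    - ip y (v *m th y) (DN u y *m J y).
Proof.
move=> Uy; rewrite (derive_form kp u Uy (smooth_vth v) smooth_xif).
by rewrite form_cov_xif.
Qed.

Lemma deta_eq y u v : U y -> dsc u (eta v) y - dsc v (eta u) y = deta u v y.
Proof. by move=> Uy; rewrite !dsc_eta// (cov_th_sym kp u v Uy) /deta; lra. Qed.

Lemma curv_N y u v : U y ->
  ip y (cplx_space_curv (g y) (J y) (u *m th y) (v *m th y) (N y)) (xif y)
  = 2 * ip y (u *m th y *m J y) (v *m th y).
Proof.
move=> Uy; have Jxi w : ip y (w *m th y *m J y) (xif y) = 0.
  by rewrite J_skew// xifJ// (hn_thN hn)// oppr0.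
rewrite /cplx_space_curv !(formBl, formDl, formZl) !(hn_thN hn)// !Jxi NJ formNl.
by rewrite xif_unit//; ring.
Qed.

Lemma curv_N_D y u v : U y -> eta u y = 0 -> eta v y = 0 ->
  cplx_space_curv (g y) (J y) (u *m th y) (v *m th y) (N y)
  = (2 * ip y (u *m th y *m J y) (v *m th y)) *: xif y.
Proof.
move=> Uy u0 v0; have JN w : eta w y = 0 -> ip y (w *m th y *m J y) (N y) = 0.
  by move=> w0; rewrite J_skew// NJ formNr opprK.
rewrite /cplx_space_curv !(hn_thN hn)// !JN// !scale0r NJ scalerN opprK.
by rewrite !(subr0, addr0, add0r).
Qed.

(** [DN_xi] along [v] is differentiated along [u] and antisymmetrized. The second derivatives of N
    become curvature; the derivative of xi leaves <nabla_v N, J nabla_u N>, which is already skew in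
    [u] and [v], whence the last factor 2. *)
Lemma codazzi_xi y u v : U y ->
  dsc u hopf y * eta v y - dsc v hopf y * eta u y + hopf y * deta u v y =
  - (2 * c) * ip y (u *m th y *m J y) (v *m th y)
  - 2 * ip y (DN u y) (DN v y *m J y).
Proof.
move=> Uy.
have e (a b : 'rV[R]_m) : ip y (cov Om a (cov Om b N) y) (xif y)
    - ip y (DN b y) (DN a y *m J y)
    = - (dsc a hopf y * eta b y + hopf y * dsc a (eta b) y).
  have := derive_form kp a Uy (smooth_DN b) smooth_xif.
  rewrite form_cov_xif// => <-.
  rewrite -(dsc_mul a (smooth_diff Uy smooth_hopf) (smooth_diff Uy (smooth_eta b))).
  rewrite -dsc_opp; last exact: smooth_diff Uy (smoothM oU smooth_hopf (smooth_eta b)).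
  by apply: (dsc_open a oU Uy) => z Uz; rewrite DN_xi// mulNr.
have := congr1 (fun x => ip y x (xif y)) (cov_curvature_cst kp u v Uy sN).
rewrite formBl formZl curv_N// -deta_eq//.
have := e u v; have := e v u.
have -> : ip y (DN v y) (DN u y *m J y) = - ip y (DN u y) (DN v y *m J y).
  by rewrite (ipC Uy) J_skew.
lra.
Qed.

Lemma JD_ex y v : U y -> eta v y = 0 ->
  exists2 w, w *m th y = v *m th y *m J y & eta w y = 0.
Proof.
move=> Uy v0; have [w wE] := hn_JD hn Uy v0; exists w => //.
by rewrite /eta wE J_skew// xifJ// (hn_thN hn)// oppr0.
Qed.

Lemma DN_xit_D y w : U y -> eta w y = 0 -> ip y (w *m th y) (DN (xit y) y) = 0.
Proof. by move=> Uy w0; rewrite shape_sym// xit_th// DN_xi_D. Qed.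

(** The case u = xi of [codazzi_xi]: nabla_xi N is orthogonal to D, while nabla_v N and its image
    under J lie in D, so every term but d alpha(v) drops out. *)
Lemma hopf_D y v : U y -> eta v y = 0 -> dsc v hopf y = 0.
Proof.
move=> Uy v0; have := codazzi_xi (xit y) v Uy.
rewrite v0 eta_xit// /deta xit_th// xifJ// (ipC Uy (N y)) (hn_thN hn)//.
have [v' v'E v'0] := JD_ex Uy v0.
have -> : ip y (v *m th y) (DN (xit y) y *m J y) = 0.
  by rewrite -[RHS]oppr0 -(DN_xit_D Uy v'0) v'E J_skew// opprK.
have -> : ip y (xif y) (DN v y *m J y) = 0.
  by rewrite -[LHS]opprK -J_skew// xifJ// (ipC Uy) DN_N// oppr0.
have [w -> w0] := DN_tangent Uy v0.
have [w' <- w'0] := JD_ex Uy w0.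
by rewrite (ipC Uy) DN_xit_D//; lra.
Qed.

Lemma codazzi_D y u v : U y -> eta u y = 0 -> eta v y = 0 ->
  hopf y * deta u v y = - (2 * c) * ip y (u *m th y *m J y) (v *m th y)
    - 2 * ip y (DN u y) (DN v y *m J y).
Proof. by move=> Uy u0 v0; rewrite -codazzi_xi// u0 v0; ring. Qed.

(** The function beta with d alpha = beta eta. *)
Definition hopf_slope y : R := dsc (xit y) hopf y.

Lemma dsc_hopf y v : U y -> dsc v hopf y = hopf_slope y * eta v y.
Proof.
move=> Uy; rewrite -[v in LHS](subrK (eta v y *: xit y)) addrC.
rewrite (dsc_linear _ _ _ (smooth_diff Uy smooth_hopf)) (hopf_D Uy (eta_dpart v Uy)).
by rewrite addr0 mulrC.
Qed.

Lemma smooth_hopf_slope : smooth_on U hopf_slope.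
Proof.
have s1 : smooth_on U (fun y => \sum_i xit y 0 i * dsc (delta_mx 0 i) hopf y).
  apply: (@smooth_sum _ _ _ oU R) => i.
  by apply: (smoothM oU (smooth_coord oU _ _ smooth_xit)); exact/smooth_dsc/smooth_hopf.
apply: (smooth_ext oU) s1 => y Uy.
by rewrite /hopf_slope (dsc_coord _ (smooth_diff Uy smooth_hopf)).
Qed.

(** This is d(beta eta) = 0 on D, where d beta ∧ eta vanishes. *)
Lemma slope_deta y u v : U y -> eta u y = 0 -> eta v y = 0 ->
  hopf_slope y * deta u v y = 0.
Proof.
move=> Uy u0 v0.
have e (a b : 'rV[R]_m) : eta b y = 0 -> dsc a (dsc b hopf) y = hopf_slope y * dsc a (eta b) y.
  move=> b0; rewrite (dsc_open (G := fun z => hopf_slope z * eta b z) a oU Uy); last first.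
    by move=> z Uz; exact: dsc_hopf.
  rewrite (dsc_mul a (smooth_diff Uy smooth_hopf_slope) (smooth_diff Uy (smooth_eta b))).
  by rewrite b0 mulr0 add0r.
by rewrite -deta_eq// mulrBr -!e// (dsc_schwarz u v oU Uy smooth_hopf) subrr.
Qed.

(** ** Eigenfields of the shape operator *)

Section Flat.
(** Integrability of D, assumed in order to be refuted in [flat_false]. *)
Hypothesis flat : forall y, U y -> forall u v, eta u y = 0 -> eta v y = 0 ->
  deta u v y = 0.

Lemma perp_D_eq y u v : U y -> eta u y = 0 -> eta v y = 0 ->
  (forall w, eta w y = 0 -> ip y (w *m th y) (u *m th y) = ip y (w *m th y) (v *m th y)) ->
  u = v.
Proof.
move=> Uy u0 v0 uv; apply: (th_inj Uy); apply/eqP; rewrite -subr_eq0 -mulmxBl.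
apply/eqP/(posdef_eq0 (kp_pos kp Uy)); rewrite {2}mulmxBl formBr uv ?subrr//.
by rewrite etaB u0 v0 subrr.
Qed.

(** By symmetry of A, [flat] says that A and J anticommute on D. *)
Lemma DN_J y v w : U y -> eta v y = 0 -> w *m th y = v *m th y *m J y ->
  DN w y = - (DN v y *m J y).
Proof.
move=> Uy v0 wE.
have w0 : eta w y = 0 by rewrite /eta wE J_skew// xifJ// (hn_thN hn)// oppr0.
have [a aE a0] := DN_tangent Uy v0; have [b bE b0] := DN_tangent Uy w0.
have [a' a'E a'0] := JD_ex Uy a0.
rewrite aE -a'E bE -mulNmx; congr (_ *m _); apply: (perp_D_eq Uy) => //.
  by rewrite -scaleN1r etaZ a'0 mulr0.
move=> u u0; rewrite -bE shape_sym// wE mulNmx formNr a'E -aE.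
have := flat Uy u0 v0; rewrite /deta => e.
by rewrite J_skew//; lra.
Qed.

(** [codazzi_D] with d eta = 0 at v = J w, where J nabla_v N = nabla_w N by [DN_J]. As A is
    symmetric, this is A^2 = - c on D. *)
Lemma DN_DN y u w : U y -> eta u y = 0 -> eta w y = 0 ->
  ip y (DN u y) (DN w y) = - c * ip y (u *m th y) (w *m th y).
Proof.
move=> Uy u0 w0; have [v vE v0] := JD_ex Uy w0.
have wE : - w *m th y = v *m th y *m J y by rewrite vE (JJ Uy) mulNmx.
have DNN : DN (- w) y = - DN w y by rewrite -scaleN1r (cov_scale kp)// scaleN1r.
have := DN_J Uy v0 wE; rewrite DNN => /oppr_inj ->.
have := codazzi_D Uy u0 v0; rewrite (flat Uy u0 v0) mulr0 J_skew// -wE mulNmx formNr.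
lra.
Qed.

Definition shape : 'rV[R]_m -> 'rV[R]_m -> 'rV[R]_m :=
  locked_with derivative_key (fun y u => - tangential y (DN u y)).

Lemma shape_def y u : shape y u = - tangential y (DN u y).
Proof. by rewrite /shape unlock. Qed.

Lemma shapeE y u : U y -> eta u y = 0 -> DN u y = - (shape y u *m th y).
Proof.
move=> Uy u0; have [w wE w0] := DN_tangent Uy u0.
by rewrite shape_def wE tangentialK// mulNmx opprK.
Qed.

Lemma eta_shape y u : U y -> eta u y = 0 -> eta (shape y u) y = 0.
Proof.
move=> Uy u0; have [w wE w0] := DN_tangent Uy u0.
by rewrite shape_def wE tangentialK// -scaleN1r etaZ w0 mulr0.
Qed.

Lemma shape2 y u : U y -> eta u y = 0 -> DN (shape y u) y = c *: (u *m th y).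
Proof.
move=> Uy u0; have s0 := eta_shape Uy u0; have [b bE b0] := DN_tangent Uy s0.
rewrite bE scalemxAl; congr (_ *m _); apply: (perp_D_eq Uy) => //.
  by rewrite etaZ u0 mulr0.
move=> w w0; rewrite -bE shape_sym// -[shape y u *m th y]opprK -shapeE// formNl.
by rewrite DN_DN// -scalemxAl formZr (ipC Uy (u *m _)); ring.
Qed.

(** [DN] is minus the shape operator on D, so the eigenvalue of A is [l]. *)
Definition eigenfield l X : Prop := smooth_on U X /\
  forall y, U y -> eta (X y) y = 0 /\ DN (X y) y = - l *: (X y *m th y).

Lemma eigenfield_ex l y u : l ^+ 2 = - c -> l != 0 -> U y -> eta u y = 0 ->
  DN u y = - l *: (u *m th y) -> exists2 X, eigenfield l X & X y = u.
Proof.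
move=> lc l0 Uy u0 ue.
have [X0 [sX0 X00 X0y]] : exists X0, [/\ smooth_on U X0,
    forall z, U z -> eta (X0 z) z = 0 & X0 y = u].
  (* The constant extension of [u], projected to D; below, (1 + A / l) / 2 sends it into the
     eigenbundle because A^2 = l^2 on D by [shape2]. *)
  exists (fun z => u - eta u z *: xit z); split.
  - exact: (smoothB oU (smooth_cst oU u) (smooth_scale oU (smooth_eta u) smooth_xit)).
  - by move=> z Uz; exact: eta_dpart.
  - by rewrite u0 scale0r subr0.
exists (fun z => 2^-1 *: (X0 z + l^-1 *: shape z (X0 z))); last first.
  rewrite X0y shape_def ue scalemxAl tangentialK// scaleNr opprK scalerA mulVf//.
  rewrite scale1r -{1 2}[u]scale1r -scalerDl scalerA.
  by rewrite (_ : 2^-1 * (1 + 1) = 1 :> R) ?scale1r//; field.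
split.
  apply: (smooth_scale oU (@smooth_cst _ _ _ oU R 2^-1)).
  apply: (smoothD oU sX0); apply: (smooth_scale oU (@smooth_cst _ _ _ oU R l^-1)).
  have := smoothN oU (smooth_tangential (smooth_cov kp sX0 sN)).
  by apply: (smooth_ext oU) => z _; rewrite shape_def.
move=> z Uz; have s0 := eta_shape Uz (X00 z Uz).
split; first by rewrite etaZ etaD etaZ X00// s0; ring.
rewrite (cov_scale kp)// (cov_add kp)// (cov_scale kp)// shape2//; last exact: X00.
rewrite shapeE//; last exact: X00.
rewrite -!scalemxAl mulmxDl -!scalemxAl.
move: (shape z (X0 z) *m th z) (X0 z *m th z) => p q.
have -> : c = - l ^+ 2 by rewrite lc opprK.
by apply/rowP => i; rewrite !mxE; field.
Qed.

Lemma eigen_split y l w : l ^+ 2 = - c -> l != 0 -> U y -> eta w y = 0 ->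
  exists w1 w2, [/\ w = w1 + w2, eta w1 y = 0 /\ DN w1 y = - l *: (w1 *m th y) &
    eta w2 y = 0 /\ DN w2 y = l *: (w2 *m th y)].
Proof.
move=> lc l0 Uy w0; have s0 := eta_shape Uy w0.
exists (2^-1 *: (w + l^-1 *: shape y w)), (2^-1 *: (w + - l^-1 *: shape y w)).
split.
- by apply/rowP => i; rewrite !mxE; field.
- split; first by rewrite etaZ etaD etaZ w0 s0; ring.
  rewrite (cov_scale kp)// (cov_add kp)// (cov_scale kp)// shape2// shapeE//.
  rewrite -!scalemxAl mulmxDl -!scalemxAl.
  move: (shape y w *m th y) (w *m th y) => p q.
  have -> : c = - l ^+ 2 by rewrite lc opprK.
  by apply/rowP => i; rewrite !mxE; field.
- split; first by rewrite etaZ etaD etaZ w0 s0; ring.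
  rewrite (cov_scale kp)// (cov_add kp)// (cov_scale kp)// shape2// shapeE//.
  rewrite -!scalemxAl mulmxDl -!scalemxAl.
  move: (shape y w *m th y) (w *m th y) => p q.
  have -> : c = - l ^+ 2 by rewrite lc opprK.
  by apply/rowP => i; rewrite !mxE; field.
Qed.

Lemma eigen_orth y l u v : U y -> l != 0 ->
  DN u y = - l *: (u *m th y) -> DN v y = l *: (v *m th y) ->
  ip y (u *m th y) (v *m th y) = 0.
Proof.
move=> Uy l0 ue ve; have := shape_sym u v Uy; rewrite ue ve !formZr.
rewrite (ipC Uy (v *m _)) => e; apply: (mulfI l0); rewrite mulr0; lra.
Qed.

Lemma smooth_Xth X : smooth_on U X -> smooth_on U (fun z => X z *m th z).
Proof. by move=> sX; exact: (smooth_mulmx oU sX sth). Qed.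

Lemma cov_orth y u W Z : U y -> smooth_on U W -> smooth_on U Z ->
  (forall z, U z -> ip z (W z) (Z z) = 0) ->
  ip y (cov Om u W y) (Z y) = - ip y (W y) (cov Om u Z y).
Proof.
move=> Uy sW sZ WZ; apply/eqP; rewrite -addr_eq0; apply/eqP.
rewrite -(derive_form kp u Uy sW sZ) (dsc_open (G := fun=> 0) u oU Uy WZ).
exact: dsc_cst.
Qed.

(** The component along xi is <B, J nabla_E N> - <E, J nabla_B N>; for opposite eigenvalues both
    terms equal - l <J E, B>. *)
Lemma eigen_bracket y l E B : U y -> eigenfield l E -> eigenfield (- l) B ->
  eta (bracket E B y) y = 0.
Proof.
move=> Uy [sE eE] [sB eB].
rewrite /eta -(cov_torsion kp Uy sE sB) formBl.
have o X : smooth_on U X -> (forall z, U z -> eta (X z) z = 0) -> forall a : 'rV[R]_m,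
    ip y (cov Om a (fun z => X z *m th z) y) (xif y) = ip y (X y *m th y) (DN a y *m J y).
  move=> sX X0 a; rewrite (cov_orth a Uy (smooth_Xth sX) smooth_xif X0).
  by rewrite form_cov_xif// opprK.
rewrite !o// => [|z /eE[]|z /eB[]]//.
have [_ ->] := eE y Uy; have [_ ->] := eB y Uy.
by rewrite -!scalemxAl !formZr (ipC Uy (E y *m _)) J_skew//; ring.
Qed.

(** The curvature equation for N: on D x D its right side is a multiple of xi, invisible to [x], and
    the eigenvalue equations replace nabla_E N and nabla_B N by - l E and l B. *)
Lemma eigen_curvature y l E B (x : 'rV[R]_d) : U y ->
  eigenfield l E -> eigenfield (- l) B -> ip y (xif y) x = 0 ->
  l * (ip y (cov Om (E y) (fun z => B z *m th z) y) x
       + ip y (cov Om (B y) (fun z => E z *m th z) y) x)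
  = ip y (DN (bracket E B y) y) x.
Proof.
move=> Uy [sE eE] [sB eB] xx.
have := congr1 (fun z : 'rV[R]_d => ip y z x) (cov_curvature kp Uy sE sB sN).
have [E0 _] := eE y Uy; have [B0 _] := eB y Uy.
rewrite (curv_N_D Uy E0 B0) formBl formDl !formZl xx !mulr0 addr0 => <-.
rewrite (cov_ext kp (E y) (W := fun z => DN (B z) z) (W' := fun z => l *: (B z *m th z)) Uy); last first.
  by move=> z Uz; have [_ ->] := eB z Uz; rewrite opprK.
rewrite (cov_ext kp (B y) (W := fun z => DN (E z) z) (W' := fun z => - l *: (E z *m th z)) Uy); last first.
  by move=> z Uz; have [_ ->] := eE z Uz.
rewrite (cov_scal Om l (E y) Uy (smooth_Xth sB)) (cov_scal Om (- l) (B y) Uy (smooth_Xth sE)).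
by rewrite !formZl; ring.
Qed.

(** Self-adjointness moves nabla N from the bracket to [t]. Thus [eigen_curvature] equates l times
    the sum of <nabla_E B, t> and <nabla_B E, t> with l times their difference. *)
Lemma eigen_parallel y l E B t : l != 0 -> U y ->
  eigenfield l E -> eigenfield (- l) B -> eta t y = 0 -> DN t y = l *: (t *m th y) ->
  ip y (cov Om (B y) (fun z => E z *m th z) y) (t *m th y) = 0.
Proof.
move=> l0 Uy eE eB t0 te.
have := eigen_curvature Uy eE eB (x := t *m th y).
rewrite (ipC Uy) => /(_ t0).
rewrite (ipC Uy (DN _ _)) shape_sym// te formZr.
have [sE _] := eE; have [sB _] := eB.
rewrite -(cov_torsion kp Uy sE sB) formBl => /(mulfI l0); lra.
Qed.

(** The bracket lies in D, so nabla N along it is tangent and [eigen_curvature] makes the sum of the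
    two pairings with [mu] vanish; their difference vanishes by torsion. *)
Lemma eigen_normal y l E B mu : l != 0 -> U y ->
  eigenfield l E -> eigenfield (- l) B ->
  (forall w, ip y (w *m th y) mu = 0) ->
  ip y (cov Om (B y) (fun z => E z *m th z) y) mu = 0.
Proof.
move=> l0 Uy eE eB nmu.
have := eigen_curvature Uy eE eB (x := mu).
rewrite -xit_th// nmu => /(_ erefl).
have [w -> w0] := DN_tangent Uy (eigen_bracket Uy eE eB).
rewrite nmu => /eqP; rewrite mulf_eq0 (negbTE l0) => /eqP.
have [sE _] := eE; have [sB _] := eB.
have := congr1 (fun z : 'rV[R]_d => ip y z mu) (cov_torsion kp Uy sE sB).
by rewrite formBl nmu; lra.
Qed.

Lemma curv_eigen y (s : 'rV[R]_d) : U y ->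
  ip y (cplx_space_curv (g y) (J y) s (s *m J y) s) (s *m J y) = - 4 * ip y s s ^+ 2.
Proof.
move=> Uy; have o : ip y (s *m J y) s = 0.
  by have := J_skew Uy s s; rewrite (ipC Uy s) => e; lra.
have o' : ip y s (s *m J y) = 0 by rewrite (ipC Uy).
rewrite /cplx_space_curv !(formBl, formDl, formZl) !(JJ Uy) !formNl o o'.
by rewrite !(kp_Jiso kp Uy); ring.
Qed.

Lemma eigenfield_J l X : eigenfield l X ->
  exists2 Y, eigenfield (- l) Y & forall z, U z -> Y z *m th z = X z *m th z *m J z.
Proof.
move=> [sX eX]; pose Y z := tangential z (X z *m th z *m J z).
have YE z : U z -> Y z *m th z = X z *m th z *m J z.
  move=> Uz; have [X0 _] := eX z Uz; have [w wE _] := JD_ex Uz X0.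
  by rewrite /Y -wE tangentialK.
exists Y => //; split.
  exact: (smooth_tangential (smooth_mulmx oU (smooth_Xth sX) (kp_sJ kp))).
move=> z Uz; have [X0 XE] := eX z Uz; split.
  by rewrite /eta YE// J_skew// xifJ// (hn_thN hn)// oppr0.
by rewrite (DN_J Uz X0 (YE z Uz)) XE YE// [- l *: _]scaleNr mulNmx !opprK -scalemxAl.
Qed.

(** By [DN_DN], - c |u|^2 is the squared norm of nabla_u N. *)
Lemma flat_c_neg y u : U y -> eta u y = 0 -> u != 0 -> c != 0 -> c < 0.
Proof.
move=> Uy u0 un0 c0; rewrite lt_neqAle c0/=.
have un : 0 < ip y (u *m th y) (u *m th y).
  apply: (kp_pos kp Uy); apply: contra un0 => /eqP e.
  by apply/eqP; apply: (th_inj Uy); rewrite mul0mx.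
have := posdef_ge0 (DN u y) (kp_pos kp Uy).
by rewrite DN_DN// mulNr oppr_ge0 pmulr_lle0.
Qed.

(** * An eigenfield S, its partner T = J S, and the curvature of their plane *)

Section Eigenpair.
Variables (l : R) (S T : 'rV[R]_m -> 'rV[R]_m).
Hypotheses (lc : l ^+ 2 = - c) (l0 : l != 0).
Hypotheses (eS : eigenfield l S) (eT : eigenfield (- l) T).
Hypothesis TE : forall z, U z -> T z *m th z = S z *m th z *m J z.

Let sS : smooth_on U S := eS.1.
Let sT : smooth_on U T := eT.1.
Let s z := S z *m th z.
Let t z := T z *m th z.
Let ss : smooth_on U s := smooth_Xth sS.
Let st : smooth_on U t := smooth_Xth sT.

Let eSz z : U z -> eta (S z) z = 0 /\ DN (S z) z = - l *: s z.
Proof. by move=> Uz; exact: eS.2. Qed.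

Let eTz z : U z -> eta (T z) z = 0 /\ DN (T z) z = l *: t z.
Proof. by move=> Uz; have := eT.2 z Uz; rewrite opprK. Qed.

Let eS' : eigenfield (- - l) S. Proof. by rewrite opprK. Qed.

Let l0' : - l != 0. Proof. by rewrite oppr_eq0. Qed.

Let lc' : (- l) ^+ 2 = - c. Proof. by rewrite sqrrN. Qed.

Let st0 z : U z -> ip z (s z) (t z) = 0.
Proof. by move=> Uz; exact: eigen_orth Uz l0 (eSz Uz).2 (eTz Uz).2. Qed.

Let covt y u : U y -> cov Om u t y = cov Om u s y *m J y.
Proof. by move=> Uy; rewrite -(cov_J kp u Uy ss); exact: (cov_ext kp u Uy TE). Qed.

(** For [u] in the bundle of - l this is [eigen_parallel] for S. For [u] in the bundle of l the
    derivative is first moved from [s] to [t], and [eigen_parallel] is used with the signs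
    exchanged. *)
Lemma cov_st_split y u : U y -> eta u y = 0 -> ip y (cov Om u s y) (t y) = 0.
Proof.
move=> Uy u0; have [u1 [u2 [-> [u10 u1e] [u20 u2e]]]] := eigen_split lc l0 Uy u0.
have [E1 e1 <-] := eigenfield_ex lc l0 Uy u10 u1e.
have u2e' : DN u2 y = - - l *: (u2 *m th y) by rewrite opprK.
have [E2 e2 <-] := eigenfield_ex lc' l0' Uy u20 u2e'.
rewrite (cov_add kp _ _ Uy ss) formDl.
have [T0 Te] := eTz Uy; have [S0 Se] := eSz Uy.
have e1' : eigenfield (- - l) E1 by rewrite opprK.
rewrite (eigen_parallel l0 Uy eS e2 T0 Te) addr0 (cov_orth _ Uy ss st st0).
by rewrite (ipC Uy) (eigen_parallel l0' Uy eT e1' S0 Se) oppr0.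
Qed.

(** There is no normal part by [eigen_normal] and no part in the bundle of - l by [eigen_parallel];
    the coefficient of xi comes from nabla_T xi = - J nabla_T N. *)
Lemma cov_T_S y : U y ->
  exists q, [/\ cov Om (T y) s y = q *m th y + (- l * ip y (s y) (s y)) *: xif y,
    eta q y = 0 & DN q y = - l *: (q *m th y)].
Proof.
move=> Uy; set Q := cov Om (T y) s y.
have [T0 Te] := eTz Uy; have [S0 Se] := eSz Uy.
have QN : ip y Q (N y) = 0.
  rewrite /Q (cov_orth (T y) Uy ss sN); last by move=> z Uz; exact: hn_thN.
  by rewrite Te formZr st0// mulr0 oppr0.
pose q := tangential y Q; pose mu := Q - q *m th y.
have nmu : forall w, ip y (w *m th y) mu = 0 by exact: tangent_remainder.
have mu0 : mu = 0.
  apply: (posdef_eq0 (kp_pos kp Uy)); rewrite {1}/mu formBl nmu subr0.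
  exact: (eigen_normal l0 Uy eS eT nmu).
have QE : Q = q *m th y by apply/eqP; rewrite -subr_eq0 -/mu mu0.
have etaq : eta q y = - l * ip y (s y) (s y).
  rewrite /eta -QE /Q (cov_orth (T y) Uy ss smooth_xif); last by move=> z /eSz[].
  rewrite form_cov_xif// opprK Te -scalemxAl formZr /t TE// (JJ Uy) formNr.
  by rewrite -/(s y); ring.
have q00 := eta_dpart q Uy.
have [q1 [q2 [qE [q10 q1e] [q20 q2e]]]] := eigen_split lc l0 Uy q00.
have q2e' : DN q2 y = - - l *: (q2 *m th y) by rewrite opprK.
have q2_0 : q2 *m th y = 0.
  apply: (posdef_eq0 (kp_pos kp Uy)).
  have := eigen_parallel l0 Uy eS eT q20 q2e; rewrite -/Q QE.
  rewrite -[q](subrK (eta q y *: xit y)) qE !mulmxDl -scalemxAl xit_th// !formDl formZl.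
  by rewrite (eigen_orth Uy l0 q1e q2e) (ipC Uy (xif y)) -/(eta _ _) q20 mulr0 addr0 add0r.
exists q1; split => //.
rewrite QE -{1}[q](subrK (eta q y *: xit y)) qE !mulmxDl q2_0 addr0.
by rewrite -scalemxAl xit_th// etaq.
Qed.

Lemma eigenpair_zero y : U y -> c != 0 -> ip y (s y) (s y) = 0.
Proof.
move=> Uy c0; have [T0 Te] := eTz Uy; have [S0 Se] := eSz Uy.
pose P z := cov Om (S z) s z; pose Q z := cov Om (T z) s z.
have sP : smooth_on U P := smooth_cov kp sS ss.
have sQ : smooth_on U Q := smooth_cov kp sT ss.
have Pt z : U z -> ip z (P z) (t z) = 0 by move=> Uz; exact: cov_st_split Uz (eSz Uz).1.
have Qt z : U z -> ip z (Q z) (t z) = 0 by move=> Uz; exact: cov_st_split Uz (eTz Uz).1.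
have := congr1 (fun z : 'rV[R]_d => ip y z (t y)) (cov_curvature kp Uy sS sT ss).
(* [P] and [Q] are orthogonal to t = J s everywhere, so the outer derivatives pass to [t] and the
   left side becomes 2 <P, J Q>. *)
rewrite formBl formDl formZl (cov_orth (S y) Uy sQ st Qt) (cov_orth (T y) Uy sP st Pt).
rewrite (cov_st_split Uy (eigen_bracket Uy eS eT)) add0r.
rewrite !covt// /t TE// curv_eigen// -/(P y) -/(Q y) -/(s y).
have -> : ip y (Q y) (P y *m J y) = - ip y (P y) (Q y *m J y).
  by rewrite (ipC Uy) J_skew.
suff -> : ip y (P y) (Q y *m J y) = c * ip y (s y) (s y) ^+ 2.
  move=> e; have : c * ip y (s y) (s y) ^+ 2 = 0 by lra.
  by move=> /eqP; rewrite mulf_eq0 (negbTE c0)/= sqrf_eq0 => /eqP.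
have [q [qE q0 qe]] := cov_T_S Uy; rewrite /Q qE mulmxDl -scalemxAl xifJ//.
rewrite formDr formZr.
have -> : ip y (P y) (N y) = l * ip y (s y) (s y).
  rewrite /P (cov_orth (S y) Uy ss sN); last by move=> z Uz; exact: hn_thN.
  by rewrite Se formZr; ring.
(* J q lies in the bundle of - l, where nabla_S S has no component. *)
have -> : ip y (P y) (q *m th y *m J y) = 0.
  have [f fE f0] := JD_ex Uy q0; have := DN_J Uy q0 fE; rewrite qe -scalemxAl -fE.
  rewrite -scaleNr => fe; have [F eF Fy] := eigenfield_ex lc' l0' Uy f0 fe.
  have sF : smooth_on U (fun z => F z *m th z) by exact: smooth_Xth eF.1.
  rewrite -Fy /P (cov_orth (S y) Uy ss sF).
    by rewrite (ipC Uy) (eigen_parallel l0' Uy eF eS' S0 Se) oppr0.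
  move=> z Uz; apply: (eigen_orth Uz l0 (eSz Uz).2).
  by rewrite (eF.2 z Uz).2 opprK.
have -> : c = - l ^+ 2 by rewrite lc opprK.
ring.
Qed.

End Eigenpair.

Lemma flat_false y u : U y -> eta u y = 0 -> u != 0 -> c != 0 -> False.
Proof.
move=> Uy u0 un0 c0; have cn := flat_c_neg Uy u0 un0 c0.
pose l := Num.sqrt (- c).
have lc : l ^+ 2 = - c by rewrite sqr_sqrtr// oppr_ge0 ltW.
have l0 : l != 0 by rewrite -sqrf_eq0 lc oppr_eq0.
have lc' : (- l) ^+ 2 = - c by rewrite sqrrN.
have l0' : - l != 0 by rewrite oppr_eq0.
have z0 k v : k ^+ 2 = - c -> k != 0 -> eta v y = 0 -> DN v y = - k *: (v *m th y) -> v = 0.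
  move=> kc k0 v0 ve; have [S eS Sy] := eigenfield_ex kc k0 Uy v0 ve.
  have [T eT TE] := eigenfield_J eS.
  have := eigenpair_zero kc k0 eS eT TE Uy c0.
  rewrite Sy => /(posdef_eq0 (kp_pos kp Uy)) e.
  by apply: (th_inj Uy); rewrite e mul0mx.
have [u1 [u2 [uE [u10 u1e] [u20 u2e]]]] := eigen_split lc l0 Uy u0.
have u2e' : DN u2 y = - - l *: (u2 *m th y) by rewrite opprK.
move: un0; rewrite uE (z0 l u1)// (z0 (- l) u2)// addr0 eqxx.
by [].
Qed.

End Flat.

End Geometry.

(** * Constancy of alpha *)

Section HopfConstant.
Variables (R : realType) (m d : nat) (c : R).
Variables (g J : 'rV[R]_m -> 'M[R]_d) (Om : 'rV[R]_m -> 'rV[R]_m -> 'M[R]_d).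
Variables (th : 'rV[R]_m -> 'M[R]_(m, d)) (N : 'rV[R]_m -> 'rV[R]_d).

Lemma kaehler_pullbackS (U U' : set 'rV[R]_m) : open U' -> U' `<=` U ->
  kaehler_pullback U c g J Om th -> kaehler_pullback U' c g J Om th.
Proof.
move=> oU' sU [_ ? ? ? ? OmL sym pos II iso compat parJ tors curv].
split=> //; do ?[by move=> *; exact: (smoothS sU)].
- by move=> y /sU; exact: OmL.
- by move=> y /sU; exact: sym.
- by move=> y /sU; exact: pos.
- by move=> y /sU; exact: II.
- by move=> y /sU; exact: iso.
- by move=> y /sU; exact: compat.
- by move=> y /sU; exact: parJ.
- by move=> y /sU; exact: tors.
- by move=> y /sU; exact: curv.
Qed.

Lemma hopf_normalS (U U' : set 'rV[R]_m) : U' `<=` U ->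
  hopf_normal U g J Om th N -> hopf_normal U' g J Om th N.
Proof.
move=> sU [? thI NN thN xi mtg JD]; split; first exact: (smoothS sU).
- by move=> y /sU; exact: thI.
- by move=> y /sU; exact: NN.
- by move=> y /sU; exact: thN.
- by move=> y /sU; exact: xi.
- by move=> y /sU; exact: mtg.
- by move=> y /sU; exact: JD.
Qed.

Lemma open_neq0 (U : set 'rV[R]_m) (f : 'rV[R]_m -> R) :
  open U -> smooth_on U f -> open (U `&` [set y | f y != 0]).
Proof.
move=> oU sf; rewrite openE => y [Uy fy].
have cf : {for y, continuous f} by exact: sf 0%N y Uy.
have o0 : nbhs (f y) [set x : R | x != 0].
  by apply: open_nbhs_nbhs; split => //; exact: open_neq.
have : \forall z \near y, f z != 0 := cf _ o0.
by apply: filterS2 (open_nbhs_nbhs (conj oU Uy)) => z.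
Qed.

Lemma hopf_const (U : set 'rV[R]_m) y v : c != 0 ->
  kaehler_pullback U c g J Om th -> hopf_normal U g J Om th N ->
  (forall z, U z -> exists2 u, eta g J th N u z = 0 & u != 0) ->
  U y -> dsc v (hopf g J Om th N) y = 0.
Proof.
move=> c0 kp hn exD Uy; rewrite (dsc_hopf kp hn v Uy).
have [->|b0] := eqVneq (hopf_slope g J Om th N y) 0; first by rewrite mul0r.
exfalso; have oU := kp_open kp.
(* On this open set [slope_deta] makes d eta vanish on D, so [flat_false] applies to the restricted
   data. *)
have oU' := open_neq0 oU (smooth_hopf_slope kp hn).
have sU' := @subIsetl _ U [set y | hopf_slope g J Om th N y != 0].
have kp' := kaehler_pullbackS oU' sU' kp; have hn' := hopf_normalS sU' hn.
have [u u0 un0] := exD y Uy.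
apply: (flat_false kp' hn' _ (conj Uy b0) u0 un0 c0) => z [Uz bz] a b a0 b0'.
by have /eqP := slope_deta kp hn Uz a0 b0'; rewrite mulf_eq0 (negbTE bz)/= => /eqP.
Qed.

End HopfConstant.

(** * Identity (a), on D and then on all tangent vectors *)

Section HopfIdentity.
Variables (R : realType) (m d : nat) (U : set 'rV[R]_m) (c : R).
Variables (g J : 'rV[R]_m -> 'M[R]_d) (Om : 'rV[R]_m -> 'rV[R]_m -> 'M[R]_d).
Variables (th : 'rV[R]_m -> 'M[R]_(m, d)) (N : 'rV[R]_m -> 'rV[R]_d).
Implicit Types (a : R) (u v w y X : 'rV[R]_m).
Hypotheses (kp : kaehler_pullback U c g J Om th) (hn : hopf_normal U g J Om th N).

Local Notation ip y := (form (g y)).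
Local Notation A y u := (shape g Om th N y u).
Local Notation eta := (eta g J th N).
Local Notation hopf := (hopf g J Om th N).
Local Notation xit := (xit g J th N).
Local Notation tang := (tangential g th).

Definition rot y u : 'rV[R]_m := tang y (u *m th y *m J y).

Lemma tangential_lin y a (v w : 'rV[R]_d) :
  tang y (a *: v + w) = a *: tang y v + tang y w.
Proof. by rewrite /tangential !mulmxDl -!scalemxAl. Qed.

Lemma tangential_normal y (w : 'rV[R]_d) : U y ->
  (forall v, ip y (v *m th y) w = 0) -> tang y w = 0.
Proof.
move=> Uy nw; apply: (th_inj hn Uy); rewrite mul0mx.
apply: (posdef_eq0 (kp_pos kp Uy)).
by rewrite (tangential_form kp hn)// (ipC kp Uy) nw.
Qed.

Lemma rot_lin y a u v : rot y (a *: u + v) = a *: rot y u + rot y v.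
Proof. by rewrite /rot !mulmxDl -!scalemxAl tangential_lin. Qed.

Lemma shape_lin y a u v : U y -> A y (a *: u + v) = a *: A y u + A y v.
Proof.
by move=> Uy; rewrite !shape_def (covL kp)// ?tangential_lin ?opprD ?scalerN//; exact: hn_sN hn.
Qed.

Lemma rot_th y u : U y -> eta u y = 0 -> rot y u *m th y = u *m th y *m J y.
Proof. by move=> Uy u0; have [w wE _] := JD_ex kp hn Uy u0; rewrite /rot -wE (tangentialK kp hn). Qed.

Lemma eta_rot y u : U y -> eta u y = 0 -> eta (rot y u) y = 0.
Proof.
by move=> Uy u0; have [w wE w0] := JD_ex kp hn Uy u0; rewrite /rot -wE (tangentialK kp hn).
Qed.

Lemma rot_xit y : U y -> rot y (xit y) = 0.
Proof.
move=> Uy; rewrite /rot (xit_th kp hn)// (xifJ N kp)//; apply: tangential_normal => // v.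
exact: hn_thN hn y Uy v.
Qed.

Lemma rot_inj0 y u : U y -> eta u y = 0 -> rot y u = 0 -> u = 0.
Proof.
move=> Uy u0 r0; apply: (th_inj hn Uy); rewrite mul0mx.
apply: (posdef_eq0 (kp_pos kp Uy)).
by rewrite -(kp_Jiso kp Uy) -rot_th// r0 mul0mx form0l.
Qed.

Lemma shape_form y u v : U y ->
  ip y (A y u *m th y) (v *m th y) = - ip y (cov Om u N y) (v *m th y).
Proof. by move=> Uy; rewrite shape_def mulNmx formNl (tangential_form kp hn). Qed.

Lemma shape_xit y : U y -> A y (xit y) = hopf y *: xit y.
Proof.
move=> Uy; apply: (th_inj hn Uy); apply/eqP; rewrite -subr_eq0 -mulmxBl.
apply/eqP/(posdef_eq0 (kp_pos kp Uy)).
have e v : ip y ((A y (xit y) - hopf y *: xit y) *m th y) (v *m th y) = 0.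
  rewrite mulmxBl formBl shape_form// -scalemxAl formZl (xit_th kp hn)//.
  rewrite -[v](subrK (eta v y *: xit y)); have := eta_dpart kp hn v Uy.
  move: (v - _) => v' v'0.
  rewrite mulmxDl -scalemxAl !formDr !formZr !(xit_th kp hn)//.
  rewrite (ipC kp Uy _ (v' *m _)) (DN_xit_D kp hn)// (ipC kp Uy _ (v' *m _)).
  rewrite -[form _ (v' *m _) _]/(eta v' y) v'0 (xif_unit kp hn)// /hopf; ring.
exact: e.
Qed.

(** [codazzi_D] tested against all of D; this suffices since the left side lies in D. *)
Lemma hopf_identity_D y X : U y -> eta X y = 0 ->
  2 *: A y (rot y (A y X)) - hopf y *: (rot y (A y X) + A y (rot y X))
  - (2 * c) *: rot y X = 0.
Proof.
move=> Uy X0; have AX0 := eta_shape kp hn Uy X0; have rX0 := eta_rot Uy X0.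
have rA0 := eta_rot Uy AX0; have Ar0 := eta_shape kp hn Uy rX0.
have ArA0 := eta_shape kp hn Uy rA0.
have e0 : eta 0 y = 0 by rewrite /eta mul0mx form0l.
apply: (perp_D_eq kp hn Uy _ e0).
  by rewrite !(etaB, etaZ, etaD) rX0 rA0 Ar0 ArA0; ring.
move=> v v0; rewrite mul0mx form0r (ipC kp Uy).
rewrite !(mulmxBl, mulmxDl) -!scalemxAl !(mulmxBl, mulmxDl) !(formBl, formZl, formDl).
rewrite !shape_form// !rot_th//.
have DNs u w : eta w y = 0 -> ip y (cov Om w N y) (v *m th y) = ip y (w *m th y) (cov Om v N y).
  by move=> w0; rewrite (ipC kp Uy) (shape_sym kp hn).
rewrite !DNs// !rot_th//.
have AE : A y X *m th y = - cov Om X N y by rewrite (shapeE kp hn)// opprK.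
rewrite AE !mulNmx !formNl !(J_skew kp Uy).
have := codazzi_D kp hn Uy X0 v0; rewrite /deta.
rewrite (ipC kp Uy (v *m th y)) (J_skew kp Uy (cov Om X N y)) (J_skew kp Uy (X *m th y)).
lra.
Qed.

(** As phi xi = 0 and A xi = alpha xi, the component of [X] along xi contributes nothing. *)
Lemma hopf_identity y X : U y ->
  2 *: A y (rot y (A y X)) - hopf y *: (rot y (A y X) + A y (rot y X))
  - (2 * c) *: rot y X = 0.
Proof.
move=> Uy; have X0 := eta_dpart kp hn X Uy.
move: (hopf_identity_D Uy X0) (esym (subrK (eta X y *: xit y) X)).
move: (X - _) => X'; move: (eta X y) => s e ->.
rewrite (addrC X') shape_lin// shape_xit// scalerA !rot_lin !rot_xit// !scaler0 !add0r.
by [].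
Qed.

End HopfIdentity.

(** * Kaehler curvature tensors *)

Section CurvatureAlgebra.
Variables (R : realType) (d : nat) (I : 'M[R]_d).
Variable Q : 'rV[R]_d -> 'rV[R]_d -> 'rV[R]_d -> 'rV[R]_d -> R.
Implicit Types x y z w : 'rV[R]_d.
Hypothesis II : I *m I = - 1%:M.
Hypothesis Q1 : forall x x' y z w, Q (x + x') y z w = Q x y z w + Q x' y z w.
Hypothesis Q3 : forall x y z z' w, Q x y (z + z') w = Q x y z w + Q x y z' w.
Hypothesis Q12 : forall x y z w, Q x y z w = - Q y x z w.
Hypothesis Q34 : forall x y z w, Q x y z w = - Q x y w z.
Hypothesis Qb : forall x y z w, Q x y z w + Q y z x w + Q z x y w = 0.
Hypothesis QI : forall x y z w, Q x y (z *m I) (w *m I) = Q x y z w.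

Let Q2 x y y' z w : Q x (y + y') z w = Q x y z w + Q x y' z w.
Proof. by rewrite !(Q12 x) Q1 opprD. Qed.

Let Q4 x y z w w' : Q x y z (w + w') = Q x y z w + Q x y z w'.
Proof. by rewrite !(Q34 x y z) Q3 opprD. Qed.

Let QN1 x y z w : Q (- x) y z w = - Q x y z w.
Proof.
have Q0 : Q 0 y z w = 0 by have := Q1 0 0 y z w; rewrite addr0; lra.
by have := Q1 x (- x) y z w; rewrite subrr Q0; lra.
Qed.

Let QN2 x y z w : Q x (- y) z w = - Q x y z w.
Proof. by rewrite Q12 QN1 -Q12. Qed.

Let QN3 x y z w : Q x y (- z) w = - Q x y z w.
Proof.
have Q0 : Q x y 0 w = 0 by have := Q3 x y 0 0 w; rewrite addr0; lra.
by have := Q3 x y z (- z) w; rewrite subrr Q0; lra.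
Qed.

Let QN4 x y z w : Q x y z (- w) = - Q x y z w.
Proof. by rewrite Q34 QN3 -Q34. Qed.

(** Four instances of the Bianchi identity combine to the pair symmetry; the other facts only
    reorder arguments so that the system becomes linear. *)
Let Qpair x y z w : Q x y z w = Q z w x y.
Proof.
have := Qb x y z w; have := Qb y z w x; have := Qb z w x y; have := Qb w x y z.
have := Q34 z w y x; have := Q34 y z w x; have := Q34 z x w y.
have := Q34 w x z y; have := Q34 x y w z; have := Q34 w y x z.
have := Q12 z x y w; have := Q12 w y z x; have := Q12 z x w y; have := Q12 w y x z.
have := Q34 x z y w; have := Q34 y w z x.
lra.
Qed.

Let xII x : x *m I *m I = - x.
Proof. by rewrite -mulmxA II mulmxN mulmx1. Qed.

Let QI1 x y z w : Q (x *m I) (y *m I) z w = Q x y z w.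
Proof. by rewrite Qpair QI Qpair. Qed.

Hypothesis Qhol : forall x, Q x (x *m I) (x *m I) x = 0.

Let IR x y z w : Q x y (z *m I) w = - Q x y z (w *m I).
Proof. by rewrite -QI xII QN3. Qed.

Let IL x y z w : Q (x *m I) y z w = - Q x (y *m I) z w.
Proof. by rewrite -QI1 xII QN1. Qed.

Let Qswap x y z w : Q x y z w = Q y x w z.
Proof. by rewrite Q12 Q34 opprK. Qed.

(* polarizing the hypothesis at [x + y] and [x - y] *)
Let Qpol x y : Q x (x *m I) (y *m I) y = - 2 * Q x (y *m I) (y *m I) x.
Proof.
have hp := Qhol (x + y); have hm := Qhol (x - y).
move: hp hm; rewrite !(mulmxDl, mulmxBl, mulNmx) !(Q1, Q2, Q3, Q4, QN1, QN2, QN3, QN4).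
rewrite !Qhol.
have e1 : Q y (y *m I) (x *m I) x = Q x (x *m I) (y *m I) y.
  by rewrite Qpair Qswap -Qpair Qswap.
have e2 : Q y (x *m I) (x *m I) y = Q x (y *m I) (y *m I) x.
  by rewrite IR -IL Qswap.
have e4 : Q x (y *m I) (x *m I) y = Q x (y *m I) (y *m I) x.
  by rewrite IR -Q34.
have e3 : Q y (x *m I) (y *m I) x = Q x (y *m I) (y *m I) x.
  by rewrite Qpair Qswap.
lra.
Qed.

(** With a = Q(x, y, y, x) and b = Q(x, Jy, Jy, x), Bianchi and [Qpol] give a + b = - 2 b. Replacing
    y by J y exchanges a and b, so a = - 3 b and b = - 3 a. *)
Let Qsec x y : Q x y y x = 0.
Proof.
have e z : Q x (x *m I) (z *m I) z = Q x z z x + Q x (z *m I) (z *m I) x.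
  have := Qb x (x *m I) (z *m I) z; rewrite QI1 (Q34 x z x z).
  rewrite (Q12 (z *m I) x) (IR x (z *m I) x z) (Q34 x (z *m I) x); lra.
have := e y; have := e (y *m I); rewrite !Qpol !xII !(QN2, QN3); lra.
Qed.

(** Polarizing [Qsec] makes [Q] skew in its two middle arguments as well; the three Bianchi terms
    are then equal. *)
Lemma hol_curv_zero x y z w : Q x y z w = 0.
Proof.
have e1 a b b' : Q a b b b' = 0.
  have := Qsec (a + b') b; rewrite !(Q1, Q4) !Qsec.
  have -> : Q b' b b a = Q a b b b' by rewrite Qpair Qswap -Qpair Qswap.
  lra.
have e2 a b b' v : Q a b b' v = - Q a b' b v.
  by have := e1 a (b + b') v; rewrite !(Q2, Q3) !e1; lra.
have := Qb x y z w; have := e2 x y z w; have := Q12 x z y w.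
have := e2 z x y w; have := Q12 z y x w; lra.
Qed.

End CurvatureAlgebra.

(** Both tensors have the Kaehler symmetries and the same holomorphic sectional curvatures, so
    [hol_curv_zero] applies to their difference. *)
Lemma hol_curvature (R : realType) d (G I : 'M[R]_d) (c : R)
    (Rm : 'rV[R]_d -> 'rV[R]_d -> 'rV[R]_d -> 'rV[R]_d) :
  G^T = G -> posdef G -> I *m I = - 1%:M ->
  (forall a b, form G (a *m I) (b *m I) = form G a b) ->
  (forall x x' y z, Rm (x + x') y z = Rm x y z + Rm x' y z) ->
  (forall x y z z', Rm x y (z + z') = Rm x y z + Rm x y z') ->
  (forall x y z, Rm x y z = - Rm y x z) ->
  (forall x y z w, form G (Rm x y z) w = - form G (Rm x y w) z) ->
  (forall x y z, Rm x y z + Rm y z x + Rm z x y = 0) ->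
  (forall x y z, Rm x y (z *m I) = Rm x y z *m I) ->
  (forall x, form G (Rm x (x *m I) (x *m I)) x = 4 * c * form G x x ^+ 2) ->
  forall x y z, Rm x y z = c *: cplx_space_curv G I x y z.
Proof.
move=> sG pG II iI R1 R3 R12 R34 Rb RI Rhol x y z.
have C a b : form G a b = form G b a by exact: formC.
have III a : a *m I *m I = - a by rewrite -mulmxA II mulmxN mulmx1.
have sk a b : form G (a *m I) b = - form G a (b *m I).
  by rewrite -(iI a) III formNr opprK.
have sk' a b : form G (a *m I) b = - form G (b *m I) a by rewrite sk C.
have sk2 a b : form G a (b *m I) = - form G (a *m I) b by rewrite sk opprK.
have skd a : form G a (a *m I) = 0 by have := sk a a; rewrite C; lra.
pose E := (formBl, formDl, formZl, formBr, formDr, formZr, formNl, formNr, mulmxDl).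
pose Q a b v w := form G (Rm a b v) w - c * form G (cplx_space_curv G I a b v) w.
apply: (posdef_inj pG) => w; rewrite formZl; apply/eqP; rewrite -subr_eq0; apply/eqP.
rewrite -/(Q x y z w); apply: (hol_curv_zero (Q := Q) II) => {x y z w}
  [x x' y z w|x y z z' w|x y z w|x y z w|x y z w|x y z w|x];
  rewrite /Q /cplx_space_curv.
- by rewrite R1 !E; ring.
- by rewrite R3 !E; ring.
- by rewrite R12 !E (sk' y x); ring.
- by rewrite R34 !E (sk' w z); ring.
- have := congr1 (fun a => form G a w) (Rb x y z); rewrite !formDl form0l !E.
  rewrite (C z x) (C y x) (C z y) (sk' z x) (sk' y x) (sk' z y) => e.
  by rewrite -[RHS]e; ring.
- by rewrite RI !E !III !formNl !iI !sk2; ring.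
- by rewrite Rhol !E !III !formNl !iI skd (C _ x) skd; ring.
Qed.

(** * Levi-Civita connections in a chart *)

Section ChartMetric.
Variables (R : realType) (d : nat) (W : set 'rV[R]_d) (g : 'rV[R]_d -> 'M[R]_d).
Implicit Types (a : R) (z u v w : 'rV[R]_d).

Record metric_on : Prop := MetricOn {
  mo_open : open W;
  mo_smooth : smooth_on W g;
  mo_sym : forall z, W z -> (g z)^T = g z;
  mo_pos : forall z, W z -> posdef (g z) }.

Definition koszul z u v w : R := 2^-1 * (form (dmx u g z) v w
  + form (dmx v g z) u w - form (dmx w g z) u v).

(** Row j is nabla_u e_j, so that the Christoffel term of a constant field [v] is [v *m gam u z],
    linear in [v] by construction. *)
Definition gam : 'rV[R]_d -> 'rV[R]_d -> 'M[R]_d :=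
  locked_with derivative_key (fun u z =>
    (\matrix_(j, k) koszul z u (delta_mx 0 j) (delta_mx 0 k)) *m invmx (g z)).

Lemma gamE u : gam u = fun z =>
  (\matrix_(j, k) koszul z u (delta_mx 0 j) (delta_mx 0 k)) *m invmx (g z).
Proof. by rewrite /gam unlock. Qed.

Hypothesis mo : metric_on.

Let oW := mo_open mo.
Let sg := mo_smooth mo.

Lemma formDm (G H : 'M[R]_d) u v : form (G + H) u v = form G u v + form H u v.
Proof. by rewrite /Defs.form mulmxDr mulmxDl mxE. Qed.

Lemma formZm a (G : 'M[R]_d) u v : form (a *: G) u v = a * form G u v.
Proof. by rewrite /Defs.form -scalemxAr -scalemxAl mxE. Qed.

Lemma koszul_lin1 z : W z -> forall a u u' v w,
  koszul z (a *: u + u') v w = a * koszul z u v w + koszul z u' v w.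
Proof.
move=> Wz a u u' v w; rewrite /koszul (dmx_linear _ _ _ (smooth_diff Wz sg)).
by rewrite !(formDm, formZm, formDl, formZl, formDr, formZr); ring.
Qed.

Lemma koszul_sym z u v w : W z -> koszul z u v w = koszul z v u w.
Proof.
move=> Wz; rewrite /koszul.
have sd : (dmx w g z)^T = dmx w g z.
  rewrite -(dmx_tr w (smooth_diff Wz sg)).
  by apply: (dmx_open w oW Wz) => z' Wz'; exact: (mo_sym mo Wz').
by rewrite (formC u v sd); ring.
Qed.

Lemma koszul_lin2 z : W z -> forall a u v v' w,
  koszul z u (a *: v + v') w = a * koszul z u v w + koszul z u v' w.
Proof.
by move=> Wz a u v v' w; rewrite !(koszul_sym u _ _ Wz) koszul_lin1.
Qed.

Lemma koszul_lin3 z : W z -> forall a u v w w',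
  koszul z u v (a *: w + w') = a * koszul z u v w + koszul z u v w'.
Proof.
move=> Wz a u v w w'; rewrite /koszul (dmx_linear _ _ _ (smooth_diff Wz sg)).
by rewrite !(formDm, formZm, formDl, formZl, formDr, formZr); ring.
Qed.

Lemma lin_row_sum (f : 'rV[R]_d -> R) v :
  (forall a u w, f (a *: u + w) = a * f u + f w) ->
  f v = \sum_k v 0 k * f (delta_mx 0 k).
Proof.
move=> lin; have f0 : f 0 = 0.
  by have := lin 1 0 0; rewrite scale1r addr0 mul1r; lra.
have fD u w : f (u + w) = f u + f w by rewrite -{1}[u]scale1r lin mul1r.
rewrite {1}(row_sum_delta v) (big_morph f fD f0).
by apply: eq_bigr => k _; rewrite -[_ *: _]addr0 lin f0 addr0.
Qed.

Lemma gam_riesz z u v : W z -> v *m gam u z = riesz (g z) (koszul z u v).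
Proof.
move=> Wz; rewrite gamE mulmxA; congr (_ *m _); apply/rowP => k; rewrite !mxE.
rewrite (lin_row_sum (f := fun v => koszul z u v (delta_mx 0 k)) v); last first.
  by move=> a u' w; exact: koszul_lin2.
by apply: eq_bigr => j _; rewrite mxE.
Qed.

Lemma form_gam z u v w : W z -> form (g z) (v *m gam u z) w = koszul z u v w.
Proof.
move=> Wz; rewrite gam_riesz// riesz_form//; first exact: (mo_pos mo Wz).
by move=> a u' w'; exact: koszul_lin3.
Qed.

Lemma gam_sym z u v : W z -> v *m gam u z = u *m gam v z.
Proof.
move=> Wz; apply: (posdef_inj (mo_pos mo Wz)) => w.
by rewrite !form_gam// koszul_sym.
Qed.

Lemma gam_lin z : W z -> forall a u v, gam (a *: u + v) z = a *: gam u z + gam v z.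
Proof.
move=> Wz a u v; rewrite !gamE scalemxAl -mulmxDl; congr (_ *m _).
by apply/matrixP => i j; rewrite !mxE koszul_lin1.
Qed.

Lemma gam_coord z u : W z -> gam u z = \sum_i u 0 i *: gam (delta_mx 0 i) z.
Proof. by move=> Wz; apply: (mx_lin_coord (f := gam ^~ z)); exact: gam_lin. Qed.

Lemma gam_compat z u : W z -> dmx u g z = gam u z *m g z + g z *m (gam u z)^T.
Proof.
move=> Wz; apply/matrixP => i j.
have e (G : 'M[R]_d) : G i j = form G (delta_mx 0 i) (delta_mx 0 j).
  by rewrite /Defs.form -rowE !mxE (bigD1 j)//= big1 ?addr0 => [|k kj];
     rewrite !mxE ?eqxx ?mulr1// (negbTE kj) andbF mulr0.
have sG := mo_sym mo Wz.
have t (A : 'M[R]_d) v w : form (A *m g z) v w = form (g z) (v *m A) w.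
  by rewrite /Defs.form !mulmxA.
have t' (A : 'M[R]_d) v w : form (g z *m A^T) v w = form (g z) (w *m A) v.
  by rewrite (formC _ _ sG) /Defs.form trmx_mul !mulmxA.
rewrite !e formDm t t' !form_gam//.
set v := delta_mx 0 i; set w := delta_mx 0 j; rewrite /koszul.
have sd : (dmx u g z)^T = dmx u g z.
  rewrite -(dmx_tr u (smooth_diff Wz sg)).
  by apply: (dmx_open u oW Wz) => z' Wz'; exact: (mo_sym mo Wz').
by rewrite (formC w v sd); field.
Qed.

Lemma smooth_gam u : smooth_on W (gam u).
Proof.
rewrite gamE; apply: (smooth_mulmx oW); last first.
  by apply: (smooth_inv oW) sg => z Wz; exact/posdef_unit/(mo_pos mo).
apply: (smooth_mx oW) => j k; under eq_fun do rewrite mxE.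
have sd v w w' : smooth_on W (fun z => form (dmx v g z) w w' : R).
  by apply: (smooth_form oW (smooth_dmx v sg)); exact: smooth_cst.
rewrite /koszul; apply: (smoothM oW); first exact: smooth_cst.
apply: (@smoothD _ _ _ oW R); first exact: (@smoothD _ _ _ oW R).
have := smoothM oW (@smooth_cst _ _ _ oW R (-1)) (sd (delta_mx 0 k) u (delta_mx 0 j)).
by apply: (smooth_ext oW) => z _; rewrite mulN1r.
Qed.

Definition riem (a b z : 'rV[R]_d) : 'M[R]_d := dmx a (gam b) z - dmx b (gam a) z
  + gam b z *m gam a z - gam a z *m gam b z.

End ChartMetric.

(** * Pullback of a Levi-Civita connection along a smooth map *)

Section Pullback.
Variables (R : realType) (m d : nat) (V : set 'rV[R]_m) (W : set 'rV[R]_d).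
Variables (g : 'rV[R]_d -> 'M[R]_d) (F : 'rV[R]_m -> 'rV[R]_d).
Implicit Types (u v w y : 'rV[R]_m).
Hypotheses (mo : metric_on W g) (oV : open V) (sF : smooth_on V F).
Hypothesis FW : forall y, V y -> W (F y).

Let oW := mo_open mo.
Let sg := mo_smooth mo.

Lemma jacobianE y u : V y -> u *m jacobian F y = dmx u F y.
Proof. by move=> Vy; rewrite dmx_def deriveEjacobian//; exact: smooth_diff Vy sF. Qed.

Lemma smooth_jacobian : smooth_on V (jacobian F).
Proof.
apply: (smooth_mx oV) => i j.
apply: (smooth_ext oV) (smooth_coord oV 0 j (smooth_dmx (delta_mx 0 i) sF)) => y Vy.
by rewrite -jacobianE// -rowE mxE.
Qed.

Let sJac := smooth_jacobian.

Lemma jacobian_sym y u v : V y ->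
  v *m dmx u (jacobian F) y = u *m dmx v (jacobian F) y.
Proof.
move=> Vy; have dj := smooth_diff Vy sJac.
have e a b : b *m dmx a (jacobian F) y = dmx a (dmx b F) y.
  rewrite -(dmx_mull b a dj); apply: (dmx_open a oV Vy) => z Vz.
  exact: jacobianE.
by rewrite !e (dmx_schwarz u v oV Vy sF).
Qed.

Lemma dmx_comp k l (A : 'rV[R]_d -> 'M[R]_(k, l)) y u : V y -> smooth_on W A ->
  dmx u (fun z => A (F z)) y = dmx (u *m jacobian F y) A (F y).
Proof.
move=> Vy sA; rewrite jacobianE// !dmx_def.
exact: (derive_comp u (smooth_diff Vy sF) (smooth_diff (FW Vy) sA)).
Qed.

Definition pconn u y : 'M[R]_d := gam g (u *m jacobian F y) (F y).

Lemma pconn_coord u y : V y ->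
  pconn u y = \sum_i (u *m jacobian F y) 0 i *: gam g (delta_mx 0 i) (F y).
Proof. by move=> Vy; exact: (gam_coord mo _ (FW Vy)). Qed.

Let sujac u : smooth_on V (fun y => u *m jacobian F y).
Proof. exact: (smooth_mulmx oV (smooth_cst oV u) sJac). Qed.

Let sgF i : smooth_on V (fun y => gam g (delta_mx 0 i) (F y)).
Proof. exact: (smooth_comp oV oW FW sF (smooth_gam mo (delta_mx 0 i))). Qed.

Lemma smooth_pconn u : smooth_on V (pconn u).
Proof.
have s1 : smooth_on V (fun y => \sum_i (u *m jacobian F y) 0 i *: gam g (delta_mx 0 i) (F y)).
  by apply: (smooth_sum oV) => i; exact: (smooth_scale oV (smooth_coord oV _ _ (sujac u)) (sgF i)).
by apply: (smooth_ext oV) s1 => y Vy; rewrite pconn_coord.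
Qed.

(** Both the direction and the base point of [gam] depend on [y]. Linearity in the direction
    separates the two dependences after an expansion in the basis. *)
Lemma dmx_pconn u v y : V y ->
  dmx u (pconn v) y = gam g (v *m dmx u (jacobian F) y) (F y)
    + dmx (u *m jacobian F y) (gam g (v *m jacobian F y)) (F y).
Proof.
move=> Vy.
have sc i := smooth_coord oV 0 i (sujac v).
rewrite (dmx_open (G := fun y => \sum_i (v *m jacobian F y) 0 i *:
  gam g (delta_mx 0 i) (F y)) u oV Vy); last by move=> z Vz; rewrite pconn_coord.
rewrite dmx_sum; last first.
  by move=> i; exact: smooth_diff Vy (smooth_scale oV (sc i) (sgF i)).
rewrite (gam_coord mo _ (FW Vy)).
rewrite (dmx_open (F := gam g (v *m jacobian F y)) (G := fun z => \sum_i
  (v *m jacobian F y) 0 i *: gam g (delta_mx 0 i) z) (u *m jacobian F y) oW (FW Vy)); last first.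
  by move=> z Wz; exact: (gam_coord mo _ Wz).
have sgi i := smooth_gam mo (delta_mx 0 i).
rewrite dmx_sum; last first.
  move=> i; exact: smooth_diff (FW Vy) (smooth_scale oW (@smooth_cst _ _ _ oW R _) (sgi i)).
rewrite -big_split/=; apply: eq_bigr => i _.
rewrite (dmx_scale u (smooth_diff Vy (sc i)) (smooth_diff Vy (sgF i))).
rewrite (dmx_comp u Vy (sgi i)) -(dmxE u 0 i (smooth_diff Vy (sujac v))).
rewrite (dmx_mull v u (smooth_diff Vy sJac)).
rewrite (dmx_scale _ (differentiable_cst _ _) (smooth_diff (FW Vy) (sgi i))).
by rewrite dsc_cst scale0r add0r.
Qed.

(** The second derivatives of [F] enter symmetrically in [u] and [v] and cancel. *)
Lemma pconn_curv u v y : V y ->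
  dmx u (pconn v) y - dmx v (pconn u) y + pconn v y *m pconn u y - pconn u y *m pconn v y
  = riem g (u *m jacobian F y) (v *m jacobian F y) (F y).
Proof.
move=> Vy; rewrite !dmx_pconn// (jacobian_sym u v Vy) /riem /pconn.
by apply/matrixP => i j; rewrite 3!mxE [in RHS]mxE; congr (_ + _); rewrite !mxE; ring.
Qed.

Lemma pconn_tors u v y : V y ->
  v *m dmx u (jacobian F) y + v *m jacobian F y *m pconn u y
  = u *m dmx v (jacobian F) y + u *m jacobian F y *m pconn v y.
Proof.
by move=> Vy; rewrite (jacobian_sym u v Vy) /pconn (gam_sym mo _ _ (FW Vy)).
Qed.

Lemma pconn_compat u y : V y -> dmx u (fun z => g (F z)) y =
  pconn u y *m g (F y) + g (F y) *m (pconn u y)^T.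
Proof. by move=> Vy; rewrite (dmx_comp u Vy sg) (gam_compat mo _ (FW Vy)). Qed.

(* Koszul's formula for the metric induced by [F] *)
Lemma koszul_pullback (g' : 'rV[R]_m -> 'M[R]_m) u v w y : V y ->
  (forall z, V z -> g' z = jacobian F z *m g (F z) *m (jacobian F z)^T) ->
  koszul g' y u v w = form (g (F y))
    (v *m dmx u (jacobian F) y + v *m jacobian F y *m pconn u y) (w *m jacobian F y).
Proof.
move=> Vy g'E; have dj := smooth_diff Vy sJac.
have dgF := smooth_diff Vy (smooth_comp oV oW FW sF sg).
pose S (a b : 'rV[R]_m) := b *m dmx a (jacobian F) y + b *m jacobian F y *m pconn a y.
have SC a b : S a b = S b a by exact: pconn_tors.
have gC : forall a b, form (g (F y)) a b = form (g (F y)) b a.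
  by move=> a b; exact: formC (mo_sym mo (FW Vy)).
have key a b b' : form (dmx a g' y) b b' =
    form (g (F y)) (S a b) (b' *m jacobian F y) + form (g (F y)) (b *m jacobian F y) (S a b').
  rewrite (dmx_open a oV Vy g'E).
  rewrite (dmx_mulmx a (differentiable_mulmx dj dgF) (differentiable_tr dj)).
  rewrite (dmx_mulmx a dj dgF) (dmx_tr a dj) pconn_compat//.
  rewrite /S.
  move: (dmx a (jacobian F) y) (jacobian F y) (pconn a y) (g (F y)) => D T P G.
  rewrite /Defs.form -!mulmxA -!mulmxDr !trmx_mul.
  have -> : (D + T *m P)^T = D^T + P^T *m T^T by rewrite linearD/= trmx_mul.
  have addE (A B : 'M[R]_1) : (A + B) 0 0 = A 0 0 + B 0 0 by rewrite mxE.
  rewrite -addE; congr (fun_of_matrix _ 0 0).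
  rewrite !mulmxA -mulmxDl; congr (_ *m _).
  rewrite !(mulmxDr, mulmxDl) !mulmxA.
  by rewrite -!addrA; congr (_ + (_ + _)); rewrite addrC.
rewrite /koszul !key -/(S u v) (SC v u) (SC w u) (SC w v).
by rewrite (gC (u *m _)) (gC (v *m _) (S u w)); field.
Qed.

End Pullback.

(** * Change of chart for the connection, the curvature and J *)

Section ChartChange.
Variables (R : realType) (d : nat) (V W : set 'rV[R]_d).
Variables (g' g : 'rV[R]_d -> 'M[R]_d) (F : 'rV[R]_d -> 'rV[R]_d).
Implicit Types (u v w y a b : 'rV[R]_d).
Hypotheses (mo' : metric_on V g') (mo : metric_on W g) (sF : smooth_on V F).
Hypothesis FW : forall y, V y -> W (F y).
Hypothesis g'E : forall y, V y -> g' y = jacobian F y *m g (F y) *m (jacobian F y)^T.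
Hypothesis FU : forall y, V y -> jacobian F y \in unitmx.

Let oV := mo_open mo'.
Let sJac := smooth_jacobian oV sF.

(** The transformation law of Christoffel symbols, solved for the second derivatives of [F]. As the
    Jacobian is invertible, [koszul_pullback] determines all pairings. *)
Lemma chart_christoffel u y : V y ->
  dmx u (jacobian F) y = gam g' u y *m jacobian F y - jacobian F y *m pconn g F u y.
Proof.
move=> Vy; apply/eqP; rewrite eq_sym subr_eq eq_sym; apply/eqP.
apply/row_matrixP => i; rewrite !rowE; set v := delta_mx 0 i.
apply: (posdef_inj (mo_pos mo (FW Vy))) => w.
rewrite mulmxDr !mulmxA -[w](mulmxKV (FU Vy)) -(koszul_pullback mo oV sF FW u v _ Vy g'E).
by rewrite form_mul -(g'E Vy) (form_gam mo').
Qed.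

(** The integrability condition of [chart_christoffel]: its derivative, antisymmetrized by
    Schwarz. *)
Lemma chart_riem a b y : V y ->
  riem g' a b y *m jacobian F y =
  jacobian F y *m riem g (a *m jacobian F y) (b *m jacobian F y) (F y).
Proof.
move=> Vy; rewrite -(pconn_curv mo oV sF FW a b Vy) /riem.
have sG v := smooth_gam mo' v; have sP v := smooth_pconn mo oV sF FW v.
have dj := smooth_diff Vy sJac.
have e u v : dmx u (dmx v (jacobian F)) y =
    dmx u (gam g' v) y *m jacobian F y
    + gam g' v y *m (gam g' u y *m jacobian F y - jacobian F y *m pconn g F u y)
    - ((gam g' u y *m jacobian F y - jacobian F y *m pconn g F u y) *m pconn g F v y
    + jacobian F y *m dmx u (pconn g F v) y).
  rewrite (dmx_open (G := fun z => gam g' v z *m jacobian F z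
    - jacobian F z *m pconn g F v z) u oV Vy); last by move=> z Vz; exact: chart_christoffel.
  have dGj := smooth_diff Vy (smooth_mulmx oV (sG v) sJac).
  have djP := smooth_diff Vy (smooth_mulmx oV sJac (sP v)).
  have djP' := smooth_diff Vy (smoothN oV (smooth_mulmx oV sJac (sP v))).
  rewrite (dmx_add u dGj djP') (dmx_opp u djP).
  rewrite (dmx_mulmx u (smooth_diff Vy (sG v)) dj) (dmx_mulmx u dj (smooth_diff Vy (sP v))).
  by rewrite chart_christoffel.
have := dmx_schwarz a b oV Vy sJac; rewrite !e.
move: (dmx a (gam g' b) y) (dmx b (gam g' a) y) (gam g' a y) (gam g' b y)
  (dmx a (pconn g F b) y) (dmx b (pconn g F a) y) (pconn g F a y) (pconn g F b y)
  (jacobian F y) => A1 A2 Ga Gb P1 P2 Pa Pb T.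
rewrite !(mulmxDl, mulmxDr, mulmxBl, mulmxBr, mulNmx, mulmxN) !mulmxA.
move: (A1 *m T) (A2 *m T) (Gb *m Ga *m T) (Gb *m T *m Pa) (Ga *m T *m Pb)
  (T *m Pa *m Pb) (T *m P1) (Ga *m Gb *m T) (T *m Pb *m Pa) (T *m P2).
move=> x1 x2 x3 x4 x5 x6 x7 x8 x9 x10 /matrixP e'.
by apply/matrixP => i j; have := e' i j; rewrite !mxE; lra.
Qed.

Variables J' J : 'rV[R]_d -> 'M[R]_d.
Hypotheses (sJ' : smooth_on V J') (sJ : smooth_on W J).
Hypothesis J'E : forall y, V y -> J' y *m jacobian F y = jacobian F y *m J (F y).

Lemma chart_parallel y : V y ->
  (forall u, dmx u J' y + J' y *m gam g' u y = gam g' u y *m J' y) ->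
  forall u, dmx u J (F y) + J (F y) *m gam g u (F y) = gam g u (F y) *m J (F y).
Proof.
move=> Vy par w; have dj := smooth_diff Vy sJac.
pose u := w *m invmx (jacobian F y).
have uE : u *m jacobian F y = w by rewrite /u mulmxKV ?FU.
have dJF := smooth_diff Vy (smooth_comp oV (mo_open mo) FW sF sJ).
have dJ' := smooth_diff Vy sJ'.
have : dmx u (fun z => J' z *m jacobian F z) y = dmx u (fun z => jacobian F z *m J (F z)) y.
  exact: (dmx_open u oV Vy J'E).
rewrite (dmx_mulmx u dJ' dj) (dmx_mulmx u dj dJF) (dmx_comp sF FW u Vy sJ) uE.
rewrite chart_christoffel// /pconn uE.
have -> : dmx u J' y = gam g' u y *m J' y - J' y *m gam g' u y by rewrite -par addrK.
move=> e; apply: (can_inj (mulKmx (FU Vy))); move: e; have := J'E Vy.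
move: (gam g' u y) (J' y) (jacobian F y) (J (F y)) (gam g w (F y)) (dmx w J (F y)).
move=> G K T L P D KT; rewrite !(mulmxDl, mulmxDr, mulNmx, mulmxN) !mulmxA.
rewrite -(mulmxA G K) KT mulmxA.
move: (K *m G *m T) (G *m T *m L) (T *m L *m P) (T *m P *m L) (T *m D).
move=> x0 x1 x2 x3 x4 /matrixP e.
by apply/matrixP => i j; have := e i j; rewrite !mxE; lra.
Qed.

End ChartChange.

(** * Symmetries of the curvature of a Kaehler metric in a chart *)

Section KaehlerChart.
Variables (R : realType) (d : nat) (W : set 'rV[R]_d) (c : R).
Variables (g J : 'rV[R]_d -> 'M[R]_d).
Implicit Types (a b u v w z x : 'rV[R]_d).

Record kaehler_on : Prop := KaehlerOn {
  ko_metric : metric_on W g;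
  ko_sJ : smooth_on W J;
  ko_JJ : forall z, W z -> J z *m J z = - 1%:M;
  ko_Jiso : forall z, W z -> forall a b : 'rV[R]_d,
    form (g z) (a *m J z) (b *m J z) = form (g z) a b;
  ko_parJ : forall z, W z -> forall u : 'rV[R]_d,
    dmx u J z + J z *m gam g u z = gam g u z *m J z }.

Hypothesis ko : kaehler_on.

Let mo := ko_metric ko.
Let oW := mo_open mo.
Let sg := mo_smooth mo.
Let sG u : smooth_on W (gam g u) := smooth_gam mo u.

Lemma riem_lin1 z : W z -> forall (k : R) a a' b,
  riem g (k *: a + a') b z = k *: riem g a b z + riem g a' b z.
Proof.
move=> Wz k a a' b; rewrite /riem (dmx_linear _ _ _ (smooth_diff Wz (sG b))).
have -> : dmx b (gam g (k *: a + a')) z = k *: dmx b (gam g a) z + dmx b (gam g a') z.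
  rewrite (dmx_open (G := fun z => k *: gam g a z + gam g a' z) b oW Wz); last first.
    by move=> z' Wz'; exact: (gam_lin mo Wz').
  have s1 := smooth_scale oW (@smooth_cst _ _ _ oW R k) (sG a).
  rewrite (dmx_add b (smooth_diff Wz s1) (smooth_diff Wz (sG a'))).
  rewrite (dmx_scale b (differentiable_cst k z) (smooth_diff Wz (sG a))).
  by rewrite dsc_cst scale0r add0r.
rewrite (gam_lin mo Wz) !(mulmxDl, mulmxDr) -!scalemxAl -!scalemxAr.
move: (dmx a (gam g b) z) (dmx a' (gam g b) z) (dmx b (gam g a) z) (dmx b (gam g a') z)
 (gam g b z *m gam g a z) (gam g b z *m gam g a' z) (gam g a z *m gam g b z)
 (gam g a' z *m gam g b z) => x1 x2 x3 x4 x5 x6 x7 x8.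
by apply/matrixP => i j; rewrite !mxE; ring.
Qed.

Lemma riem_asym z a b : riem g a b z = - riem g b a z.
Proof.
rewrite /riem; move: (dmx a _ _) (dmx b _ _) (_ *m _) (_ *m _) => x1 x2 x3 x4.
by apply/matrixP => i j; rewrite !mxE; ring.
Qed.

(** Curvature annihilates parallel tensors: Schwarz for [g], with its derivatives rewritten by
    [gam_compat]. [riem_J] is the same argument for J. *)
Lemma riem_skew z a b : W z -> riem g a b z *m g z + g z *m (riem g a b z)^T = 0.
Proof.
move=> Wz.
have e u v : dmx u (dmx v g) z =
    dmx u (gam g v) z *m g z + gam g v z *m (gam g u z *m g z + g z *m (gam g u z)^T)
    + ((gam g u z *m g z + g z *m (gam g u z)^T) *m (gam g v z)^T
    + g z *m (dmx u (gam g v) z)^T).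
  rewrite (dmx_open (G := fun z => gam g v z *m g z + g z *m (gam g v z)^T) u oW Wz); last first.
    by move=> z' Wz'; exact: (gam_compat mo).
  have dG := smooth_diff Wz (sG v); have dg := smooth_diff Wz sg.
  have dt := differentiable_tr dG.
  rewrite (dmx_add u (differentiable_mulmx dG dg) (differentiable_mulmx dg dt)).
  rewrite (dmx_mulmx u dG dg) (dmx_mulmx u dg dt) (dmx_tr u dG).
  by rewrite (gam_compat mo).
have := dmx_schwarz a b oW Wz sg; rewrite !e /riem.
move: (dmx a (gam g b) z) (dmx b (gam g a) z) (gam g a z) (gam g b z) (g z).
move=> A1 A2 Ga Gb G.
have -> : (A1 - A2 + Gb *m Ga - Ga *m Gb)^T
    = A1^T - A2^T + Ga^T *m Gb^T - Gb^T *m Ga^T.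
  by rewrite !linearB/= linearD/= linearB/= !trmx_mul.
rewrite !(mulmxDl, mulmxDr, mulmxBl, mulmxBr, mulNmx, mulmxN) !mulmxA.
move: (A1 *m G) (A2 *m G) (Gb *m Ga *m G) (Ga *m Gb *m G) (Ga *m G *m Gb^T)
  (Gb *m G *m Ga^T) (G *m A1^T) (G *m A2^T) (G *m Ga^T *m Gb^T) (G *m Gb^T *m Ga^T).
move=> x1 x2 x3 x4 x5 x6 x7 x8 x9 x10 /matrixP e'.
by apply/matrixP => i j; have := e' i j; rewrite !mxE; lra.
Qed.

Lemma riem_J z a b : W z -> riem g a b z *m J z = J z *m riem g a b z.
Proof.
move=> Wz.
have par z' u : W z' -> dmx u J z' = gam g u z' *m J z' - J z' *m gam g u z'.
  by move=> Wz'; rewrite -(ko_parJ ko Wz') addrK.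
have e u v : dmx u (dmx v J) z =
    dmx u (gam g v) z *m J z + gam g v z *m (gam g u z *m J z - J z *m gam g u z)
    - ((gam g u z *m J z - J z *m gam g u z) *m gam g v z + J z *m dmx u (gam g v) z).
  rewrite (dmx_open (G := fun z => gam g v z *m J z - J z *m gam g v z) u oW Wz); last first.
    by move=> z' Wz'; exact: par.
  have dG := smooth_diff Wz (sG v); have dJ := smooth_diff Wz (ko_sJ ko).
  have d2 := differentiable_mulmx dJ dG.
  have d2' := smooth_diff Wz (smoothN oW (smooth_mulmx oW (ko_sJ ko) (sG v))).
  rewrite (dmx_add u (differentiable_mulmx dG dJ) d2') (dmx_opp u d2).
  by rewrite (dmx_mulmx u dG dJ) (dmx_mulmx u dJ dG) par.
have := dmx_schwarz a b oW Wz (ko_sJ ko); rewrite !e /riem.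
move: (dmx a (gam g b) z) (dmx b (gam g a) z) (gam g a z) (gam g b z) (J z).
move=> A1 A2 Ga Gb G.
rewrite !(mulmxDl, mulmxDr, mulmxBl, mulmxBr, mulNmx, mulmxN) !mulmxA.
move: (A1 *m G) (A2 *m G) (Gb *m Ga *m G) (Ga *m Gb *m G) (Ga *m G *m Gb)
  (Gb *m G *m Ga) (G *m A1) (G *m A2) (G *m Ga *m Gb) (G *m Gb *m Ga).
move=> x1 x2 x3 x4 x5 x6 x7 x8 x9 x10 /matrixP e'.
by apply/matrixP => i j; have := e' i j; rewrite !mxE; lra.
Qed.

Lemma riem_bianchi z x y w : W z ->
  w *m riem g x y z + x *m riem g y w z + y *m riem g w x z = 0.
Proof.
move=> Wz.
have dsym u a b : a *m dmx u (gam g b) z = b *m dmx u (gam g a) z.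
  rewrite -(dmx_mull a u (smooth_diff Wz (sG b))) -(dmx_mull b u (smooth_diff Wz (sG a))).
  by apply: (dmx_open u oW Wz) => z' Wz'; exact: (gam_sym mo).
rewrite /riem !(mulmxDr, mulmxBr, mulmxN) !mulmxA.
rewrite (dsym x w y) (dsym y w x) (dsym w x y) (gam_sym mo y w Wz) (gam_sym mo x w Wz).
rewrite (gam_sym mo x y Wz).
move: (y *m dmx x (gam g w) z) (x *m dmx y (gam g w) z) (y *m dmx w (gam g x) z).
move: (y *m gam g w z *m gam g x z) (x *m gam g w z *m gam g y z)
  (x *m gam g y z *m gam g w z) => x1 x2 x3 x4 x5 x6.
by apply/rowP => i; rewrite !mxE; ring.
Qed.

Lemma riem_hol z : W z ->
  (forall x, form (g z) (x *m J z *m riem g x (x *m J z) z) x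
    = 4 * c * form (g z) x x ^+ 2) ->
  forall a b w, w *m riem g a b z = c *: cplx_space_curv (g z) (J z) a b w.
Proof.
move=> Wz hol a b w.
apply: (hol_curvature (Rm := fun x y w => w *m riem g x y z)) => //.
- exact: (mo_sym mo).
- exact: (mo_pos mo).
- exact: (ko_JJ ko).
- exact: (ko_Jiso ko Wz).
- move=> x x' y v; rewrite -{1}[x]scale1r (riem_lin1 Wz) scale1r.
  by rewrite mulmxDr.
- by move=> x y v v'; rewrite mulmxDl.
- by move=> x y v; rewrite riem_asym mulmxN.
- move=> x y v v'; apply/eqP; rewrite -addr_eq0; apply/eqP.
  rewrite (formC _ _ (mo_sym mo Wz)) (formC (v' *m _) _ (mo_sym mo Wz)).
  rewrite (formC v' _ (mo_sym mo Wz)).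
  have -> : form (g z) v (v' *m riem g x y z) = form (g z *m (riem g x y z)^T) v v'.
    by rewrite /Defs.form trmx_mul !mulmxA.
  have -> : form (g z) (v *m riem g x y z) v' = form (riem g x y z *m g z) v v'.
    by rewrite /Defs.form !mulmxA.
  by rewrite -formDm riem_skew// /Defs.form mulmx0 mul0mx mxE.
- by move=> x y v; have := riem_bianchi x y v Wz.
- by move=> x y v; rewrite -mulmxA -riem_J// mulmxA.
Qed.

End KaehlerChart.

Section PullbackKaehler.
Variables (R : realType) (m d : nat) (V : set 'rV[R]_m) (W : set 'rV[R]_d) (c : R).
Variables (g J : 'rV[R]_d -> 'M[R]_d) (F : 'rV[R]_m -> 'rV[R]_d).

Lemma pullback_kaehler : kaehler_on W g J ->
  (forall z, W z -> forall a b w : 'rV[R]_d,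
    w *m riem g a b z = c *: cplx_space_curv (g z) (J z) a b w) ->
  open V -> smooth_on V F -> (forall y, V y -> W (F y)) ->
  kaehler_pullback V c (fun y => g (F y)) (fun y => J (F y)) (pconn g F) (jacobian F).
Proof.
move=> ko curv oV sF FW; have mo := ko_metric ko; have oW := mo_open mo.
split=> //.
- exact: (smooth_comp oV oW FW sF (mo_smooth mo)).
- exact: (smooth_comp oV oW FW sF (ko_sJ ko)).
- exact: smooth_jacobian.
- by move=> u; exact: (smooth_pconn mo oV sF FW u).
- move=> y Vy a u v; rewrite /pconn mulmxDl -scalemxAl; exact: (gam_lin mo (FW y Vy)).
- by move=> y Vy; exact: (mo_sym mo (FW y Vy)).
- by move=> y Vy; exact: (mo_pos mo (FW y Vy)).
- by move=> y Vy; exact: (ko_JJ ko (FW y Vy)).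
- by move=> y Vy; exact: (ko_Jiso ko (FW y Vy)).
- by move=> y Vy u; exact: (pconn_compat mo sF FW).
- move=> y Vy u; rewrite (dmx_comp sF FW u Vy (ko_sJ ko)).
  exact: (ko_parJ ko (FW y Vy)).
- by move=> y Vy u v; exact: (pconn_tors mo oV sF FW).
- by move=> y Vy u v w; rewrite (pconn_curv mo oV sF FW u v Vy); exact: curv (FW y Vy) _ _ _.
Qed.

End PullbackKaehler.

(** * Manifolds and their charts *)

Section Jacobian.
Variable R : realType.

Lemma eq_mulrow m n (A B : 'M[R]_(m, n)) : (forall u : 'rV_m, u *m A = u *m B) -> A = B.
Proof. by move=> AB; apply/row_matrixP => i; rewrite !rowE. Qed.

Lemma jacobian_dmx m n (F : 'rV[R]_m -> 'rV[R]_n) y (u : 'rV[R]_m) : differentiable F y ->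
  u *m jacobian F y = dmx u F y.
Proof. by move=> dF; rewrite dmx_def deriveEjacobian. Qed.

Lemma jacobian_comp k m n (F : 'rV[R]_k -> 'rV[R]_m) (G : 'rV[R]_m -> 'rV[R]_n) y :
  differentiable F y -> differentiable G (F y) ->
  jacobian (G \o F) y = jacobian F y *m jacobian G (F y).
Proof.
move=> dF dG; have dGF : differentiable (G \o F) y by exact: differentiable_comp.
apply: eq_mulrow => u; rewrite mulmxA (jacobian_dmx u dF) (jacobian_dmx _ dG).
by rewrite (jacobian_dmx u dGF) !dmx_def; exact: (derive_comp u dF dG).
Qed.

Lemma jacobian_open m n (U : set 'rV[R]_m) (F G : 'rV[R]_m -> 'rV[R]_n) y :
  open U -> U y -> (forall z, U z -> F z = G z) -> differentiable F y ->
  jacobian F y = jacobian G y.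
Proof.
move=> oU Uy FG dF; have dG : differentiable G y.
  by apply: near_differentiable dF; exact: near_open FG.
apply: eq_mulrow => u.
apply: etrans (jacobian_dmx u dF) _.
apply: etrans (esym (jacobian_dmx u dG)).
exact: (dmx_open u oU Uy FG).
Qed.

Lemma jacobian_id m (y : 'rV[R]_m) : jacobian id y = 1%:M.
Proof.
have [did _] := @is_diff_id R 'rV[R]_m y.
by apply: eq_mulrow => u; rewrite (jacobian_dmx u did) mulmx1 dmx_def derive_id.
Qed.

End Jacobian.

Section Charts.
Variables (R : realType) (m : nat) (M : manifold R m).
Implicit Types (p q r x : M) (y z : 'rV[R]_m).

Lemma cdom_open p : open (cdom p). Proof. by case: M p. Qed.

Lemma cdom_self p : cdom p p. Proof. by case: M p. Qed.

Lemma chartK p x : cdom p x -> cinv p (chart p x) = x.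
Proof. by case: M p x => ? ? ? ? ? ? ? ? h ? ? ? ? a b; exact (h a b). Qed.

Definition cimg p : set 'rV[R]_m := chart p @` cdom p.

Lemma cimg_open p : open (cimg p).
Proof. by rewrite /cimg; case: M p => ? ? ? ? ? ? ? ? ? h ? ? ? a; exact (h a). Qed.

Lemma chart_continuous p : {within cdom p, continuous (chart p)}.
Proof. by case: M p => ? ? ? ? ? ? ? ? ? ? h ? ? a; exact (h a). Qed.

Lemma cinv_continuous p : {within cimg p, continuous (cinv p)}.
Proof. by rewrite /cimg; case: M p => ? ? ? ? ? ? ? ? ? ? ? h ? a; exact (h a). Qed.

Lemma transition_smooth p q :
  smooth_on (chart p @` (cdom p `&` cdom q)) (chart q \o cinv p).
Proof. by case: M p q => ? ? ? ? ? ? ? ? ? ? ? ? h a b; exact (h a b). Qed.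

Lemma cinv_cimg p y : cimg p y -> cdom p (cinv p y).
Proof. by move=> [x px <-]; rewrite chartK. Qed.

Lemma cinvK p y : cimg p y -> chart p (cinv p y) = y.
Proof. by move=> [x px <-]; rewrite chartK. Qed.

Lemma chart_cimg p x : cdom p x -> cimg p (chart p x).
Proof. by exists x. Qed.

Lemma imageE p (A : set M) y : (chart p @` (cdom p `&` A)) y <->
  cimg p y /\ A (cinv p y).
Proof.
split=> [[x [px Ax] <-]|[py Ay]].
  by rewrite chartK//; split=> //; exists x.
by exists (cinv p y); [split=> //; exact: cinv_cimg|exact: cinvK].
Qed.

Lemma image_open p (A : set M) : open A -> open (chart p @` (cdom p `&` A)).
Proof.
move=> oA; rewrite openE => y /imageE[py Ay].
have cp : {for y, continuous (cinv p)}.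
  have := @cinv_continuous p; rewrite continuous_open_subspace; last exact: cimg_open.
  by apply; rewrite inE.
have nA : nbhs (cinv p y) A by apply: open_nbhs_nbhs.
have /= := cp _ nA; apply: filterS2 (open_nbhs_nbhs (conj (@cimg_open p) py)) => z pz Az.
by apply/imageE.
Qed.

Definition overlap p q : set 'rV[R]_m := chart p @` (cdom p `&` cdom q).

Lemma overlap_open p q : open (overlap p q).
Proof. exact/image_open/cdom_open. Qed.

Lemma overlapS p q : overlap p q `<=` cimg p.
Proof. by move=> y /imageE[]. Qed.

Lemma chart_overlap p q x : cdom p x -> cdom q x -> overlap p q (chart p x).
Proof. by move=> px qx; exists x. Qed.

Definition transition p q : 'rV[R]_m -> 'rV[R]_m := chart q \o cinv p.

Lemma transition_chart p q x : cdom p x -> transition p q (chart p x) = chart q x.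
Proof. by move=> px; rewrite /transition/= chartK. Qed.

Lemma transition_overlap p q y : overlap p q y -> cimg q (transition p q y).
Proof. by move=> /imageE[py qy]; exact: chart_cimg. Qed.

Lemma transition_diff p q x : cdom p x -> cdom q x ->
  differentiable (transition p q) (chart p x).
Proof.
by move=> px qx; exact: (smooth_diff (chart_overlap px qx) (@transition_smooth p q)).
Qed.

(** A common form of [to_chart] and [from_chart], for which the chain rule is the cocycle identity
    [tr_comp]. *)
Definition tr : M -> M -> M -> 'M[R]_m :=
  locked_with derivative_key (fun p q x => jacobian (transition p q) (chart p x)).

Lemma trE p q x : tr p q x = jacobian (transition p q) (chart p x).
Proof. by rewrite /tr unlock. Qed.

Lemma tr_comp p q r x : cdom p x -> cdom q x -> cdom r x ->
  tr p q x *m tr q r x = tr p r x.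
Proof.
move=> px qx rx; have d1 := transition_diff px qx.
have d2 := transition_diff qx rx; rewrite -(transition_chart q px) in d2.
rewrite !trE -(transition_chart q px) -(jacobian_comp d1 d2).
have d12 : differentiable (transition q r \o transition p q) (chart p x).
  exact: differentiable_comp.
have e z : overlap p q z -> (transition q r \o transition p q) z = transition p r z.
  by move=> /imageE[pz qz]; rewrite /transition/= chartK.
exact: (jacobian_open (@overlap_open p q) (chart_overlap px qx) e d12).
Qed.

Lemma trI p x : cdom p x -> tr p p x = 1%:M.
Proof.
move=> px; rewrite trE -(jacobian_id (chart p x)).
have e z : cimg p z -> transition p p z = id z.
  by move=> pz; rewrite /transition/= cinvK.
exact: (jacobian_open (@cimg_open p) (chart_cimg px) e (transition_diff px px)).
Qed.

Lemma tr_inv p q x : cdom p x -> cdom q x -> tr p q x *m tr q p x = 1%:M.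
Proof. by move=> px qx; rewrite tr_comp// trI. Qed.

Lemma tr_unit p q x : cdom p x -> cdom q x -> tr p q x \in unitmx.
Proof. by move=> px qx; exact: (proj1 (mulmx1_unit (tr_inv px qx))). Qed.

Lemma to_chartE p x : to_chart p x = tr x p x.
Proof. by rewrite trE. Qed.

Lemma from_chartE p x : from_chart p x = tr p x x.
Proof. by rewrite trE. Qed.

End Charts.

(** * Kaehler manifolds in charts *)

Lemma metric_onS (R : realType) d (W W' : set 'rV[R]_d) g : open W' -> W' `<=` W ->
  metric_on W g -> metric_on W' g.
Proof.
move=> oW' sW [_ sg sym pos]; split=> //; first exact: (smoothS sW).
- by move=> z /sW; exact: sym.
- by move=> z /sW; exact: pos.
Qed.

Lemma dsc_form (R : realType) (V : normedModType R) d (g : V -> 'M[R]_d) u y (v w : 'rV[R]_d) :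
  differentiable g y -> dsc u (fun z => form (g z) v w) y = form (dmx u g y) v w.
Proof.
move=> dg; have dvg := differentiable_mulmx (differentiable_cst v y) dg.
have dw := differentiable_cst (w^T) y.
rewrite /Defs.form -(dmxE u 0 0 (differentiable_mulmx dvg dw)) (dmx_mulmx u dvg dw).
by rewrite (dmx_mull v u dg) dmx_cst mulmx0 addr0.
Qed.

Section KaehlerManifold.
Variables (R : realType) (n : nat) (M : manifold R n.*2) (K : kaehler M) (c : R).
Implicit Types (p q r x : M) (y z : 'rV[R]_(n.*2)) (u v w a b : 'rV[R]_(n.*2)).

Lemma kmetric_sym x : (K x)^T = K x.
Proof. by case: (kmetric K) x => h1 h2 h3 h4 x; exact: h2. Qed.

Lemma kmetric_pos x : posdef (K x).
Proof. by case: (kmetric K) x => h1 h2 h3 h4 x u; exact: h3. Qed.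

Lemma kmetric_smooth p : smooth_on (cimg p) (form_in_chart K p).
Proof. by rewrite /cimg; case: (kmetric K) => h1 h2 h3 h4; exact (h4 p). Qed.

Lemma cplx_smooth p : smooth_on (cimg p) (endo_in_chart (cplx K) p).
Proof. by rewrite /cimg; case: K => h1 h2 h3 h4 h5 h6; exact (h3 p). Qed.

Lemma cplx2 x : cplx K x *m cplx K x = - 1%:M.
Proof. by case: K => h1 h2 h3 h4 h5 h6; exact (h4 x). Qed.

Lemma cplx_iso x u v : form (K x) (u *m cplx K x) (v *m cplx K x) = form (K x) u v.
Proof. by case: K => h1 h2 h3 h4 h5 h6; exact (h5 x u v). Qed.

Lemma cplx_parallel p u v : 'D_u (fun z => v *m endo_in_chart (cplx K) p z) (chart p p)
  + christoffel K p (chart p p) u (v *m cplx K p)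
  = christoffel K p (chart p p) u v *m cplx K p.
Proof. by case: K => h1 h2 h3 h4 h5 h6; exact (h6 p u v). Qed.

Local Notation gc p := (form_in_chart K p).
Local Notation Jc p := (endo_in_chart (cplx K) p).

Lemma gcE p y : gc p y = tr p (cinv p y) (cinv p y) *m K (cinv p y) *m (tr p (cinv p y) (cinv p y))^T.
Proof. by rewrite /form_in_chart from_chartE. Qed.

Lemma JcE p y : Jc p y = tr p (cinv p y) (cinv p y) *m cplx K (cinv p y) *m tr (cinv p y) p (cinv p y).
Proof. by rewrite /endo_in_chart from_chartE to_chartE. Qed.

Lemma chart_metric p : metric_on (cimg p) (gc p).
Proof.
split; [exact: cimg_open|exact: kmetric_smooth| |].
- by move=> y py; rewrite gcE !trmx_mul trmxK kmetric_sym mulmxA.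
- move=> y py u u0; rewrite gcE -form_mul; apply: kmetric_pos.
  have px := cinv_cimg py; have uT := tr_unit px (cdom_self (cinv p y)).
  by apply: contra u0 => /eqP e; rewrite -(mulmxK uT u) e mul0mx.
Qed.

Lemma gc_transition p q x : cdom p x -> cdom q x ->
  gc p (chart p x) = tr p q x *m gc q (chart q x) *m (tr p q x)^T.
Proof.
move=> px qx; rewrite !gcE !chartK//.
by rewrite -(tr_comp px qx (cdom_self x)) trmx_mul !mulmxA.
Qed.

Lemma Jc_transition p q x : cdom p x -> cdom q x ->
  Jc p (chart p x) *m tr p q x = tr p q x *m Jc q (chart q x).
Proof.
move=> px qx; have xx := cdom_self x; rewrite !JcE !chartK// -!mulmxA (tr_comp xx px qx).
by rewrite !mulmxA (tr_comp px qx xx).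
Qed.

Lemma gc_center p : gc p (chart p p) = K p.
Proof.
have pp := cdom_self p.
by rewrite gcE !chartK// trI// trmx1 mul1mx mulmx1.
Qed.

Lemma Jc_center p : Jc p (chart p p) = cplx K p.
Proof.
have pp := cdom_self p.
by rewrite JcE !chartK// trI// mul1mx mulmx1.
Qed.

Lemma christoffelE p y u v : cimg p y -> christoffel K p y u v = v *m gam (gc p) u y.
Proof.
move=> py; have mo := chart_metric p; rewrite (gam_riesz mo)//.
rewrite /christoffel; congr (riesz _ _); apply/funext => w.
have dg := smooth_diff py (mo_smooth mo).
by rewrite /koszul -!(dsc_form _ _ _ dg) !dsc_def.
Qed.

Lemma JJc p y : cimg p y -> Jc p y *m Jc p y = - 1%:M.
Proof.
move=> py; have px := cinv_cimg py; have xx := cdom_self (cinv p y); rewrite JcE.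
move: (tr_inv xx px) (tr_inv px xx) (cplx2 (cinv p y)).
move: (tr p _ _) (tr _ p _) (cplx K _) => T T' I TT' T'T II.
rewrite !mulmxA -(mulmxA _ T') TT' mulmx1 -(mulmxA T) II.
by rewrite mulmxN mulmx1 mulNmx T'T.
Qed.

Lemma Jc_iso p y : cimg p y -> forall a b,
  form (gc p y) (a *m Jc p y) (b *m Jc p y) = form (gc p y) a b.
Proof.
move=> py a b; have px := cinv_cimg py; have xx := cdom_self (cinv p y).
rewrite JcE gcE -!form_mul; move: (tr_inv xx px) (cplx_iso (cinv p y)).
move: (tr p _ _) (tr _ p _) (cplx K _) (K _) => T T' I G TT' iso.
by rewrite !mulmxA -!(mulmxA _ T' T) TT' !mulmx1 iso.
Qed.

Lemma parallel_center p u :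
  dmx u (Jc p) (chart p p) + Jc p (chart p p) *m gam (gc p) u (chart p p)
  = gam (gc p) u (chart p p) *m Jc p (chart p p).
Proof.
have py := chart_cimg (cdom_self p); have dJ := smooth_diff py (cplx_smooth p).
apply: eq_mulrow => v; have := cplx_parallel p u v.
rewrite !christoffelE// Jc_center -dmx_def (dmx_mull v u dJ).
by rewrite mulmxDr !mulmxA.
Qed.

Section Transport.
Variables (q r : M).
Hypothesis qr : cdom q r.

Let V := overlap r q.
Let oV : open V := @overlap_open _ _ M r q.
Let mo' : metric_on V (gc r) := metric_onS oV (@overlapS _ _ M r q) (chart_metric r).
Let mo := chart_metric q.
Let sF : smooth_on V (transition r q) := @transition_smooth _ _ M r q.
Let FW : forall y, V y -> cimg q (transition r q y) := @transition_overlap _ _ M r q.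

Let VE y : V y -> exists x, [/\ cdom r x, cdom q x & y = chart r x].
Proof. by move=> [x [rx qx] <-]; exists x. Qed.

Let g'E y : V y -> gc r y = jacobian (transition r q) y *m gc q (transition r q y)
  *m (jacobian (transition r q) y)^T.
Proof.
move=> /VE[x [rx qx ->]]; rewrite (transition_chart q rx) -(trE r q x).
exact: (gc_transition rx qx).
Qed.

Let J'E y : V y -> Jc r y *m jacobian (transition r q) y =
  jacobian (transition r q) y *m Jc q (transition r q y).
Proof.
move=> /VE[x [rx qx ->]]; rewrite (transition_chart q rx) -(trE r q x).
exact: (Jc_transition rx qx).
Qed.

Let FU y : V y -> jacobian (transition r q) y \in unitmx.
Proof. move=> /VE[x [rx qx ->]]; rewrite -(trE r q x); exact: tr_unit. Qed.

Let Vr : V (chart r r) := chart_overlap (cdom_self r) qr.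

Let Fr : transition r q (chart r r) = chart q r := transition_chart q (cdom_self r).

(** The Kaehler axiom holds at [r] in the chart centred at [r]; the transition to the chart [q]
    carries it over. Since each point of a chart is the centre of its own, this covers all of
    [cimg q]. *)
Lemma parallel_transport u :
  dmx u (Jc q) (chart q r) + Jc q (chart q r) *m gam (gc q) u (chart q r)
  = gam (gc q) u (chart q r) *m Jc q (chart q r).
Proof.
rewrite -Fr; apply: (chart_parallel mo' mo sF FW g'E FU _ (cplx_smooth q) J'E Vr).
  exact: smoothS (@overlapS _ _ M r q) (cplx_smooth r).
exact: parallel_center.
Qed.

Lemma curvature_transport :
  (forall a b w, w *m riem (gc r) a b (chart r r) =
    c *: cplx_space_curv (gc r (chart r r)) (Jc r (chart r r)) a b w) ->
  forall a b w, w *m riem (gc q) a b (chart q r) =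
    c *: cplx_space_curv (gc q (chart q r)) (Jc q (chart q r)) a b w.
Proof.
move=> curv a b w; have := FU Vr; have := g'E Vr; have := J'E Vr.
have /(_ _ _ _ Vr) rt := chart_riem mo' mo sF FW g'E FU.
move: rt; rewrite Fr.
move: (jacobian _ _) (gc q _) (Jc q _) (gc r _) (Jc r _) curv => T G I G' I' curv rt I'E GE TU.
have [a' aE] : exists a', a = a' *m T by exists (a *m invmx T); rewrite mulmxKV.
have [b' bE] : exists b', b = b' *m T by exists (b *m invmx T); rewrite mulmxKV.
have [w' wE] : exists w', w = w' *m T by exists (w *m invmx T); rewrite mulmxKV.
have := rt a' b'; rewrite -aE -bE => rt'.
rewrite {1}wE -mulmxA -rt' mulmxA curv -scalemxAl; congr (_ *: _).
have fE (x x' : 'rV[R]_(n.*2)) : form G (x *m T) (x' *m T) = form G' x x' by rewrite form_mul GE.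
have IE (x : 'rV[R]_(n.*2)) : x *m T *m I = x *m I' *m T by rewrite -!mulmxA I'E.
rewrite /cplx_space_curv aE bE wE !IE !fE.
by rewrite !(mulmxDl, mulmxBl, mulNmx) -!scalemxAl.
Qed.

End Transport.

Lemma kaehler_chart q : kaehler_on (cimg q) (gc q) (Jc q).
Proof.
split; [exact: chart_metric|exact: cplx_smooth|exact: JJc|exact: Jc_iso|].
by move=> z [r qr <-] u; exact: parallel_transport.
Qed.

Lemma curvatureE p u v w : curvature K p u v w = w *m riem (gc p) u v (chart p p).
Proof.
have py := chart_cimg (cdom_self p); have mo := chart_metric p.
have oW := mo_open mo.
have dG a := smooth_diff py (smooth_gam mo a).
rewrite /curvature !christoffelE// /riem !(mulmxDr, mulmxN, mulmxBr) !mulmxA.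
do 2 congr (_ + _).
congr (_ + _).
  rewrite -(dmx_mull w u (dG v)) dmx_def.
  by apply: (derive_open u oW py) => z Wz; exact: christoffelE.
congr (- _); rewrite -(dmx_mull w v (dG u)) dmx_def.
by apply: (derive_open v oW py) => z Wz; exact: christoffelE.
Qed.

Lemma space_form_curv : complex_space_form K c -> forall q z, cimg q z ->
  forall a b w, w *m riem (gc q) a b z = c *: cplx_space_curv (gc q z) (Jc q z) a b w.
Proof.
move=> [_ _ hol] q z [r qr <-]; apply: curvature_transport => //.
have py := chart_cimg (cdom_self r).
apply: (riem_hol (kaehler_chart r) py) => u; rewrite gc_center Jc_center.
have [->|u0] := eqVneq u 0; first by rewrite !form0r; ring.
have up := @kmetric_pos r u u0.
have := hol r u u0; rewrite /sectional_curvature curvatureE.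
(* u and J u are orthogonal and of equal length, so the denominator of the sectional curvature is
   |u|^4. *)
have -> : form (K r) u (u *m cplx K r) = 0.
  have := cplx_iso r u (u *m cplx K r).
  by rewrite -mulmxA cplx2 mulmxN mulmx1 formNr (formC _ _ (kmetric_sym r)); lra.
rewrite cplx_iso => <-; field; exact: lt0r_neq0.
Qed.

End KaehlerManifold.

(** * Linear algebra of CR-submanifolds *)

Section CRLinearAlgebra.
Variables (R : realType) (m d p : nat) (G I : 'M[R]_d) (T : 'M[R]_(m, d)) (N : 'rV[R]_d).
Hypotheses (sG : G^T = G) (pG : posdef G) (II : I *m I = - 1%:M).
Hypothesis iI : forall a b : 'rV[R]_d, form G (a *m I) (b *m I) = form G a b.
Hypothesis freeT : row_free T.

Lemma orthP k (A : 'M[R]_(k, d)) (w : 'rV[R]_d) :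
  reflect (forall u : 'rV[R]_k, form G w (u *m A) = 0) (w <= orth G A)%MS.
Proof.
apply: (iffP sub_kermxP) => [w0 u|w0].
  by rewrite /Defs.form trmx_mul mulmxA -(mulmxA w) w0 mul0mx mxE.
apply/rowP => j; have := w0 (delta_mx 0 j).
rewrite /Defs.form trmx_mul mulmxA -(mulmxA w) trmx_delta -colE mxE => ->.
by rewrite mxE.
Qed.

Let D := (T :&: T *m I)%MS.
Let P := (T :&: orth G D)%MS.
Hypotheses (rD : \rank D = p.*2) (rP : \rank P = 1%N) (mp : m = p.*2.+1).
Hypotheses (NP : (N <= P *m I)%MS) (NN : form G N N = 1).

Lemma xi_sub : (- (N *m I) <= P)%MS.
Proof.
have /submxP[a ->] := NP.
by rewrite mulmxA -!(mulmxA _ I) II mulmxN mulmx1 opprK submxMl.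
Qed.

Lemma xi_tangent : exists u : 'rV[R]_m, u *m T = - (N *m I).
Proof.
have /submxP[u uE] : (- (N *m I) <= T)%MS by apply: submx_trans xi_sub (capmxSl _ _).
by exists u.
Qed.

Lemma holo_J w : (w <= D)%MS -> exists u : 'rV[R]_m, u *m T = w *m I.
Proof.
move=> wD; have /submxP[u ->] : (w <= T *m I)%MS by apply: submx_trans wD (capmxSr _ _).
by exists (- u); rewrite mulmxA -mulmxA II mulmxN mulmx1 mulNmx.
Qed.

(** D and P meet in 0 and their ranks add up to m, so T = D + P; the line P is spanned by the unit
    vector xi, and orthogonality to xi removes the part in P. *)
Lemma holo_sub v : form G (v *m T) (- (N *m I)) = 0 -> (v *m T <= D)%MS.
Proof.
move=> v0; set xi := - (N *m I) in v0 *.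
have xxi : form G xi xi = 1 by rewrite /xi formNl formNr opprK iI.
have DP0 : (D :&: P)%MS = 0.
  apply/eqP/rowV0P => w; rewrite sub_capmx => /andP[/submxP[a wE] wP].
  have /orthP wD : (w <= orth G D)%MS by apply: submx_trans wP (capmxSr _ _).
  by apply: (posdef_eq0 pG); rewrite {2}wE.
have DPT : (D + P <= T)%MS by rewrite addsmx_sub !capmxSl.
have rDP : \rank (D + P)%MS = \rank T.
  have := mxrank_sum_cap D P; rewrite DP0 mxrank0 addn0 rD rP addn1 => ->.
  by move: freeT; rewrite /row_free => /eqP ->.
have TDP : (T <= D + P)%MS by rewrite -(mxrank_leqif_sup DPT) rDP.
have /sub_addsmxP[[a b] /= vE] : (v *m T <= D + P)%MS by apply: submx_trans (submxMl _ _) TDP.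
have xi0 : xi != 0.
  apply/eqP => xi0; move: xxi; rewrite {1}xi0 form0l => /eqP.
  by rewrite eq_sym oner_eq0.
have Pxi : (P <= xi)%MS by rewrite -(mxrank_leqif_sup xi_sub) rank_rV xi0 rP.
have /sub_rVP[k kE] : (b *m P <= xi)%MS by apply: submx_trans (submxMl _ _) Pxi.
have xiD : form G (a *m D) xi = 0.
  rewrite (formC _ _ sG); move: (a); apply/orthP.
  by apply: submx_trans xi_sub (capmxSr _ _).
move: v0; rewrite vE formDl xiD add0r kE formZl xxi mulr1 => ->.
by rewrite scale0r addr0 submxMl.
Qed.

Lemma holo_perp_xi w : (w <= D)%MS -> form G w (- (N *m I)) = 0.
Proof.
move=> /submxP[a ->]; rewrite (formC _ _ sG); move: (a); apply/orthP.
by apply: submx_trans xi_sub (capmxSr _ _).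
Qed.

End CRLinearAlgebra.

(** * Submanifolds in charts *)

Lemma dmx_square (R : realType) m d (V W2 : set 'rV[R]_m) (W1 : set 'rV[R]_d)
    (A E : 'rV[R]_m -> 'M[R]_(m, d)) (B : 'rV[R]_d -> 'M[R]_d) (C : 'rV[R]_m -> 'M[R]_m)
    (F : 'rV[R]_m -> 'rV[R]_d) (G : 'rV[R]_m -> 'rV[R]_m) (u y : 'rV[R]_m) :
  open V -> open W1 -> open W2 -> V y ->
  smooth_on V A -> smooth_on W1 B -> smooth_on V C -> smooth_on W2 E ->
  smooth_on V F -> smooth_on V G ->
  (forall z, V z -> W1 (F z)) -> (forall z, V z -> W2 (G z)) ->
  (forall z, V z -> A z *m B (F z) = C z *m E (G z)) ->
  dmx u A y *m B (F y) + A y *m dmx (u *m jacobian F y) B (F y)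
  = dmx u C y *m E (G y) + C y *m dmx (u *m jacobian G y) E (G y).
Proof.
move=> oV oW1 oW2 Vy sA sB sC sE sF sG FW GW comm.
have sBF := smooth_comp oV oW1 FW sF sB; have sEG := smooth_comp oV oW2 GW sG sE.
have := dmx_open u oV Vy comm.
rewrite (dmx_mulmx u (smooth_diff Vy sA) (smooth_diff Vy sBF)).
rewrite (dmx_mulmx u (smooth_diff Vy sC) (smooth_diff Vy sEG)).
by rewrite (dmx_comp sF FW u Vy sB) (dmx_comp sG GW u Vy sE).
Qed.

(** [D] and [B] stand for the Jacobian of the immersion in two pairs of charts, [L] and [Q] for the
    chart changes, [P], [E], [X] for the derivatives of [D], [B], [L], and [G], [G'] for the
    connection matrices. *)
Lemma connection_change (R : realType) m d (v : 'rV[R]_m) (P D B E : 'M[R]_(m, d))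
    (X L : 'M[R]_m) (Q G G' : 'M[R]_d) :
  D *m Q = L *m B -> P *m Q + D *m (G *m Q - Q *m G') = X *m B + L *m E ->
  (v *m P + v *m D *m G) *m Q = v *m X *m B + (v *m L *m E + v *m L *m B *m G').
Proof.
move=> DL e; rewrite -(mulmxA v L B) -DL -(mulmxA v L E) -(mulmxA v X).
have -> : L *m E = P *m Q + D *m (G *m Q - Q *m G') - X *m B by rewrite e addrC addKr.
rewrite !(mulmxDl, mulmxDr, mulmxN, mulNmx) !mulmxA.
move: (v *m P *m Q) (v *m D *m G *m Q) (v *m X *m B) (v *m D *m Q *m G').
by move=> x1 x2 x3 x4; apply/rowP => i; rewrite !mxE; ring.
Qed.

(** * The second fundamental form of an immersion in arbitrary charts *)

Section Immersion.
Variables (R : realType) (m n : nat) (M : manifold R m) (M' : manifold R n.*2).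
Variables (K : kaehler M') (f : M -> M').
Hypotheses (cf : continuous f) (sf : forall p q, smooth_on (local_dom f p q) (local_map f p q)).
Implicit Types (p x : M) (q : M') (y z : 'rV[R]_m) (u v w : 'rV[R]_m).

Local Notation gc q := (form_in_chart K q).
Local Notation Jc q := (endo_in_chart (cplx K) q).

Lemma preimage_open q : open (f @^-1` cdom q).
Proof. by apply: open_comp => [x _|]; [exact: cf|exact: cdom_open]. Qed.

Lemma local_dom_open p q : open (local_dom f p q).
Proof. exact: image_open (@preimage_open q). Qed.

Lemma local_mapE p q x : cdom p x -> local_map f p q (chart p x) = chart q (f x).
Proof. by move=> px; rewrite /local_map/= chartK. Qed.

Lemma local_dom_chart p q x : cdom p x -> cdom q (f x) -> local_dom f p q (chart p x).
Proof. by move=> px qx; exists x. Qed.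

Lemma local_map_cimg p q y : local_dom f p q y -> cimg q (local_map f p q y).
Proof. by move=> [x [px qx] <-]; rewrite local_mapE//; exact: chart_cimg. Qed.

Lemma smooth_local_jac p q : smooth_on (local_dom f p q) (jacobian (local_map f p q)).
Proof. exact: (smooth_jacobian (@local_dom_open p q) (sf p q)). Qed.

Section At.
Variables (p : M) (q : M') (x : M).
Hypotheses (px : cdom p x) (qx : cdom q (f x)).

Let F := local_map f p q.
Let FX := local_map f x (f x).
Let yx := chart x x.
Let y := chart p x.
Let V : set 'rV[R]_m :=
  chart x @` (cdom x `&` (cdom p `&` (f @^-1` cdom (f x) `&` f @^-1` cdom q))).
Let L := tr x p x.
Let Q := tr (f x) q (f x).
Let psp := transition x p.
Let psq := transition (f x) q.

Let oV : open V.
Proof.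
by apply: image_open; apply: openI; [exact: cdom_open|apply: openI; exact: preimage_open].
Qed.

Let Vx : V yx.
Proof. by exists x => //; split; [exact: cdom_self|do 2 split => //; exact: cdom_self]. Qed.

Let VP z : V z -> exists x', [/\ z = chart x x', cdom x x', cdom p x',
  cdom (f x) (f x') & cdom q (f x')].
Proof. by move=> [x' [? [? [? ?]]] <-]; exists x'. Qed.

Let sFX : smooth_on V FX.
Proof.
apply: smoothS (sf x (f x)) => z /VP[x' [-> ? ? ? ?]].
exact: local_dom_chart.
Qed.

Let spsp : smooth_on V psp.
Proof.
apply: smoothS (@transition_smooth _ _ M x p) => z /VP[x' [-> ? ? ? ?]].
exact: chart_overlap.
Qed.

Let FXV z : V z -> overlap (f x) q (FX z).
Proof. by move=> /VP[x' [-> ? ? ? ?]]; rewrite /FX local_mapE//; exact: chart_overlap. Qed.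

Let pspV z : V z -> local_dom f p q (psp z).
Proof.
by move=> /VP[x' [-> ? ? ? ?]]; rewrite /psp transition_chart//; exact: local_dom_chart.
Qed.

Let pspx : psp yx = y. Proof. exact: (transition_chart p (cdom_self x)). Qed.

Let FXx : FX yx = chart (f x) (f x). Proof. exact: (local_mapE (f x) (cdom_self x)). Qed.

Let Fy : F y = chart q (f x). Proof. exact: (local_mapE q px). Qed.

Let comm z : V z -> (psq \o FX) z = (F \o psp) z.
Proof.
move=> /VP[x' [-> ? ? ? ?]]; rewrite /psq /FX /F /psp/=.
by rewrite local_mapE// !transition_chart// local_mapE.
Qed.

Let spsq : smooth_on (overlap (f x) q) psq := @transition_smooth _ _ M' (f x) q.
Let opsq : open (overlap (f x) q) := @overlap_open _ _ M' (f x) q.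

Let jac_comm z : V z -> jacobian FX z *m jacobian psq (FX z) = jacobian psp z *m jacobian F (psp z).
Proof.
move=> Vz; have d1 := smooth_diff Vz sFX; have d2 := smooth_diff (FXV Vz) spsq.
have d3 := smooth_diff Vz spsp; have d4 := smooth_diff (pspV Vz) (sf p q).
apply: etrans (esym (jacobian_comp d1 d2)) _; apply: etrans (jacobian_comp d3 d4).
by apply: (jacobian_open oV Vz comm); exact: differentiable_comp.
Qed.

Lemma differential_local : differential f x *m Q = L *m jacobian F y.
Proof. by have := jac_comm Vx; rewrite pspx FXx -!trE. Qed.

Let jac_comm2 u : dmx u (jacobian FX) yx *m Q
    + differential f x *m dmx (u *m differential f x) (jacobian psq) (chart (f x) (f x))
  = dmx u (jacobian psp) yx *m jacobian F y + L *m dmx (u *m L) (jacobian F) y.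
Proof.
have s1 := smooth_jacobian oV sFX; have s2 := smooth_jacobian opsq spsq.
have s3 := smooth_jacobian oV spsp; have s4 := smooth_local_jac p q.
have := dmx_square u oV opsq (@local_dom_open p q) Vx s1 s2 s3 s4 sFX spsp FXV pspV jac_comm.
by rewrite pspx FXx -(trE x p x) -(trE (f x) q (f x)).
Qed.

Let mo : metric_on (overlap (f x) q) (gc (f x)).
Proof. by apply: metric_onS (chart_metric K (f x)); [exact: overlap_open|exact: overlapS]. Qed.

Let chart_conn (w' : 'rV[R]_(n.*2)) : dmx w' (jacobian psq) (chart (f x) (f x))
  = gam (gc (f x)) w' (chart (f x) (f x)) *m Q - Q *m gam (gc q) (w' *m Q) (F y).
Proof.
have E (z : 'rV[R]_(n.*2)) : overlap (f x) q z -> exists r, [/\ cdom (f x) r, cdom q r & z = chart (f x) r].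
  by move=> [r [a b] <-]; exists r.
have g'E (z : 'rV[R]_(n.*2)) : overlap (f x) q z -> gc (f x) z = jacobian psq z *m gc q (psq z) *m (jacobian psq z)^T.
  move=> /E[r [a b ->]]; rewrite /psq (transition_chart q a) -(trE (f x) q r).
  exact: (gc_transition K a b).
have FU (z : 'rV[R]_(n.*2)) : overlap (f x) q z -> jacobian psq z \in unitmx.
  by move=> /E[r [a b ->]]; rewrite -(trE (f x) q r); exact: tr_unit.
have Vf := chart_overlap (cdom_self (f x)) qx.
rewrite (chart_christoffel mo (chart_metric K q) spsq (@transition_overlap _ _ M' (f x) q) g'E FU w' Vf).
by rewrite /pconn -(trE (f x) q (f x)) /psq (transition_chart q (cdom_self (f x))) Fy.
Qed.

(* the second derivatives of the chart changes of [M] only contribute tangential terms *)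
Lemma second_ff_local u v (mu : 'rV[R]_(n.*2)) :
  (forall w, form (gc q (F y)) (w *m jacobian F y) mu = 0) ->
  form (gc q (F y)) (second_ff K f x u v *m Q) mu =
  form (gc q (F y)) (cov (pconn (gc q) F) (u *m L) (fun z => v *m L *m jacobian F z) y) mu.
Proof.
move=> nmu; rewrite /second_ff -/FX -/yx /normal_part mulmxBl.
have dFX := smooth_diff Vx (smooth_jacobian oV sFX).
have -> : 'D_u (fun z => 'D_v FX z) yx = v *m dmx u (jacobian FX) yx.
  rewrite -(dmx_mull v u dFX) dmx_def; apply: (derive_open u oV Vx) => z Vz.
  by rewrite (deriveEjacobian v (smooth_diff Vz sFX)).
rewrite FXx christoffelE; last exact/chart_cimg/cdom_self.
set X := (_ + _ *m gam _ _ _); rewrite -[_ *m differential f x *m Q]mulmxA differential_local mulmxA.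
rewrite formBl nmu subr0.
have ld : local_dom f p q y by exact: local_dom_chart.
have dF := smooth_diff ld (smooth_local_jac p q).
rewrite covE (dmx_mull _ _ dF).
have -> : X *m Q = v *m dmx u (jacobian psp) yx *m jacobian F y +
   (v *m L *m dmx (u *m L) (jacobian F) y + v *m L *m jacobian F y *m pconn (gc q) F (u *m L) y).
  have pc : pconn (gc q) F (u *m L) y = gam (gc q) (u *m differential f x *m Q) (F y).
    by rewrite -(mulmxA u) differential_local mulmxA.
  have j2 := jac_comm2 u; rewrite chart_conn in j2; rewrite pc.
  exact: (connection_change v differential_local j2).
apply: etrans (formDl _ _ _ _) _; apply: etrans (congr1 (+%R^~ _) (nmu _)) _.
by rewrite add0r.
Qed.

End At.
End Immersion.

Lemma riesz_tangential (R : realType) m d (g : 'rV[R]_m -> 'M[R]_d)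
    (th : 'rV[R]_m -> 'M[R]_(m, d)) y (w : 'rV[R]_d) :
  riesz (th y *m g y *m (th y)^T) (fun v => form (g y) w (v *m th y)) = tangential g th y w.
Proof.
rewrite /riesz /tangential; congr (_ *m _); apply/rowP => k.
by rewrite mxE /Defs.form trmx_mul mulmxA trmx_delta -colE mxE.
Qed.

(** * The bundle data of the CR-submanifold over a pair of charts *)

Section Submanifold.
Variables (R : realType) (m n k : nat) (c : R).
Variables (M' : manifold R n.*2) (K : kaehler M').
Variables (M : manifold R m) (f : M -> M') (N : M -> 'rV[R]_(n.*2)).
Hypotheses (csf : complex_space_form K c) (imm : immersion f).
Hypotheses (mcr : maximal_CR_dim K f k) (mtg : mixed_totally_geodesic K f).
Hypothesis uN : unit_normal_section K f N.
Implicit Types (p x : M) (q : M') (y z u v : 'rV[R]_m).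

Local Notation gc q := (form_in_chart K q).
Local Notation Jc q := (endo_in_chart (cplx K) q).
Local Notation D x := (differential f x).
Local Notation I x := (cplx K (f x)).

Let cf : continuous f := imm.1.1.
Let sf : forall p q, smooth_on (local_dom f p q) (local_map f p q) := imm.1.2.
Let freeD x : row_free (D x) := imm.2 x.

Definition lmet p q y : 'M[R]_(n.*2) := gc q (local_map f p q y).
Definition lcplx p q y : 'M[R]_(n.*2) := Jc q (local_map f p q y).
Definition lconn p q : 'rV[R]_m -> 'rV[R]_m -> 'M[R]_(n.*2) := pconn (gc q) (local_map f p q).
Definition ljac p q : 'rV[R]_m -> 'M[R]_(m, n.*2) := jacobian (local_map f p q).
Definition lnorm p q y : 'rV[R]_(n.*2) := N (cinv p y) *m to_chart q (f (cinv p y)).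

Lemma local_kaehler p q :
  kaehler_pullback (local_dom f p q) c (lmet p q) (lcplx p q) (lconn p q) (ljac p q).
Proof.
have cimgF y := @local_map_cimg _ _ _ _ _ f p q y.
exact: (pullback_kaehler (kaehler_chart K q) (space_form_curv csf (q := q))
  (@local_dom_open _ _ _ _ _ f cf p q) (sf p q) cimgF).
Qed.

Lemma xi_ex x : exists u, u *m D x = - (N x *m I x).
Proof. by have [NP _ _] := uN.2 x; exact: (xi_tangent (cplx2 K (f x)) NP). Qed.

Lemma holo_ex x v : form (K (f x)) (v *m D x) (- (N x *m I x)) = 0 ->
  (v *m D x <= holo_dist K f x)%MS.
Proof.
have [NP _ NN] := uN.2 x; have [mk rk] := mcr; have [rD rP] := rk x.
exact: (holo_sub (kmetric_sym K _) (@kmetric_pos _ _ _ K _) (cplx2 K _) (cplx_iso K _)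
  (freeD x) rD rP mk NP NN).
Qed.

Lemma normal_form x v : form (K (f x)) (v *m D x) (N x) = 0.
Proof.
have [_ /orthP Nn _] := uN.2 x.
by rewrite (formC _ _ (kmetric_sym K _)).
Qed.

Section At.
Variables (p : M) (q : M') (x : M).
Hypotheses (px : cdom p x) (qx : cdom q (f x)).

Let y := chart p x.
Let L := tr x p x.
Let Q := tr (f x) q (f x).

Lemma lnormE : lnorm p q y = N x *m Q.
Proof. by rewrite /lnorm /y chartK// to_chartE. Qed.

Lemma lmet_form (a b : 'rV[R]_(n.*2)) :
  form (lmet p q y) (a *m Q) (b *m Q) = form (K (f x)) a b.
Proof.
rewrite /lmet /y (local_mapE f q px) form_mul.
by rewrite -(gc_transition K (cdom_self (f x)) qx) gc_center.
Qed.

Lemma lcplxE (a : 'rV[R]_(n.*2)) : a *m Q *m lcplx p q y = a *m I x *m Q.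
Proof.
rewrite /lcplx /y (local_mapE f q px) -!mulmxA; congr (_ *m _).
by rewrite -(Jc_transition K (cdom_self (f x)) qx) Jc_center.
Qed.

Lemma ljacE : L *m ljac p q y = D x *m Q.
Proof. exact: (esym (differential_local cf sf px qx)). Qed.

Let Linv : tr p x x *m L = 1%:M := tr_inv px (cdom_self x).

Lemma ljac_mul v : v *m ljac p q y = v *m tr p x x *m D x *m Q.
Proof. by rewrite -mulmxA -ljacE mulmxA -(mulmxA v) Linv mulmx1. Qed.

Lemma local_xi : - (lnorm p q y *m lcplx p q y) = - (N x *m I x) *m Q.
Proof. by rewrite lnormE lcplxE mulNmx. Qed.

Lemma local_xi_ex u : u *m D x = - (N x *m I x) ->
  u *m L *m ljac p q y = - (lnorm p q y *m lcplx p q y).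
Proof. by move=> uE; rewrite local_xi -uE -mulmxA ljacE mulmxA. Qed.

Let Qu : Q \in unitmx := tr_unit (cdom_self (f x)) qx.

Lemma at_free : row_free (ljac p q y).
Proof.
apply/row_freeP; have /row_freeP[B DB] := freeD x.
exists (invmx Q *m B *m L).
have -> : ljac p q y = tr p x x *m D x *m Q.
  by rewrite -mulmxA -ljacE mulmxA Linv mul1mx.
by rewrite !mulmxA mulmxK// -(mulmxA _ _ B) DB mulmx1.
Qed.

Lemma at_mtg u v (mu : 'rV[R]_(n.*2)) :
  u *m ljac p q y = - (lnorm p q y *m lcplx p q y) ->
  form (lmet p q y) (v *m ljac p q y) (- (lnorm p q y *m lcplx p q y)) = 0 ->
  (forall w : 'rV[R]_m, form (lmet p q y) (w *m ljac p q y) mu = 0) ->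
  form (lmet p q y) (cov (lconn p q) u (fun z => v *m ljac p q z) y) mu = 0.
Proof.
move=> uE vE nmu.
have e (a : 'rV[R]_m) : a = a *m tr p x x *m L by rewrite -mulmxA Linv mulmx1.
rewrite (e u) (e v) /lmet /lconn -(second_ff_local cf sf px qx _ _ nmu).
rewrite (mtg (u := u *m tr p x x) (v := v *m tr p x x)).
- by rewrite mul0mx form0l.
- have -> : u *m tr p x x *m D x = - (N x *m I x).
    by apply: (can_inj (mulmxK Qu)); rewrite -ljac_mul uE local_xi.
  by have [NP _ _] := uN.2 x; exact: (xi_sub (cplx2 K (f x)) NP).
- by apply: holo_ex; rewrite -lmet_form -ljac_mul -local_xi.
Qed.

Lemma at_JD v :
  form (lmet p q y) (v *m ljac p q y) (- (lnorm p q y *m lcplx p q y)) = 0 ->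
  exists w : 'rV[R]_m, w *m ljac p q y = v *m ljac p q y *m lcplx p q y.
Proof.
rewrite local_xi ljac_mul lmet_form => /holo_ex vD.
have [w wE] := holo_J (cplx2 K (f x)) vD; exists (w *m L).
by rewrite lcplxE -wE -mulmxA ljacE mulmxA.
Qed.

End At.

Lemma local_hopf_normal p q :
  hopf_normal (local_dom f p q) (lmet p q) (lcplx p q) (lconn p q) (ljac p q) (lnorm p q).
Proof.
split; first exact: uN.1 p q.
- by move=> y [x [px qx] <-]; exact: at_free.
- by move=> y [x [px qx] <-]; rewrite lnormE// lmet_form//; have [] := uN.2 x.
- by move=> y [x [px qx] <-] v; rewrite lnormE// ljac_mul// lmet_form// normal_form.
- move=> y [x [px qx] <-]; have [u uE] := xi_ex x.
  by exists (u *m tr x p x); exact: local_xi_ex.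
- by move=> y [x [px qx] <-] u v mu; exact: at_mtg.
- by move=> y [x [px qx] <-] v; exact: at_JD.
Qed.

Section Hopf.
Variables (p : M) (q : M') (x : M).
Hypotheses (px : cdom p x) (qx : cdom q (f x)).

Let y := chart p x.
Let L := tr x p x.
Let kp := local_kaehler p q.
Let hn := local_hopf_normal p q.
Let Uy : local_dom f p q y := local_dom_chart px qx.

Lemma induced_pos : posdef (induced_metric K f x).
Proof.
move=> u u0; rewrite /induced_metric -form_mul; apply: kmetric_pos.
apply: contra u0 => /eqP e; apply/eqP; apply: (row_free_inj (freeD x)).
by rewrite mul0mx.
Qed.

Lemma tan_partK u : tan_part K f x (u *m D x) = u.
Proof.
rewrite /tan_part /riesz.
have -> : (\row_j form (K (f x)) (u *m D x) (delta_mx 0 j *m D x)) = u *m induced_metric K f x.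
  apply/rowP => j; rewrite mxE form_mul -/(induced_metric K f x) /Defs.form.
  by rewrite trmx_delta -colE mxE.
by rewrite mulmxK//; exact: posdef_unit induced_pos.
Qed.

Lemma xi_tangentE : xi K f N x *m D x = - (N x *m I x).
Proof. by have [u uE] := xi_ex x; rewrite /xi -uE tan_partK. Qed.

(** The charts p and q are arbitrary, so [alpha] can be differentiated in one chart although its
    definition changes charts with x. *)
Lemma hopf_alpha : alpha K f N x =
  hopf (lmet p q) (lcplx p q) (lconn p q) (ljac p q) (lnorm p q) y.
Proof.
have xiE : xi K f N x *m L = xit (lmet p q) (lcplx p q) (ljac p q) (lnorm p q) y.
  apply: (th_inj hn Uy); rewrite (xit_th kp hn Uy) /xif.
  exact: (local_xi_ex px qx xi_tangentE).
rewrite /alpha -(lmet_form px qx) -(lnormE q px) /lmet.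
have nN w : form (lmet p q y) (w *m ljac p q y) (lnorm p q y) = 0 by exact: (hn_thN hn Uy).
rewrite (second_ff_local cf sf px qx _ _ nN) -/L xiE.
set t := xit _ _ _ _ y; have := shape_cov kp hn t t Uy.
have tE : t *m ljac p q y = xif (lcplx p q) (lnorm p q) y := xit_th kp hn Uy.
move=> e; apply: oppr_inj; apply: etrans (esym e) _.
apply: etrans (congr1 (fun a => form _ a _) tE) _.
by apply: etrans (ipC kp Uy _ _) (esym (opprK _)).
Qed.

End Hopf.

Lemma shape_opE x u : shape_op K f x (N x) u =
  shape (lmet x (f x)) (lconn x (f x)) (ljac x (f x)) (lnorm x (f x)) (chart x x) u.
Proof.
have px := cdom_self x; have qx := cdom_self (f x).
have kp := local_kaehler x (f x); have hn := local_hopf_normal x (f x).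
have Uy := local_dom_chart px qx.
have nN w : form (lmet x (f x) (chart x x)) (w *m ljac x (f x) (chart x x))
  (lnorm x (f x) (chart x x)) = 0 by exact: (hn_thN hn Uy).
have gE : lmet x (f x) (chart x x) = K (f x) by rewrite /lmet local_mapE// gc_center.
have riesz_ext l l' (G : 'M[R]_m) : (forall v, l v = l' v) -> riesz G l = riesz G l'.
  by move=> ll; congr (riesz _ _); apply/funext.
rewrite /shape_op (riesz_ext _ (fun v => form (K (f x))
  (- cov (lconn x (f x)) u (lnorm x (f x)) (chart x x)) (v *m D x))); last first.
  move=> v.
  have s1 : form (K (f x)) (second_ff K f x u v) (N x) =
      form (lmet x (f x) (chart x x))
        (cov (lconn x (f x)) u (fun z => v *m ljac x (f x) z) (chart x x))
        (lnorm x (f x) (chart x x)).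
    rewrite -(lmet_form px qx) -(lnormE (f x) px).
    apply: etrans (second_ff_local cf sf px qx u v nN) _.
    by rewrite (trI px) !mulmx1.
  apply: etrans s1 _; apply: oppr_inj; apply: etrans (esym (shape_cov kp hn u v Uy)) _.
  apply: etrans (ipC kp Uy _ _) _; rewrite gE formNl opprK.
  by [].
have := riesz_tangential (lmet x (f x)) (ljac x (f x)) (chart x x).
rewrite gE => ->; rewrite shape_def.
by rewrite /tangential !mulNmx.
Qed.

Lemma phiE x u : phi K f x u = rot (lmet x (f x)) (lcplx x (f x)) (ljac x (f x)) (chart x x) u.
Proof.
have px := cdom_self x.
have gE : lmet x (f x) (chart x x) = K (f x) by rewrite /lmet local_mapE// gc_center.
have JE : lcplx x (f x) (chart x x) = I x by rewrite /lcplx local_mapE// Jc_center.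
have := riesz_tangential (lmet x (f x)) (ljac x (f x)) (chart x x).
by rewrite gE /rot JE => <-.
Qed.

Lemma holo_eta p q x w : cdom p x -> cdom q (f x) -> (w *m D x <= holo_dist K f x)%MS ->
  eta (lmet p q) (lcplx p q) (ljac p q) (lnorm p q) (w *m tr x p x) (chart p x) = 0.
Proof.
move=> px qx wD; have [NP _ _] := uN.2 x.
rewrite /eta -[_ *m ljac p q _]mulmxA (ljacE px qx) mulmxA /xif (local_xi px qx).
rewrite (lmet_form px qx).
exact: (holo_perp_xi (kmetric_sym K (f x)) (cplx2 K (f x)) NP wD).
Qed.

Hypothesis ntr : ~ totally_real_submanifold K f.

(** The rank of D is the same at all points, so D is nonzero everywhere once it is nonzero
    somewhere. *)
Lemma holo_nontrivial x : exists2 u : 'rV[R]_m, (u *m D x <= holo_dist K f x)%MS & u != 0.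
Proof.
have [_ rk] := mcr.
have k0 : k != 0%N.
  apply/eqP => k0; apply: ntr => x'; apply/eqP; rewrite -mxrank_eq0.
  by have [-> _] := rk x'; rewrite k0.
have : holo_dist K f x != 0.
  by rewrite -mxrank_eq0; have [-> _] := rk x; rewrite double_eq0.
move=> /rowV0Pn[w wD w0].
have /submxP[u uE] : (w <= D x)%MS by apply: submx_trans wD (capmxSl _ _).
exists u; first by rewrite -uE.
by apply: contra w0 => /eqP u0; rewrite uE u0 mul0mx.
Qed.

Lemma local_holo_nontrivial p q y : local_dom f p q y ->
  exists2 u, eta (lmet p q) (lcplx p q) (ljac p q) (lnorm p q) u y = 0 & u != 0.
Proof.
move=> [x [px qx] <-]; have [u uD u0] := holo_nontrivial x.
exists (u *m tr x p x); first exact: holo_eta.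
apply: contra u0 => /eqP e; have := congr1 (mulmx^~ (tr p x x)) e.
by rewrite /= -mulmxA (tr_inv (cdom_self x) px) mulmx1 mul0mx => ->.
Qed.

Lemma local_hopf_constant p q y : c != 0 -> local_dom f p q y ->
  \forall z \near y, hopf (lmet p q) (lcplx p q) (lconn p q) (ljac p q) (lnorm p q) z
    = hopf (lmet p q) (lcplx p q) (lconn p q) (ljac p q) (lnorm p q) y.
Proof.
move=> c0 Uy; have kp := local_kaehler p q; have hn := local_hopf_normal p q.
have sh := smooth_hopf kp hn; have oU := kp_open kp.
apply: (zero_derivative oU Uy) => [z Uz|z v Uz]; first exact: (smooth_diff Uz sh).
apply: etrans (esym (dsc_def _ _ _)) _.
exact: (hopf_const v c0 kp hn (@local_holo_nontrivial p q) Uz).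
Qed.

Lemma chart_preimage_nbhs p (A : set 'rV[R]_m) x : cdom p x ->
  nbhs (chart p x) A -> nbhs x (chart p @^-1` A).
Proof.
move=> px nA; have := @chart_continuous _ _ M p.
rewrite continuous_open_subspace; last exact: cdom_open.
by move=> /(_ x); rewrite inE => /(_ px); exact.
Qed.

Lemma alpha_locally_constant x : c != 0 ->
  \forall x' \near x, alpha K f N x' = alpha K f N x.
Proof.
move=> c0; have px := cdom_self x; have qx := cdom_self (f x).
have n0 := chart_preimage_nbhs px (local_hopf_constant c0 (local_dom_chart px qx)).
have n1 := open_nbhs_nbhs (conj (@cdom_open _ _ M x) px).
have n2 := open_nbhs_nbhs (conj (@preimage_open _ _ _ _ _ f cf (f x)) qx).
apply: filterS3 n0 n1 n2 => x' e x'x x'q.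
apply: etrans (hopf_alpha x'x x'q) _; apply: etrans (esym (hopf_alpha px qx)).
exact: e.
Qed.

Lemma alpha_constant : c != 0 -> connected [set: M] ->
  exists a, forall x, alpha K f N x = a.
Proof.
(* An empty manifold counts as connected; any constant serves there. *)
move=> c0 cM; have [[x0 _]|M0] := pselect (exists x : M, True); last first.
  by exists 0 => x; exfalso; apply: M0; exists x.
exists (alpha K f N x0) => x; pose B := [set x' | alpha K f N x' = alpha K f N x0].
have oB (a : R) : open [set x' | alpha K f N x' = a].
  rewrite openE => x' /= x'a; apply: filterS (alpha_locally_constant x' c0) => z.
  by rewrite x'a.
have clB : closed B.
  rewrite -openC openE => x' /= x'B.
  apply: filterS (alpha_locally_constant x' c0) => z ze zB; apply: x'B.
  exact: etrans (esym ze) zB.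
have -> : alpha K f N x = alpha K f N x0 <-> B x by [].
rewrite (cM B); first by [].
- by exists x0.
- by exists B; rewrite ?setTI//; exact: oB.
- by exists B; rewrite ?setTI.
Qed.

End Submanifold.

Theorem lemma3p1 (R : realType) (m n p : nat) (c : R)
  (Mhat : manifold R n.*2) (K : kaehler Mhat)
  (M : manifold R m) (f : M -> Mhat) (N : M -> 'rV[R]_(n.*2)) :
  c != 0 ->
  complex_space_form K c ->
  connected [set: M] ->
  immersion f ->
  proper_CR K f ->
  maximal_CR_dim K f p ->
  mixed_totally_geodesic K f ->
  unit_normal_section K f N ->
  let A (x : M) := shape_op K f x (N x) in
  let ph (x : M) := phi K f x in
  let al (x : M) := alpha K f N x in
  [/\ (forall (x : M) (X : 'rV[R]_m),
         2 *: A x (ph x (A x X))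
         - al x *: (ph x (A x X) + A x (ph x X))
         - (2 * c) *: ph x X = 0),
      (forall (Y : M -> 'rV[R]_m) (lam lam' : M -> R),
         holo_section K f Y ->
         (forall x : M, A x (Y x) = lam x *: Y x) ->
         (forall x : M, A x (ph x (Y x)) = lam' x *: ph x (Y x)) ->
         forall x : M, Y x != 0 ->
           (2 * lam x - al x) * (2 * lam' x - al x) = al x ^+ 2 + 4 * c) &
      (exists a : R, forall x : M, al x = a)].
Proof.
move=> c0 csf cM imm [_ _ ntr] mcr mtg uN A ph al.
have identity x X : 2 *: A x (ph x (A x X)) - al x *: (ph x (A x X) + A x (ph x X))
    - (2 * c) *: ph x X = 0.
  have kp := local_kaehler csf imm x (f x).
  have hn := local_hopf_normal imm mcr mtg uN x (f x).
  have Uy := local_dom_chart (f := f) (cdom_self x) (cdom_self (f x)).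
  have := hopf_identity kp hn X Uy.
  rewrite -(hopf_alpha csf imm mcr mtg uN (cdom_self x) (cdom_self (f x))).
  by rewrite -!(phiE K f) -!(shape_opE csf imm mcr mtg uN).
split=> //; last exact: (alpha_constant csf imm mcr mtg uN ntr c0 cM).
move=> Y lam lam' [_ YD] AY AphY x Y0.
(* (b) is the coefficient of phi Y in (a), so phi Y must not vanish; J is injective and preserves
   D. *)
have phY0 : ph x (Y x) != 0.
  have kp := local_kaehler csf imm x (f x).
  have hn := local_hopf_normal imm mcr mtg uN x (f x).
  have Uy := local_dom_chart (f := f) (cdom_self x) (cdom_self (f x)).
  apply: contra Y0 => /eqP; rewrite /ph phiE => e; apply/eqP.
  apply: (rot_inj0 kp hn Uy _ e).
  have := holo_eta imm uN (cdom_self x) (cdom_self (f x)) (YD x).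
  by rewrite (trI (cdom_self x)) mulmx1.
have phZ a u : ph x (a *: u) = a *: ph x u.
  by rewrite /ph !phiE /rot /tangential -!scalemxAl.
have := identity x (Y x); rewrite AY phZ.
have -> : A x (lam x *: ph x (Y x)) = (lam x * lam' x) *: ph x (Y x).
  have kp := local_kaehler csf imm x (f x).
  have hn := local_hopf_normal imm mcr mtg uN x (f x).
  have Uy := local_dom_chart (f := f) (cdom_self x) (cdom_self (f x)).
  rewrite -scalerA -AphY /A !(shape_opE csf imm mcr mtg uN) !shape_def.
  by rewrite (cov_scale kp _ _ Uy (hn_sN hn)) /tangential -!scalemxAl scalerN.
rewrite AphY -scalerDl !scalerA -!scalerBl => /eqP.
rewrite scaler_eq0 (negbTE phY0) orbF => /eqP e.
have e' : 2 * (lam x * lam' x) = al x * (lam x + lam' x) + 2 * c by lra.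
have -> : (2 * lam x - al x) * (2 * lam' x - al x) =
  2 * (2 * (lam x * lam' x)) - 2 * al x * (lam x + lam' x) + al x ^+ 2 by ring.
by rewrite e'; ring.
Qed.
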